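(* Let $R$ be a ring and let $\rho$ be a representation of a monoid (or a ring) $G$ over a right $R$-module $M$. Assume that one of the following holds: (i) $\mathrm{End}(M)$ has $\mathcal{P}\in\mathscr{P}_{\mathrm{disc}}\cup\mathscr{P}_{\mathrm{top}}$. (ii) There is a submonoid (or a subring) $H\subseteq G$ such that $\mathrm{End}(\rho|_H)$ has $\mathcal{P}\in\mathscr{P}_{\mathrm{disc}}$. (iii) $\mathrm{End}(M)$ is linearly topologized and Hausdorff and there is a submonoid (or a subring) $H\subseteq G$ such that $\mathrm{End}(\rho|_H)$ has $\mathcal{P}\in\mathscr{P}_{\mathrm{top}}$ with respect to the induced topology. Then $\mathrm{End}(\rho)$ has $\mathcal{P}$. Moreover, if $\mathcal{P}\in\mathscr{P}_{\mathrm{sp}}$, then $\rho$ has a Krull-Schmidt decomposition $\rho\cong\rho_1\oplus\dots\oplus\rho_t$, and $\mathrm{End}(\rho_i)$ is local and has $\mathcal{P}$ for all $1\le i\le t$.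
   Context: All rings are unital; subrings share the unity. A representation of a monoid (ring) $G$ over a right $R$-module $M$ is a monoid (ring) homomorphism $\rho:G\to\mathrm{End}(M)=\mathrm{End}(M_R)$; $\mathrm{End}(\rho)$ is the ring of $R$-endomorphisms of $M$ commuting with $\rho(g)$ for all $g\in G$, and $\rho|_H$ is the restriction to $H$. A Krull-Schmidt decomposition is a decomposition into a finite direct sum of nonzero indecomposables which is unique up to isomorphism and reordering of the summands. A topological ring is linearly topologized (LT) if it has a local basis at $0$ consisting of two-sided ideals; such a topology is called linear. $\mathscr{P}_{\mathrm{disc}}$ is the set of properties: semiprimary; right perfect; left perfect; $\pi_\infty$-regular and semiperfect; $\pi_\infty$-regular; $\pi$-regular and semiperfect; $\pi$-regular. $\mathscr{P}_{\mathrm{top}}$ is the set of properties of LT rings: pro-$\mathcal{Q}$, and pro-$\mathcal{Q}$ and semiperfect, for $\mathcal{Q}\in\mathscr{P}_{\mathrm{disc}}$; quasi-$\mathcal{Q}$, and quasi-$\mathcal{Q}$ and semiperfect, for $\mathcal{Q}\in\{\pi_\infty\text{-regular},\pi\text{-regular}\}$. A ring without specified topology satisfies a property in $\mathscr{P}_{\mathrm{top}}$ if it does so for some linear ring topology. $\mathscr{P}_{\mathrm{sp}}$ is the set of properties in $\mathscr{P}_{\mathrm{disc}}\cup\mathscr{P}_{\mathrm{top}}$ which imply that the ring is semiperfect. Definitions: a ring $R$ is semilocal if $R/\mathrm{Jac}(R)$ is semisimple artinian; semiperfect if semilocal and idempotents lift modulo $\mathrm{Jac}(R)$; semiprimary if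 semilocal with $\mathrm{Jac}(R)$ nilpotent; right (left) perfect if semilocal and for every sequence $x_1,x_2,\dots\in\mathrm{Jac}(R)$ the sequence $x_1,x_2x_1,x_3x_2x_1,\dots$ (resp. $x_1,x_1x_2,x_1x_2x_3,\dots$) eventually vanishes. $R$ is $\pi$-regular if for every $a\in R$ the chain $aR\supseteq a^2R\supseteq\cdots$ stabilizes; $\pi_\infty$-regular if $\mathrm{M}_n(R)$ is $\pi$-regular for all $n$. A topological ring is pro-$\mathcal{Q}$ if it is isomorphic as a topological ring to the inverse limit of an inverse system of discrete rings satisfying $\mathcal{Q}$. A Hausdorff LT ring $R$ is quasi-$\pi$-regular if for every $a\in R$ there is an idempotent $e\in R$ such that, with $f:=1-e$: $a=eae+faf$; $eae$ is invertible in $eRe$; and $(faf)^n\to0$ as $n\to\infty$. It is quasi-$\pi_\infty$-regular if $\mathrm{M}_n(R)$, with local basis $\{\mathrm{M}_n(I):I\text{ an open ideal of }R\}$, is quasi-$\pi$-regular for all $n$. *)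

(* Defs.v *)
From HB Require Import structures.
From mathcomp Require Import all_boot all_algebra.
From mathcomp Require Import boolp classical_sets.

Set Implicit Arguments.
Unset Strict Implicit.
Unset Printing Implicit Defensive.

Import GRing.Theory.
Local Open Scope classical_set_scope.
Local Open Scope ring_scope.

(* Rings are unital, possibly zero and possibly noncommutative, hence
   [pzRingType]. *)

Section RingNotions.
Variable R : pzRingType.
Implicit Types (I J : set R).

Definition right_ideal I : Prop :=
  [/\ I 0, forall x y, I x -> I y -> I (x - y) & forall x r, I x -> I (x * r)].

Definition two_sided_ideal I : Prop :=
  right_ideal I /\ forall x r, I x -> I (r * x).

Definition maximal_right_ideal I : Prop :=
  [/\ right_ideal I, I != setT &
      forall J, right_ideal J -> I `<=` J -> J = I \/ J = setT].

Definition Jac : set R := [set x | forall I, maximal_right_ideal I -> I x].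

Definition right_artinian : Prop :=
  forall I : nat -> set R, (forall n, right_ideal (I n)) ->
    (forall n, I n.+1 `<=` I n) -> exists n, forall m, (n <= m)%N -> I m = I n.

Definition local_ring : Prop :=
  exists2 m, maximal_right_ideal m & forall n, maximal_right_ideal n -> n = m.

Definition principal (a : R) : set R := [set a * x | x in setT].

Definition pi_regular : Prop :=
  forall a : R, exists n : nat, forall m : nat, (n <= m)%N ->
    principal (a ^+ m) = principal (a ^+ n).

Definition idempotents_lift_mod_Jac : Prop :=
  forall x : R, Jac (x * x - x) -> exists e : R, e * e = e /\ Jac (e - x).

Definition Jac_nilpotent : Prop :=
  exists n : nat, forall x : 'I_n -> R,
    (forall i, Jac (x i)) -> \prod_(i < n) x i = 0.

(* [rev_ord] turns the product into x_{n-1} * ... * x_1 * x_0. *)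
Definition Jac_right_T_nilpotent : Prop :=
  forall x : nat -> R, (forall i, Jac (x i)) ->
    exists N, forall n, (N <= n)%N -> \prod_(i < n) x (rev_ord i) = 0.

Definition Jac_left_T_nilpotent : Prop :=
  forall x : nat -> R, (forall i, Jac (x i)) ->
    exists N, forall n, (N <= n)%N -> \prod_(i < n) x i = 0.

End RingNotions.

Definition semisimple_artinian (R : pzRingType) : Prop :=
  right_artinian R /\ @Jac R = [set 0].

(* The quotient R/I is presented, up to its unique isomorphism, as the target
   of a surjective ring homomorphism with kernel I. *)
Definition is_quotient (R S : pzRingType) (I : set R)
    (p : {rmorphism R -> S}) : Prop :=
  (forall y : S, exists x : R, p x = y) /\ [set x | p x = 0] = I.

Definition semilocal (R : pzRingType) : Prop :=
  exists (S : pzRingType) (p : {rmorphism R -> S}),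
    is_quotient (@Jac R) p /\ semisimple_artinian S.

Definition semiperfect (R : pzRingType) : Prop :=
  semilocal R /\ idempotents_lift_mod_Jac R.

Definition semiprimary (R : pzRingType) : Prop :=
  semilocal R /\ Jac_nilpotent R.

Definition right_perfect (R : pzRingType) : Prop :=
  semilocal R /\ Jac_right_T_nilpotent R.

Definition left_perfect (R : pzRingType) : Prop :=
  semilocal R /\ Jac_left_T_nilpotent R.

Definition pi_inf_regular (R : pzRingType) : Prop :=
  forall n : nat, pi_regular ('M[R]_n).

(* P_disc *)
Inductive disc_property :=
| Semiprimary
| RightPerfect
| LeftPerfect
| PiInfRegularSemiperfect
| PiInfRegular
| PiRegularSemiperfect
| PiRegular.

Definition has_disc (Q : disc_property) (R : pzRingType) : Prop :=
  match Q with
  | Semiprimary => semiprimary R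
  | RightPerfect => right_perfect R
  | LeftPerfect => left_perfect R
  | PiInfRegularSemiperfect => pi_inf_regular R /\ semiperfect R
  | PiInfRegular => pi_inf_regular R
  | PiRegularSemiperfect => pi_regular R /\ semiperfect R
  | PiRegular => pi_regular R
  end.

(* A ring must be allowed to carry several topologies, so a topology is an
   explicit family of open sets instead of a canonical structure. *)

Definition is_topology (T : Type) (tau : set (set T)) : Prop :=
  [/\ tau setT,
      forall U V, tau U -> tau V -> tau (U `&` V) &
      forall F : set (set T), F `<=` tau -> tau (\bigcup_(U in F) U)].

Definition continuous1 (T : Type) (tau : set (set T)) (f : T -> T) : Prop :=
  forall U, tau U -> tau (f @^-1` U).

Definition continuous2 (T : Type) (tau : set (set T)) (op : T -> T -> T) :
    Prop :=
  forall U x y, tau U -> U (op x y) ->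
    exists V W, [/\ tau V, tau W, V x, W y &
                    forall v w, V v -> W w -> U (op v w)].

Definition hausdorff (T : Type) (tau : set (set T)) : Prop :=
  forall x y, x <> y ->
    exists U V, [/\ tau U, tau V, U x, V y & U `&` V = set0].

Definition initial_topology (S T : Type) (f : S -> T) (tau : set (set T)) :
    set (set S) :=
  [set f @^-1` V | V in tau].

Section LinearTopology.
Variable R : pzRingType.
Implicit Types tau : set (set R).

Definition ring_topology tau : Prop :=
  [/\ is_topology tau, continuous2 tau +%R, continuous1 tau -%R &
      continuous2 tau *%R].

Definition linear_topology tau : Prop :=
  ring_topology tau /\
  forall U, tau U -> U 0 -> exists I, [/\ tau I, two_sided_ideal I & I `<=` U].

Definition tends_to_0 tau (u : nat -> R) : Prop :=
  forall U, tau U -> U 0 -> exists N, forall n, (N <= n)%N -> U (u n).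

Definition quasi_pi_regular tau : Prop :=
  [/\ linear_topology tau, hausdorff tau &
      forall a : R, exists e : R, let f := 1 - e in
        [/\ e * e = e,
            a = e * a * e + f * a * f,
            exists b, [/\ e * b * e = b, (e * a * e) * b = e &
                          b * (e * a * e) = e] &
            tends_to_0 tau (fun n => (f * a * f) ^+ n)]].

(* The translation invariant topology on n x n matrices with local basis
   M_n(I), I an open ideal of R. *)
Definition matrix_topology tau (n : nat) : set (set 'M[R]_n) :=
  [set U : set 'M[R]_n | forall A : 'M[R]_n, U A -> exists I : set R,
     [/\ tau I, two_sided_ideal I &
         forall B : 'M[R]_n, (forall i j, I (B i j - A i j)) -> U B]].

End LinearTopology.

Definition quasi_pi_inf_regular (R : pzRingType) (tau : set (set R)) : Prop :=
  [/\ linear_topology tau, hausdorff tau &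
      forall n, quasi_pi_regular (@matrix_topology R tau n)].

Record inverse_system (I : choiceType) := InverseSystem {
  sys_le : I -> I -> Prop;
  sys_inhabited : inhabited I;
  sys_le_refl : forall i, sys_le i i;
  sys_le_trans : forall i j k, sys_le i j -> sys_le j k -> sys_le i k;
  sys_directed : forall i j, exists k, sys_le i k /\ sys_le j k;
  sys_ring : I -> pzRingType;
  sys_map : forall i j, sys_le i j -> {rmorphism sys_ring j -> sys_ring i};
  sys_map_id : forall i (h : sys_le i i) x, sys_map h x = x;
  sys_map_comp : forall i j k (hij : sys_le i j) (hjk : sys_le j k)
    (hik : sys_le i k) x, sys_map hij (sys_map hjk x) = sys_map hik x
}.

Definition inverse_limit (I : choiceType) (S : inverse_system I) :
    set (forall i, sys_ring S i) :=
  [set x | forall i j (h : sys_le S i j), sys_map h (x j) = x i].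
Arguments inverse_limit {I} S _.

(* [p] collects the coordinates of a map R -> prod_i S_i. It is an isomorphism
   of topological rings onto the inverse limit when it is injective with image
   the limit, and the open sets of R are those of the product topology of the
   discrete S_i, whose basic neighbourhoods fix finitely many coordinates. *)
Definition is_inverse_limit_of (R : pzRingType) (tau : set (set R))
    (I : choiceType) (S : inverse_system I) : Prop :=
  exists p : forall i, {rmorphism R -> sys_ring S i},
    [/\ injective (fun (x : R) i => p i x),
        range (fun (x : R) i => p i x) = inverse_limit S &
        forall U : set R, tau U <->
          (forall x, U x -> exists s : seq I,
             forall y, (forall i, i \in s -> p i y = p i x) -> U y)].

Definition pro (Q : pzRingType -> Prop) (R : pzRingType)
    (tau : set (set R)) : Prop :=
  exists (I : choiceType) (S : inverse_system I),
    (forall i, Q (sys_ring S i)) /\ is_inverse_limit_of tau S.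

(* P_top *)
Inductive top_property :=
| Pro of disc_property
| ProSemiperfect of disc_property
| QuasiPiInfRegular
| QuasiPiInfRegularSemiperfect
| QuasiPiRegular
| QuasiPiRegularSemiperfect.

Definition has_top (P : top_property) (R : pzRingType) (tau : set (set R)) :
    Prop :=
  linear_topology tau /\
  match P with
  | Pro Q => pro (has_disc Q) tau
  | ProSemiperfect Q => pro (has_disc Q) tau /\ semiperfect R
  | QuasiPiInfRegular => quasi_pi_inf_regular tau
  | QuasiPiInfRegularSemiperfect => quasi_pi_inf_regular tau /\ semiperfect R
  | QuasiPiRegular => quasi_pi_regular tau
  | QuasiPiRegularSemiperfect => quasi_pi_regular tau /\ semiperfect R
  end.

Inductive ring_property :=
| Disc of disc_property
| Top of top_property.

(* A ring without specified topology has a property of topological rings when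
   it has it for some linear ring topology. *)
Definition has_property (P : ring_property) (R : pzRingType) : Prop :=
  match P with
  | Disc Q => has_disc Q R
  | Top Q => exists tau : set (set R), has_top Q tau
  end.

(* P_sp *)
Definition implies_semiperfect (P : ring_property) : Prop :=
  forall R : pzRingType, has_property P R -> semiperfect R.

(* A right R-module is a left module over the converse ring R^c. *)

Definition endo (R : pzRingType) (M : lmodType R^c) : Type := {linear M -> M}.

Definition endo_fun (R : pzRingType) (M : lmodType R^c) (f : endo M) :
  {linear M -> M} := f.
Coercion endo_fun : endo >-> GRing.Linear.type.

Section EndoRing.
Variables (R : pzRingType) (M : lmodType R^c).
Implicit Types f g h : endo M.

HB.instance Definition _ := gen_eqMixin (endo M).
HB.instance Definition _ := gen_choiceMixin (endo M).

Lemma endoP f g : (forall x, f x = g x) -> f = g.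
Proof.
case: f g => [f [[f1] [f2]]] [g [[g1] [g2]]] /= /funext fg.
rewrite /= in fg; subst g.
by congr GRing.Linear.Pack; congr GRing.Linear.Class;
   [rewrite (Prop_irrelevance f1 g1) | rewrite (Prop_irrelevance f2 g2)].
Qed.

Definition endo0 : endo M := \0 : {linear M -> M}.
Definition endo_add f g : endo M := (f \+ g : {linear M -> M}).
Definition endo_opp f : endo M := (\- f : {linear M -> M}).
Definition endo1 : endo M := (idfun : {linear M -> M}).
Definition endo_mul f g : endo M := (f \o g : {linear M -> M}).

Fact endo_addA : associative endo_add.
Proof. by move=> f g h; apply: endoP => x; exact: addrA. Qed.
Fact endo_addC : commutative endo_add.
Proof. by move=> f g; apply: endoP => x; exact: addrC. Qed.
Fact endo_add0 : left_id endo0 endo_add.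
Proof. by move=> f; apply: endoP => x; exact: add0r. Qed.
Fact endo_addN : left_inverse endo0 endo_opp endo_add.
Proof. by move=> f; apply: endoP => x; exact: addNr. Qed.

HB.instance Definition _ :=
  GRing.isZmodule.Build (endo M) endo_addA endo_addC endo_add0 endo_addN.

Fact endo_mulA : associative endo_mul.
Proof. by move=> f g h; exact: endoP. Qed.
Fact endo_mul1l : left_id endo1 endo_mul.
Proof. by move=> f; exact: endoP. Qed.
Fact endo_mul1r : right_id endo1 endo_mul.
Proof. by move=> f; exact: endoP. Qed.
Fact endo_mulDl : left_distributive endo_mul +%R.
Proof. by move=> f g h; exact: endoP. Qed.
Fact endo_mulDr : right_distributive endo_mul +%R.
Proof. by move=> f g h; apply: endoP => x; exact: raddfD. Qed.

HB.instance Definition _ := GRing.Zmodule_isPzRing.Build (endo M)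
  endo_mulA endo_mul1l endo_mul1r endo_mulDl endo_mulDr.

End EndoRing.

Inductive monoid_or_ring :=
| AMonoid of monoidType
| ARing of pzRingType.

Definition carrier (G : monoid_or_ring) : Type :=
  match G with AMonoid G => G | ARing G => G end.
Coercion carrier : monoid_or_ring >-> Sortclass.

Definition subobject (G : monoid_or_ring) : set G -> Prop :=
  match G with
  | AMonoid G => fun H : set G =>
      H 1%g /\ forall x y, H x -> H y -> H (x * y)%g
  | ARing G => fun H : set G =>
      [/\ H 1, forall x y, H x -> H y -> H (x - y) &
          forall x y, H x -> H y -> H (x * y)]
  end.

Definition is_hom (G : monoid_or_ring) (E : pzRingType) : (G -> E) -> Prop :=
  match G with
  | AMonoid G => fun rho : G -> E =>
      rho 1%g = 1 /\ forall x y, rho (x * y)%g = rho x * rho y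
  | ARing G => fun rho : G -> E =>
      [/\ rho 1 = 1, forall x y, rho (x + y) = rho x + rho y &
          forall x y, rho (x * y) = rho x * rho y]
  end.

Record representation (R : pzRingType) (G : monoid_or_ring)
    (M : lmodType R^c) := Representation {
  rep_map :> G -> endo M;
  rep_hom : is_hom rep_map
}.

(* [endrep rho H] is End(rho|_H); [endrep rho setT] is End(rho). *)
Section EndRep.
Variables (R : pzRingType) (G : monoid_or_ring) (M : lmodType R^c).
Variables (rho : representation G M) (H : set G).

Definition commutant : {pred endo M} :=
  [pred f | `[< forall g, H g -> f * rho g = rho g * f >]].

Fact commutant_subring : GRing.subring_closed commutant.
Proof.
split=> [|f g /asboolP cf /asboolP cg|f g /asboolP cf /asboolP cg];
  apply/asboolP => x Hx.
- by rewrite mul1r mulr1.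
- by rewrite mulrBl mulrBr cf ?cg.
- by rewrite -mulrA cg // mulrA cf // mulrA.
Qed.

Record endrep := EndRep { endrep_val : endo M; _ : endrep_val \in commutant }.

HB.instance Definition _ := [isSub for endrep_val].
HB.instance Definition _ := [Choice of endrep by <:].
HB.instance Definition _ := GRing.SubChoice_isSubPzRing.Build
  (endo M) commutant endrep commutant_subring.

Definition endrep_topology (tau : set (set (endo M))) : set (set endrep) :=
  initial_topology endrep_val tau.

End EndRep.

Definition rep_iso (R : pzRingType) (G : monoid_or_ring)
    (M N : lmodType R^c) (rho : representation G M) (sigma : representation G N)
    (f : {linear M -> N}) : Prop :=
  bijective f /\ forall g m, f (rho g m) = sigma g (f m).

Definition isomorphic_reps (R : pzRingType) (G : monoid_or_ring)
    (M N : lmodType R^c) (rho : representation G M)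
    (sigma : representation G N) : Prop :=
  exists f : {linear M -> N}, rep_iso rho sigma f.

Definition dsum (R : pzRingType) (t : nat) (N : 'I_t -> lmodType R^c) : Type :=
  forall i, N i.

Section DirectSum.
Variables (R : pzRingType) (t : nat) (N : 'I_t -> lmodType R^c).
Implicit Types x y z : dsum N.

HB.instance Definition _ := gen_eqMixin (dsum N).
HB.instance Definition _ := gen_choiceMixin (dsum N).

Definition dsum0 : dsum N := fun i => 0.
Definition dsum_add x y : dsum N := fun i => x i + y i.
Definition dsum_opp x : dsum N := fun i => - x i.
Definition dsum_scale (r : R^c) x : dsum N := fun i => r *: x i.

Fact dsum_addA : associative dsum_add.
Proof. by move=> x y z; apply: functional_extensionality_dep => i; exact: addrA. Qed.
Fact dsum_addC : commutative dsum_add.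
Proof. by move=> x y; apply: functional_extensionality_dep => i; exact: addrC. Qed.
Fact dsum_add0 : left_id dsum0 dsum_add.
Proof. by move=> x; apply: functional_extensionality_dep => i; exact: add0r. Qed.
Fact dsum_addN : left_inverse dsum0 dsum_opp dsum_add.
Proof. by move=> x; apply: functional_extensionality_dep => i; exact: addNr. Qed.

HB.instance Definition _ :=
  GRing.isZmodule.Build (dsum N) dsum_addA dsum_addC dsum_add0 dsum_addN.

Fact dsum_scaleA a b x : dsum_scale a (dsum_scale b x) = dsum_scale (a * b) x.
Proof. by apply: functional_extensionality_dep => i; exact: scalerA. Qed.
Fact dsum_scale1 : left_id 1 dsum_scale.
Proof. by move=> x; apply: functional_extensionality_dep => i; exact: scale1r. Qed.
Fact dsum_scaleDr : right_distributive dsum_scale +%R.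
Proof. by move=> a x y; apply: functional_extensionality_dep => i; exact: scalerDr. Qed.
Fact dsum_scaleDl x : {morph dsum_scale^~ x : a b / a + b}.
Proof. by move=> a b; apply: functional_extensionality_dep => i; exact: scalerDl. Qed.

HB.instance Definition _ := GRing.Zmodule_isLmodule.Build R^c (dsum N)
  dsum_scaleA dsum_scale1 dsum_scaleDr dsum_scaleDl.

Definition dsum_fun (f : forall i, endo (N i)) (x : dsum N) : dsum N :=
  fun i => f i (x i).

Fact dsum_fun_linear f : linear (dsum_fun f).
Proof.
by move=> a x y; apply: functional_extensionality_dep => i; exact: linearP.
Qed.

HB.instance Definition _ f :=
  GRing.isLinear.Build R^c (dsum N) (dsum N) _ (dsum_fun f) (dsum_fun_linear f).

Definition dsum_endo (f : forall i, endo (N i)) : endo (dsum N) :=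
  (dsum_fun f : {linear dsum N -> dsum N}).

Variables (G : monoid_or_ring) (rho : forall i, representation G (N i)).

Fact dsum_rep_hom : is_hom (fun g => dsum_endo (fun i => rho i g)).
Proof.
case: G rho => A r /=.
- split=> [|a b]; apply: endoP => x; apply: functional_extensionality_dep => i;
    have [r1 rM] := rep_hom (r i).
  + by rewrite /= /dsum_fun r1.
  + by rewrite /= /dsum_fun rM.
- split=> [|a b|a b]; apply: endoP => x;
    apply: functional_extensionality_dep => i;
    have [r1 rD rM] := rep_hom (r i).
  + by rewrite /= /dsum_fun r1.
  + by rewrite /= /dsum_fun rD.
  + by rewrite /= /dsum_fun rM.
Qed.

Definition dsum_rep : representation G (dsum N) := Representation dsum_rep_hom.

End DirectSum.

Record decomposition (R : pzRingType) (G : monoid_or_ring) (M : lmodType R^c)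
    (rho : representation G M) (t : nat) := Decomposition {
  summand_mod : 'I_t -> lmodType R^c;
  summand : forall i, representation G (summand_mod i);
  dec_map : {linear M -> dsum summand_mod};
  dec_iso : rep_iso rho (dsum_rep summand) dec_map
}.

Section KrullSchmidt.
Variables (R : pzRingType) (G : monoid_or_ring).

Definition zero_module (M : lmodType R^c) : Prop := forall x : M, x = 0.

Definition indecomposable (M : lmodType R^c) (rho : representation G M) :
    Prop :=
  ~ zero_module M /\
  forall D : decomposition rho 2, exists i, zero_module (summand_mod D i).

Variables (M : lmodType R^c) (rho : representation G M).

Definition krull_schmidt (t : nat) (D : decomposition rho t) : Prop :=
  (forall i, indecomposable (summand D i)) /\
  forall (t' : nat) (D' : decomposition rho t'),
    (forall i, indecomposable (summand D' i)) ->
    exists2 s : 'I_t -> 'I_t', bijective s &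
      forall i, isomorphic_reps (summand D i) (summand D' (s i)).

(* The topology on End(rho_i) induced by a topology [tau] on End(M), along the
   embedding End(rho_i) -> End(M) that sends [phi] to
   [psi = iota_i o phi o pi_i], where iota_i and pi_i are the injection and the
   projection of the i-th summand (transported along [dec_map D]). Its image
   is the corner e_i End(rho) e_i, with e_i = iota_i o pi_i. *)
Definition summand_topology (tau : set (set (endo M))) (t : nat)
    (D : decomposition rho t) (i : 'I_t) :
    set (set (endrep (summand D i) setT)) :=
  [set [set phi | exists2 psi : endo M, V psi &
          forall m, dec_map D (psi m) =
            dfwith (fun=> 0) (endrep_val phi (dec_map D m i)) :> (forall j, _)]
   | V in tau].

End KrullSchmidt.

(* Main.v *)
Require Import Defs.
From Stdlib Require Import Ncring Ncring_tac.
From HB Require Import structures.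
From mathcomp Require Import all_boot all_algebra.
From mathcomp Require Import generic_quotient boolp classical_sets.

Set Implicit Arguments.
Unset Strict Implicit.
Unset Printing Implicit Defensive.

Import GRing.Theory.
Local Open Scope classical_set_scope.
Local Open Scope ring_scope.

(* Each of the properties is expressed through generalized Drazin inverses: [R]
   is (quasi-)pi-regular when every [a] has a [b] commuting with [a] such that
   [b * a * b = b] and [a - a * a * b] is (topologically) nilpotent; in the
   discrete case this uses Dischinger's theorem on the symmetry of
   pi-regularity. Such a [b] is unique and commutes with everything that
   commutes with [a], in any overring, so it stays in [End rho] when [a] is in
   [End rho]; applied to matrix rings, this also covers pi_inf-regularity.

   If [R1] is pi-regular and embeds in a semilocal ring [R2], then [R1] has no
   infinite family of orthogonal idempotents, so it is semiperfect, and its nil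
   radical maps to a nil, hence nilpotent, subsemigroup of the semisimple ring
   [R2 / Jac R2]; this transfers the semiprimary and perfect properties. For an
   inverse limit, [R1] is the limit of its images in the given discrete rings,
   and these images inherit pi-regularity from [R1].

   The embedding need not preserve the unit, so corner rings [e * R * e] are
   treated in the same way. A semiperfect [End rho] has a decomposition of 1
   into local orthogonal idempotents; this gives the summands, whose
   uniqueness is Azumaya's exchange argument on idempotents. *)

(** * Right ideals and the Jacobson radical *)

(** An embedding [R1 -> R2] need not send [Jac R1] into [Jac R2], so T-nilpotence of the radical
    does not simply restrict. What survives is that, for one fixed [k], every product of [k]
    elements of [Jac R1] lands in [Jac R2]; sequences are therefore cut into blocks of length [k].
    For inverse limits the obstacle is completeness: a compatible family of images of [R1]
    determines an element of [R2] that is a priori only a limit of elements of [R1]. Hence [R1] has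
    to be closed in [R2], which holds for centralizers and for corners in a Hausdorff linear
    topology. In case (iii) the elements [rho g] may lie outside [End(rho|_H)], so the fact that
    they commute with a Drazin inverse is proved in [End M]; this is why the Hausdorff linear
    topology is placed there. The powers in [gdrazin] start at exponent 1 because an embedding that
    does not preserve the unit does not preserve zeroth powers. *)

#[local] Instance pzring_ops (R : pzRingType) :
  @Ring_ops R 0 1 +%R *%R (fun x y => x - y) -%R eq := {}.

#[local] Instance pzring_ring (R : pzRingType) : Ring (Ro := pzring_ops R).
Proof.
split; try by [exact: RelationClasses.eq_equivalence
              | move=> ? ? -> ? ? -> | move=> ? ? ->].
- exact: add0r.
- exact: addrC.
- exact: addrA.
- exact: mul1r.
- exact: mulr1.
- exact: mulrA.
- exact: mulrDl.
- by move=> x y z; exact: mulrDr.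
- by [].
- exact: subrr.
Qed.

Ltac ncring := non_commutative_ring.

Section RightIdeals.
Variable R : pzRingType.
Implicit Types (I J : set R) (x y z : R).

Lemma right_ideal0 I : right_ideal I -> I 0. Proof. by case. Qed.

Lemma right_idealB I x y : right_ideal I -> I x -> I y -> I (x - y).
Proof. by case=> _ + _; apply. Qed.

Lemma right_idealN I x : right_ideal I -> I x -> I (- x).
Proof. by move=> rI Ix; rewrite -[- x]add0r; apply: right_idealB => //; case: rI. Qed.

Lemma right_idealD I x y : right_ideal I -> I x -> I y -> I (x + y).
Proof.
by move=> rI Ix Iy; rewrite -[y]opprK; apply: right_idealB => //;
   exact: right_idealN.
Qed.

Lemma right_idealM I x r : right_ideal I -> I x -> I (x * r).
Proof. by case=> _ _; apply. Qed.

Lemma right_ideal1 I : right_ideal I -> I 1 -> I = setT.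
Proof.
by move=> rI I1; apply/seteqP; split=> // x _; rewrite -[x]mul1r; exact: right_idealM.
Qed.

Lemma principal_right_ideal x : right_ideal (principal x).
Proof.
split; first by exists 0; rewrite // mulr0.
- by move=> _ _ [y _ <-] [z _ <-]; exists (y - z) => //; rewrite mulrBr.
- by move=> _ r [y _ <-]; exists (y * r); rewrite // mulrA.
Qed.

Lemma maximal_right_ideal_ex x : (forall z, x * z <> 1) ->
  exists2 m, maximal_right_ideal m & m x.
Proof.
move=> xz1.
pose P (I : set R) := [/\ right_ideal I, I x & ~ I 1].
pose T := {I | P I}.
pose le (A B : T) := `[< sval A `<=` sval B >].
have T0 : T.
  exists (principal x); split; first exact: principal_right_ideal.
  - by exists 1 => //; rewrite mulr1.
  - by case=> z _ /xz1.
have [|A B C /asboolP AB /asboolP BC||A Atot|m mmax] := @Zorn T le.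
- by move=> A; apply/asboolP.
- by apply/asboolP => y /AB /BC.
- move=> A B /asboolP AB /asboolP BA.
  have eAB : sval A = sval B by apply/seteqP.
  by apply: eq_sig_hprop => // *; exact: Prop_irrelevance.
(* A nonempty chain is bounded by its union, the empty one by [T0]. *)
- have [[B0 AB0]|noA] := pselect (exists B, A B); last first.
    by exists T0 => s As; case: noA; exists s.
  have rB : [/\ right_ideal [set y | exists2 B, A B & sval B y],
      [set y | exists2 B, A B & sval B y] x &
      ~ [set y | exists2 B, A B & sval B y] 1].
    split; last by move=> [B AB B1]; case: (svalP B).
    + split; first by exists B0 => //; case: (svalP B0) => -[].
      * move=> y z [B AB By] [C AC Cz].
        have [/asboolP BC|/asboolP CB] := Atot _ _ AB AC.
          by exists C => //; apply: right_idealB => //; [case: (svalP C)|exact: BC].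
        by exists B => //; apply: right_idealB => //; [case: (svalP B)|exact: CB].
      * move=> y r [B AB By]; exists B => //.
        by apply: right_idealM => //; case: (svalP B).
    + by exists B0 => //; case: (svalP B0).
  by exists (exist P _ rB) => s As; apply/asboolP => y sy; exists s.
case: m mmax => m [rm mx m1] mmax; exists m => //; split=> //.
  by apply/eqP => mT; have nm1 := m1; apply: nm1; rewrite mT.
move=> J rJ mJ; have [J1|J1] := pselect (J 1); first by right; exact: right_ideal1.
left; have pJ : [/\ right_ideal J, J x & ~ J 1] by split=> //; exact: mJ.
have /(congr1 sval) : exist P J pJ = exist P m (And3 rm mx m1).
  by apply: mmax; apply/asboolP.
by [].
Qed.

Lemma Jac_right_ideal : right_ideal (@Jac R).
Proof.
split; first by move=> I [[]].
- by move=> x y Jx Jy I mI; apply: right_idealB; [case: mI|exact: Jx|exact: Jy].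
- by move=> x r Jx I mI; apply: right_idealM; [case: mI|exact: Jx].
Qed.

(** If [1 - x * y] has no right inverse, it lies in a maximal right ideal, which then cannot contain
    [x]. Conversely, if a maximal [I] misses [x], then [I + x * R] is everything, and
    [1 = a + x * y] puts the right invertible element [a = 1 - x * y] into [I]. *)
Lemma JacP x : Jac x <-> forall y, exists z, (1 - x * y) * z = 1.
Proof.
split=> [Jx y|xinv I mI].
  apply: contrapT => /forallNP /maximal_right_ideal_ex[m mm mxy].
  have [rm mT _] := mm; apply/(elimN eqP mT)/right_ideal1 => //.
  rewrite -(subrK (x * y) 1); apply: right_idealD => //.
  by apply: right_idealM => //; exact: Jx.
have [rI IT maxI] := mI; apply: contrapT => nIx.
pose K := [set y | exists a z, I a /\ y = a + x * z].
have rK : right_ideal K.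
  split; first by exists 0, 0; split; [exact: right_ideal0|rewrite mulr0 addr0].
  - move=> _ _ [a [z [Ia ->]]] [b [w [Ib ->]]]; exists (a - b), (z - w).
    by split; [exact: right_idealB|ncring].
  - move=> _ r [a [z [Ia ->]]]; exists (a * r), (z * r).
    by split; [exact: right_idealM|ncring].
have [|KI|KT] := maxI _ rK.
- by move=> a Ia; exists a, 0; split=> //; rewrite mulr0 addr0.
- apply: nIx; rewrite -KI; exists 0, 1.
  by split; [exact: right_ideal0|rewrite mulr1 add0r].
- have /= [a [y [Ia e1]]] : K 1 by rewrite KT.
  have [z xyz] := xinv y.
  apply: (elimN eqP IT); apply: right_ideal1 => //.
  rewrite -xyz; apply: right_idealM => //.
  by rewrite e1 addrK.
Qed.

(** A right inverse [z] of [1 - x] equals [1 + x * z], so it is right invertible as well, and its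
    right inverse must be [1 - x]. *)
Lemma Jac_inv x : Jac x -> exists z, (1 - x) * z = 1 /\ z * (1 - x) = 1.
Proof.
move=> Jx; have /(_ 1)[z] := (JacP x).1 Jx; rewrite mulr1 => xz; exists z.
split=> //; have /(_ (- z))[w zw] := (JacP x).1 Jx.
have xzE : x * z = z - 1 by rewrite -[in RHS]xz; ncring.
have zE : 1 - x * - z = z by rewrite mulrN xzE; ncring.
rewrite zE in zw; suff -> : 1 - x = w by [].
by transitivity ((1 - x) * z * w); [rewrite -mulrA zw mulr1 | rewrite xz mul1r].
Qed.

Lemma Jac_left x r : Jac x -> Jac (r * x).
Proof.
move=> Jx; apply/JacP => y.
have [|z [xz zx]] := @Jac_inv (x * (y * r)).
  exact: (right_idealM _ Jac_right_ideal).
have xyrz : x * (y * r) * z = z - 1 by rewrite -[in RHS]xz; ncring.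
(* The usual passage from an inverse [z] of [1 - s * r] to one of [1 - r * s], with [s = x * y]. *)
exists (1 + r * z * (x * y)).
transitivity (1 - r * (x * y) + r * (z - x * (y * r) * z) * (x * y)); first by ncring.
by rewrite xyrz; ncring.
Qed.

Lemma Jac_idem (e : R) : Jac e -> e * e = e -> e = 0.
Proof.
move=> /Jac_inv[z [ez _]] ee.
by rewrite -[e]mulr1 -ez mulrA mulrBr mulr1 ee subrr mul0r.
Qed.

End RightIdeals.

(** * Quotient rings and semisimple rings *)

Section QuotientRing.
Variables (R : pzRingType) (I : set R) (tI : two_sided_ideal I).
Implicit Types x y z : R.

Let rI : right_ideal I. Proof. by case: tI. Qed.
Let I0 : I 0. Proof. by case: rI. Qed.

Definition ideal_eqv x y := `[< I (x - y) >].

Fact ideal_eqv_refl : reflexive ideal_eqv.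
Proof. by move=> x; apply/asboolP; rewrite subrr. Qed.
Fact ideal_eqv_sym : symmetric ideal_eqv.
Proof.
by move=> x y; apply/asboolP/asboolP => /(right_idealN rI); rewrite opprB.
Qed.
Fact ideal_eqv_trans : transitive ideal_eqv.
Proof.
move=> y x z /asboolP xy /asboolP yz; apply/asboolP.
by have := right_idealD rI xy yz; rewrite addrA subrK.
Qed.

Definition ideal_equiv :=
  EquivRel ideal_eqv ideal_eqv_refl ideal_eqv_sym ideal_eqv_trans.

(** Needed for [R / Jac R] when idempotents are lifted, and for the images of a ring in the terms of
    an inverse system. *)
Definition quotient_ring := {eq_quot ideal_equiv}%qT.
HB.instance Definition _ := EqQuotient.on quotient_ring.
HB.instance Definition _ := Choice.on quotient_ring.

Definition qpi x : quotient_ring := (\pi_quotient_ring x)%qT.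

Lemma qpiE x y : (qpi x = qpi y) <-> I (x - y).
Proof.
split=> [/eqP|Ixy]; first by rewrite eqmodE => /asboolP.
by apply/eqP; rewrite eqmodE; apply/asboolP.
Qed.

Lemma qpi_surj (q : quotient_ring) : exists x, qpi x = q.
Proof. by exists (repr q); rewrite /qpi reprK. Qed.

Definition qadd (p q : quotient_ring) := qpi (repr p + repr q).
Definition qopp (p : quotient_ring) := qpi (- repr p).
Definition qmul (p q : quotient_ring) := qpi (repr p * repr q).

Lemma repr_qpi x : I (repr (qpi x) - x).
Proof. by apply/qpiE; rewrite /qpi reprK. Qed.

Lemma qpiD x y : qadd (qpi x) (qpi y) = qpi (x + y).
Proof.
apply/qpiE; rewrite opprD addrACA.
by apply: right_idealD => //; exact: repr_qpi.
Qed.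

Lemma qpiN x : qopp (qpi x) = qpi (- x).
Proof. by apply/qpiE; rewrite -opprD; apply: right_idealN => //; exact: repr_qpi. Qed.

Lemma qpiM x y : qmul (qpi x) (qpi y) = qpi (x * y).
Proof.
apply/qpiE; set x' := repr _; set y' := repr _.
have -> : x' * y' - x * y = (x' - x) * y' + x * (y' - y) by ncring.
apply: right_idealD => //.
  by apply: right_idealM => //; exact: repr_qpi.
by case: tI => _; apply; exact: repr_qpi.
Qed.

Fact qaddA : associative qadd.
Proof.
move=> p q r; have [[x <-] [y <-] [z <-]] := And3 (qpi_surj p) (qpi_surj q) (qpi_surj r).
by rewrite !qpiD addrA.
Qed.
Fact qaddC : commutative qadd.
Proof.
move=> p q; have [[x <-] [y <-]] := conj (qpi_surj p) (qpi_surj q).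
by rewrite !qpiD addrC.
Qed.
Fact qadd0 : left_id (qpi 0) qadd.
Proof. by move=> p; have [x <-] := qpi_surj p; rewrite qpiD add0r. Qed.
Fact qaddN : left_inverse (qpi 0) qopp qadd.
Proof. by move=> p; have [x <-] := qpi_surj p; rewrite qpiN qpiD addNr. Qed.
Fact qmulA : associative qmul.
Proof.
move=> p q r; have [[x <-] [y <-] [z <-]] := And3 (qpi_surj p) (qpi_surj q) (qpi_surj r).
by rewrite !qpiM mulrA.
Qed.
Fact qmul1l : left_id (qpi 1) qmul.
Proof. by move=> p; have [x <-] := qpi_surj p; rewrite qpiM mul1r. Qed.
Fact qmul1r : right_id (qpi 1) qmul.
Proof. by move=> p; have [x <-] := qpi_surj p; rewrite qpiM mulr1. Qed.
Fact qmulDl : left_distributive qmul qadd.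
Proof.
move=> p q r; have [[x <-] [y <-] [z <-]] := And3 (qpi_surj p) (qpi_surj q) (qpi_surj r).
by rewrite !(qpiD, qpiM) mulrDl.
Qed.
Fact qmulDr : right_distributive qmul qadd.
Proof.
move=> p q r; have [[x <-] [y <-] [z <-]] := And3 (qpi_surj p) (qpi_surj q) (qpi_surj r).
by rewrite !(qpiD, qpiM) mulrDr.
Qed.

HB.instance Definition _ :=
  GRing.isZmodule.Build quotient_ring qaddA qaddC qadd0 qaddN.
HB.instance Definition _ := GRing.Zmodule_isPzRing.Build quotient_ring
  qmulA qmul1l qmul1r qmulDl qmulDr.

Fact qpi_zmod_morphism : zmod_morphism qpi.
Proof. by move=> x y; rewrite -qpiD -qpiN. Qed.
Fact qpi_monoid_morphism : monoid_morphism qpi.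
Proof. by split=> // x y; rewrite -qpiM. Qed.
HB.instance Definition _ :=
  GRing.isZmodMorphism.Build R quotient_ring qpi qpi_zmod_morphism.
HB.instance Definition _ :=
  GRing.isMonoidMorphism.Build R quotient_ring qpi qpi_monoid_morphism.

Lemma qpi_eq0 x : qpi x = 0 <-> I x.
Proof. by rewrite -[0]/(qpi 0) qpiE subr0. Qed.

Section Lift.
Variables (S : pzRingType) (f : {rmorphism R -> S}).

Definition qlift of (forall x, I x -> f x = 0) := fun q : quotient_ring => f (repr q).

Variable f0 : forall x, I x -> f x = 0.

Lemma qliftE x : qlift f0 (qpi x) = f x.
Proof. by apply/eqP; rewrite -subr_eq0 -rmorphB f0 //; exact: repr_qpi. Qed.

Fact qlift_zmod_morphism : zmod_morphism (qlift f0).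
Proof.
move=> p q; have [[x <-] [y <-]] := conj (qpi_surj p) (qpi_surj q).
by rewrite -raddfB !qliftE raddfB.
Qed.
Fact qlift_monoid_morphism : monoid_morphism (qlift f0).
Proof.
split; first by rewrite qliftE rmorph1.
move=> p q; have [[x <-] [y <-]] := conj (qpi_surj p) (qpi_surj q).
by rewrite -rmorphM !qliftE rmorphM.
Qed.
HB.instance Definition _ :=
  GRing.isZmodMorphism.Build quotient_ring S (qlift f0) qlift_zmod_morphism.
HB.instance Definition _ :=
  GRing.isMonoidMorphism.Build quotient_ring S (qlift f0) qlift_monoid_morphism.
End Lift.

End QuotientRing.

Section Artinian.
Variable S : pzRingType.
Implicit Types (x y z : S).

(** Without a minimal member, dependent choice builds a strictly decreasing chain [u] in [F]. *)
Lemma artinian_min (F : set (set S)) : right_artinian S ->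
  (forall I, F I -> right_ideal I) -> F !=set0 ->
  exists2 I, F I & forall J, F J -> J `<=` I -> J = I.
Proof.
move=> artS Fr [I0 FI0]; apply: contrapT => nomin.
have step (I : {I | F I}) : {J : {I | F I} | sval J `<=` sval I /\ sval J <> sval I}.
  apply: cid; apply: contrapT => noJ; apply: nomin; exists (sval I); first exact: svalP.
  move=> J FJ JI; apply: contrapT => nJI; apply: noJ.
  by exists (exist _ J FJ).
pose u := fix u n := if n is n.+1 then sval (step (u n)) else exist F I0 FI0.
have [|n|n un] := artS (fun n => sval (u n)).
- by move=> n; apply/Fr/svalP.
- by case: (svalP (step (u n))).
- by case: (svalP (step (u n))) => _; apply; exact: (un n.+1 (leqnSn n)).
Qed.

Definition annr x : set S := [set y | x * y = 0].

Lemma annr_right_ideal x : right_ideal (annr x).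
Proof.
split; rewrite /annr /=; first by rewrite mulr0.
- by move=> y z xy xz; rewrite mulrBr xy xz subrr.
- by move=> y r xy; rewrite mulrA xy mul0r.
Qed.

Hypothesis ssS : semisimple_artinian S.

(** Let [K] be minimal among the nonzero right ideals inside [I]. Since [Jac S] is zero, some
    maximal [m] does not contain [K]; then [m + K] is everything, and [m] meets [K] in zero by
    minimality. The component of [1] in [K] is the idempotent sought. *)
Lemma minimal_right_ideal (I : set S) : right_ideal I -> I <> [set 0] ->
  exists2 h, h * h = h /\ h <> 0 & I h.
Proof.
move=> rI I0; have [artS JS] := ssS.
have [||K [rK KI [k Kk k0]] Kmin] := @artinian_min
  [set K | [/\ right_ideal K, K `<=` I & exists2 k, K k & k <> 0]] artS.
- by move=> K [].
- exists I; split=> //; apply: contrapT => nI; apply: I0; apply/seteqP; split=> x.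
    by move=> Ix; apply: contrapT => x0; apply: nI; exists x.
  by move=> ->; case: rI.
have : ~ @Jac S k by rewrite JS.
move=> /existsNP[m /not_implyP[mm nmk]]; have [rm mT maxm] := mm.
have [||mM|Jm] := maxm [set y | exists a b, [/\ m a, K b & y = a + b]].
- split; first by exists 0, 0; rewrite addr0; case: rm rK => ? ? ? [].
  + move=> _ _ [a [b [ma Kb ->]]] [c [d [mc Kd ->]]]; exists (a - c), (b - d).
    by split; [exact: right_idealB|exact: right_idealB|ncring].
  + move=> _ r [a [b [ma Kb ->]]]; exists (a * r), (b * r).
    by split; [exact: right_idealM|exact: right_idealM|ncring].
- by move=> a ma; exists a, 0; split; rewrite ?addr0 //; case: rK.
- by case: nmk; rewrite -mM; exists 0, k; split; rewrite ?add0r //; case: rm.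
have mK0 x : m x -> K x -> x = 0.
  move=> mx Kx; apply: contrapT => x0; apply: nmk.
  suff KE : [set y | m y /\ K y] = K by have [] : [set y | m y /\ K y] k by rewrite KE.
  apply: Kmin => [|y []//]; split.
  - split; first by split; [case: rm|case: rK].
    + by move=> y z [? ?] [? ?]; split; exact: right_idealB.
    + by move=> y r [? ?]; split; exact: right_idealM.
  - by move=> y [_ /KI].
  - by exists x.
have /= [a [h [ma Kh e1]]] : [set y | exists a b, [/\ m a, K b & y = a + b]] 1 by rewrite Jm.
have hE y : K y -> h * y = y.
  move=> Ky; apply/eqP; rewrite eq_sym -subr_eq0; apply/eqP/mK0.
  - by rewrite -{1}[y]mul1r e1 mulrDl addrK; exact: right_idealM.
  - by apply: right_idealB => //; exact: right_idealM.
exists h; last exact: KI.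
split; first exact: hE.
by move=> h0; apply: k0; rewrite -[k]hE // h0 mul0r.
Qed.

(** Take an idempotent [g] of [I] for which the intersection of [I] and [annr g] is minimal. If
    [g * x] differs from [x], this intersection contains a nonzero idempotent [h], and
    [g + h * (1 - g)] is an idempotent of [I] whose annihilator in [I] is smaller, as it no longer
    contains [h]. *)
Lemma semisimple_idem (I : set S) : right_ideal I ->
  exists2 g, I g & forall x, I x -> g * x = x.
Proof.
move=> rI; have [artS _] := ssS.
have [||_ [g [Ig gg] <-] gmin] := @artinian_min
  [set K | exists2 g, I g /\ g * g = g & I `&` annr g = K] artS.
- move=> _ [g _ <-]; split; first by split; [case: rI|rewrite /annr /= mulr0].
  + move=> y z [Iy gy] [Iz gz]; split; first exact: right_idealB.
    exact: (right_idealB (annr_right_ideal g)).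
  + move=> y r [Iy gy]; split; first exact: right_idealM.
    exact: (right_idealM _ (annr_right_ideal g)).
- by exists (I `&` annr 0); exists 0; rewrite ?mulr0 //; split=> //; case: rI.
exists g => // x Ix; apply: contrapT => gx.
have rK : right_ideal (I `&` annr g).
  split; first by split; [case: rI|rewrite /annr /= mulr0].
  + move=> y z [Iy gy] [Iz gz]; split; first exact: right_idealB.
    exact: (right_idealB (annr_right_ideal g)).
  + move=> y r [Iy gy]; split; first exact: right_idealM.
    exact: (right_idealM _ (annr_right_ideal g)).
have [|h [hh h0] [Ih gh]] := minimal_right_ideal rK.
  move=> K0; have : (I `&` annr g) (x - g * x).
    split; first by apply: right_idealB => //; exact: right_idealM.
    by rewrite /annr /= mulrBr mulrA gg subrr.
  by rewrite K0 /= => /eqP; rewrite subr_eq0 => /eqP/esym.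
rewrite /annr /= in gh; pose g' := g + h * (1 - g).
have gg' : g * g' = g by rewrite /g' mulrDr mulrA gh gg mul0r addr0.
have g'h : g' * h = h.
  have -> : g' * h = g * h + h * h - h * (g * h) by rewrite /g'; ncring.
  by rewrite gh hh mulr0 add0r subr0.
have g'g : g' * g = g.
  have -> : g' * g = g * g + h * g - h * (g * g) by rewrite /g'; ncring.
  by rewrite gg addrK.
have g'g' : g' * g' = g'.
  have -> : g' * g' = g' * g + g' * h * (1 - g) by rewrite {2}/g'; ncring.
  by rewrite g'g g'h.
have : (I `&` annr g') h.
  rewrite (gmin (I `&` annr g')) //.
  - exists g' => //; split=> //; apply: right_idealD => //; exact: right_idealM.
  - move=> y [Iy g'y]; split=> //; rewrite /annr /= in g'y *.
    by rewrite -gg' -mulrA g'y mulr0.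
by case=> _; rewrite /annr /= g'h.
Qed.

End Artinian.

(** * Nil subsemigroups of semisimple rings *)

Section Levitzki.
Variables (S : pzRingType) (N : set S).
Hypothesis ssS : semisimple_artinian S.
Hypothesis NM : forall x y, N x -> N y -> N (x * y).
Hypothesis Nnil : forall x, N x -> exists n, x ^+ n = 0.
Implicit Types (B : set S) (s : seq S).

Let inN s := forall x, x \in s -> N x.

Let annihilates k B := forall s, size s = k -> inN s ->
  forall b, B b -> (\prod_(x <- s) x) * b = 0.

Let annihilates_leq k l B : (k <= l)%N -> annihilates k B -> annihilates l B.
Proof.
move=> kl ann s sl sN b Bb.
rewrite -(cat_take_drop (l - k) s) big_cat /= -mulrA.
rewrite [X in _ * X]ann ?mulr0 //; first by rewrite size_drop sl subKn.
by move=> x /mem_drop; exact: sN.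
Qed.

Let stable B := right_ideal B /\ forall n b, N n -> B b -> B (n * b).

(* Take [B] minimal among the stable right ideals not annihilated by any power
   of [N], let [C'] be the part of [B] killed by some power of [N], and choose
   [a] in [N] with [a B + C'] minimal among those with [a B] not inside [C'].
   Then [a N a B] lies in [C'], since otherwise some [(a n) ^ k a B + C'] would
   be constant in [k]. *)
Lemma nil_semigroup_nilpotent : exists k, forall s, size s = k ->
  (forall x, x \in s -> N x) -> \prod_(x <- s) x = 0.
Proof.
have [artS _] := ssS.
apply: contrapT => nNil.
have [||B [[rB sB] Bbad] Bmin] := @artinian_min S
  [set B | stable B /\ forall k, ~ annihilates k B] artS.
- by move=> B [[]].
- exists setT; split; first by split.
  move=> k ann; apply: nNil; exists k => s sk sN.
  by rewrite -[LHS]mulr1; exact: ann.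
have Bgood C : stable C -> C `<=` B -> C <> B -> exists k, annihilates k C.
  move=> sC CB nCB; apply: contrapT => /forallNP Cbad.
  by apply: nCB; apply: Bmin.
pose C' := [set v | B v /\ exists k, annihilates k [set v]].
have C'B : C' `<=` B by move=> v [].
have sC' : stable C'.
  split; first split.
  - split; first by case: rB.
    by exists 0 => s _ _ _ ->; rewrite mulr0.
  - move=> x y [Bx [k kx]] [By [l ly]]; split; first exact: right_idealB.
    exists (maxn k l) => s sm sN _ ->; rewrite mulrBr.
    rewrite (annihilates_leq (leq_maxl k l) kx) //.
    by rewrite (annihilates_leq (leq_maxr k l) ly) // subrr.
  - move=> x r [Bx [k kx]]; split; first exact: right_idealM.
    by exists k => s sk sN _ ->; rewrite mulrA (kx s sk sN x) // mul0r.
  - move=> n x Nn [Bx [k kx]]; split; first exact: sB.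
    exists k => s sk sN _ ->; rewrite mulrA.
    have -> : (\prod_(y <- s) y) * n = \prod_(y <- rcons s n) y.
      by rewrite -cats1 big_cat big_seq1.
    apply: (annihilates_leq (leqnSn k) kx); rewrite ?size_rcons ?sk // => y.
    by rewrite mem_rcons inE => /orP[/eqP ->|/sN].
have nC'B : C' <> B.
  (* The left identity [g] of [B] makes the exponent uniform: a power of [N] that kills [g] kills
     every [b = g * b]. *)
  move=> C'eB; have [g Bg gB] := semisimple_idem ssS rB.
  have [_ [k kg]] : C' g by rewrite C'eB.
  by apply: (Bbad k) => s sk sN b Bb; rewrite -(gB b Bb) mulrA kg ?mul0r.
have [j jC'] := Bgood _ sC' C'B nC'B.
have [a0 [Na0 [b0 Bb0 nb0]]] : exists a, N a /\ exists2 b, B b & ~ C' (a * b).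
  apply: contrapT => noa; apply: (Bbad j.+1) => s sj sN b Bb.
  case: s sj sN => // x s [sj] sN; move: sN.
  rewrite lastI => sN.
  rewrite -cats1 big_cat /= big_seq1 -mulrA; apply: jC'.
  - by rewrite size_belast.
  - by move=> y ys; apply: sN; rewrite mem_rcons inE ys orbT.
  apply: contrapT => nC'; apply: noa; exists (last x s); split; last by exists b.
  by apply: sN; rewrite mem_rcons mem_head.
pose aBC a := [set y | exists b c, [/\ B b, C' c & y = a * b + c]].
have raBC a : right_ideal (aBC a).
  have [rC' _] := sC'; split.
  - by exists 0, 0; split; rewrite ?mulr0 ?addr0 //; exact: right_ideal0.
  - move=> _ _ [b [c [Bb Cc ->]]] [b' [c' [Bb' Cc' ->]]]; exists (b - b'), (c - c').
    by split; [exact: right_idealB|exact: right_idealB|ncring].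
  - move=> _ r [b [c [Bb Cc ->]]]; exists (b * r), (c * r).
    by split; [exact: right_idealM|exact: right_idealM|ncring].
have [||_ [a [Na [b1 Bb1 nb1]] <-] amin] := @artinian_min S
  [set I | exists2 a, N a /\ (exists2 b, B b & ~ C' (a * b)) & aBC a = I] artS.
- by move=> _ [a _ <-].
- by exists (aBC a0), a0 => //; split=> //; exists b0.
have [rC' _] := sC'.
have anaC n b : N n -> B b -> C' (a * n * a * b).
  move=> Nn Bb; apply: contrapT => nC'.
  have Nan : N (a * n) by exact: NM.
  have aBCE : aBC (a * n * a) = aBC a.
    apply: amin; first by exists (a * n * a) => //; split; [exact: NM|exists b].
    move=> _ [b' [c [Bb' C'c ->]]]; exists (n * (a * b')), c; split=> //.
    + by apply: (sB) => //; exact: sB.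
    + by rewrite !mulrA.
  have step k : forall b, B b -> exists b' c, [/\ B b', C' c & a * b = (a * n) ^+ k * (a * b') + c].
    elim: k => [|k IHk] d Bd.
      by exists d, 0; split=> //; [exact: right_ideal0|rewrite mul1r addr0].
    have [d' [c [Bd' C'c adE]]] := IHk d Bd.
    have [d2 [c2 [Bd2 C'c2 ad2]]] : aBC (a * n * a) (a * d').
      by rewrite aBCE; exists d', 0; split=> //; [exact: right_ideal0|rewrite addr0].
    exists d2, ((a * n) ^+ k * c2 + c); split=> //.
      apply: right_idealD => //; elim: k {IHk adE} => [|k IHk]; first by rewrite mul1r.
      by rewrite exprS -mulrA; case: (sC') => _; apply.
    by rewrite adE ad2 exprSr; ncring.
  have [k ank] := Nnil Nan.
  have [b' [c [_ C'c]]] := step k _ Bb1.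
  by rewrite ank mul0r add0r => ab1; apply: nb1; rewrite ab1.
(* [C] differs from [B] because of [b1], so some [N ^ k] kills it. By [anaC], [C] contains every
   [n * (a * b1)] with [n] in [N]; hence [N ^ k.+1] kills [a * b1], which puts [a * b1] into [C'], a
   contradiction. *)
pose C := [set v | [/\ B v, C' (a * v) & forall n, N n -> C' (a * n * v)]].
have sC : stable C.
  split; first split.
  - by split=> [||n _]; rewrite ?mulr0; exact: right_ideal0.
  - move=> x y [Bx ax nx] [By ay ny].
    by split=> [||n Nn]; rewrite ?mulrBr; apply: right_idealB; auto.
  - by move=> x r [Bx ax nx]; split=> [||n Nn]; rewrite ?mulrA; apply: right_idealM; auto.
  - move=> n x Nn [Bx ax nx]; split=> [||m Nm].
    + exact: sB.
    + by rewrite mulrA; exact: nx.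
    + by rewrite mulrA -[a * m * n]mulrA; apply: nx; exact: NM.
have CB : C `<=` B by move=> v [].
have nCB : C <> B by move=> CeB; have [_ + _] : C b1 by rewrite CeB.
have [k kC] := Bgood _ sC CB nCB.
apply: nb1; split; first exact: sB.
exists k.+1 => s sk sN _ ->.
case: s sk sN => // x s [sk]; rewrite lastI => sN.
have Nl : N (last x s) by apply: sN; rewrite mem_rcons mem_head.
rewrite -cats1 big_cat /= big_seq1 -mulrA; apply: kC.
- by rewrite size_belast.
- by move=> y ys; apply: sN; rewrite mem_rcons inE ys orbT.
split; first by apply: (sB) => //; exact: sB.
  by rewrite !mulrA; exact: anaC.
by move=> n Nn; rewrite !mulrA -[a * n * _]mulrA; apply: anaC => //; exact: NM.
Qed.

End Levitzki.

(** * Dischinger's theorem and generalized Drazin inverses *)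

Definition right_pi (R : pzRingType) :=
  forall a : R, exists n b, a ^+ n = a ^+ n.+1 * b.

Lemma exp_stable (R : pzRingType) (a b : R) n : a ^+ n = a ^+ n.+1 * b ->
  forall k, a ^+ n = a ^+ (n + k) * b ^+ k.
Proof.
move=> anE; elim=> [|k IHk]; first by rewrite addn0 mulr1.
rewrite exprS mulrA addnS addnC.
have -> : a ^+ (k + n).+1 * b = a ^+ (n + k).
  by rewrite -addnS exprD -mulrA -anE -exprD addnC.
exact: IHk.
Qed.

Lemma pi_regularP (R : pzRingType) : pi_regular R <-> right_pi R.
Proof.
split=> piR a.
  have [n /(_ n.+1 (leqnSn n)) an] := piR a; exists n.
  have [b _ <-] : principal (a ^+ n.+1) (a ^+ n).
    by rewrite an; exists 1; rewrite ?mulr1.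
  by exists b.
have [n [b /exp_stable anE]] := piR a; exists n => m /subnKC <-.
apply/seteqP; split=> _ [x _ <-].
  by exists (a ^+ (m - n) * x); rewrite // mulrA -exprD.
by exists (b ^+ (m - n) * x); rewrite // mulrA -anE.
Qed.

Section Dischinger.
Variable R : pzRingType.
Implicit Types a b c t : R.

(* Choose [c] with [b ^+ m = b ^+ m.+1 * c] and put [t = c - a]. Then [a * t = 0]
   and [c * t = t * t], and the stabilization of the powers of [t] gives
   [a * b ^+ j * t = 0] for all [j]. *)
Lemma right_to_left_regular a b : right_pi R -> a = a * a * b ->
  a = a * b * b * (a * a).
Proof.
move=> piR aE.
have aS k : a = a ^+ k.+1 * b ^+ k.
  have := @exp_stable _ a b 1; rewrite expr1; apply.
  by rewrite expr2.
have [m [c bc]] := piR b.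
have abSc k : a * b ^+ k.+1 * c = a * b ^+ k.
  have bE : b ^+ m * b ^+ k.+1 * c = b ^+ m * b ^+ k.
    by rewrite -!exprD -addSnnS addnC exprD -mulrA -bc -exprD addnC.
  by rewrite {1}(aS m) -2!mulrA [b ^+ m * _]mulrA bE mulrA -aS.
have abc : a * b * c = a by have := abSc 0; rewrite expr1 mulr1.
have ac : a * c = a * a by rewrite {1}aE -!mulrA [a * (b * c)]mulrA abc.
pose t := c - a.
have at0 : a * t = 0 by rewrite mulrBr ac subrr.
have ct : c * t = t * t by rewrite mulrBl at0 subr0.
have tS j : t ^+ j.+1 = c ^+ j * t.
  elim: j => [|j IHj]; first by rewrite mul1r.
  by rewrite exprSr IHj -mulrA -ct mulrA -exprSr.
have abcD j l : a * b ^+ (j + l) * c ^+ l = a * b ^+ j.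
  elim: l => [|l IHl]; first by rewrite addn0 mulr1.
  by rewrite addnS [c ^+ _]exprS mulrA abSc.
have [p [s ts]] := piR t.
(* [a * b ^+ j * t] equals [a * b ^+ (j + p) * t ^+ p.+1], and stabilization rewrites [t ^+ p.+1] as
   [c ^+ (p + j.+1) * t * s ^+ j.+1]. The powers of [c] outnumber those of [b] by one, which leaves
   the factor [a * c * t = a * a * t = 0]. *)
have abt j : a * b ^+ j * t = 0.
  have tp : t ^+ p.+1 = c ^+ (p + j.+1) * t * s ^+ j.+1.
    by rewrite exprS (exp_stable ts j.+1) mulrA -exprS tS.
  rewrite -(abcD j p) -mulrA -tS tp addnS [(p + j)%N]addnC [c ^+ _]exprSr.
  have := abcD 0 (j + p)%N; rewrite add0n mulr1 => abc0.
  by rewrite !mulrA abc0 ac -[a * a * t]mulrA at0 mulr0 mul0r.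
have abSa j : a * b ^+ j.+1 * a = a * b ^+ j.
  have -> : a = c - t by rewrite /t; ncring.
  by rewrite mulrBr [c - t]subKr abt subr0 abSc.
have aba := abSa 0; have abba := abSa 1; rewrite expr1 mulr1 expr2 mulrA in aba abba.
by rewrite mulrA abba aba.
Qed.

(** The power [A = a ^+ n.+1] satisfies [A = A * A * y] and, by the previous lemma, [A = d * A * A];
    then [d * A * y] is the group inverse of [A]. *)
Lemma dischinger (a : R) : right_pi R ->
  exists n x, [/\ a ^+ n.+1 * x = x * a ^+ n.+1, x * a ^+ n.+1 * x = x &
                  a ^+ n.+1 * x * a ^+ n.+1 = a ^+ n.+1].
Proof.
move=> piR; have [m [b /exp_stable ab]] := piR a; exists m.
set A := a ^+ m.+1.
have AE : A = A * A * b ^+ m.+1.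
  by rewrite -exprD {1}/A exprS (ab m.+1) mulrA -exprS -addSn.
have := right_to_left_regular piR AE; move: (b ^+ _) AE => y.
move: (A * y * y) => d AE1 AE2.
have yd : A * y = d * A by rewrite {1}AE2 -!mulrA [A * (A * y)]mulrA -AE1.
have Ax : A * (d * A * y) = A * y by rewrite -yd !mulrA -AE1.
have xA : d * A * y * A = A * y by rewrite -[d * A * y]mulrA yd -!mulrA -AE2.
exists (d * A * y); split; first by rewrite Ax xA.
- by rewrite xA yd -mulrA Ax !mulrA.
- by rewrite Ax yd -mulrA -AE2.
Qed.

End Dischinger.

Lemma linear_tends_to_0 (R : pzRingType) (tau : set (set R)) (u : nat -> R) :
  linear_topology tau ->
  tends_to_0 tau u <->
  forall I, tau I -> two_sided_ideal I -> exists N, forall n, (N <= n)%N -> I (u n).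
Proof.
move=> [_ lin]; split=> [u0 I tI iI|u0 U tU U0].
  by apply: u0 => //; case: iI => -[].
have [I [tI iI IU]] := lin _ tU U0.
by have [N uN] := u0 _ tI iI; exists N => n /uN /IU.
Qed.

Lemma linear_separated (R : pzRingType) (tau : set (set R)) (x : R) :
  linear_topology tau -> hausdorff tau ->
  (forall I, tau I -> two_sided_ideal I -> I x) -> x = 0.
Proof.
move=> [_ lin] hd Ix; apply: contrapT => x0.
have [U [V [tU tV Ux V0 UV]]] := hd _ _ x0.
have [I [tI iI IV]] := lin _ tV V0.
suff : set0 x by [].
by rewrite -UV; split=> //; apply: IV; exact: Ix.
Qed.

(* The generalized Drazin inverse [b] of [a]: it corresponds to the idempotent
   [e = a * b] in the definition of quasi-pi-regularity. *)
Definition gdrazin (R : pzRingType) (tau : set (set R)) (a b : R) :=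
  [/\ a * b = b * a, b * a * b = b & tends_to_0 tau (fun n => (a - a * a * b) ^+ n.+1)].

Section Gdrazin.
Variables (R : pzRingType) (tau : set (set R)).
Implicit Types a b x e : R.

(** [a * b] is an idempotent commuting with [a] and [b]: on it [a] and [b] are mutually inverse, and
    on its complement [a] restricts to [a - a * a * b]. *)
Lemma gdrazin_pow a b n : a * b = b * a -> b * a * b = b ->
  [/\ a ^+ n.+1 * b ^+ n.+1 = a * b, b ^+ n.+1 * a ^+ n.+1 = a * b &
      (a - a * a * b) ^+ n.+1 = a ^+ n.+1 * (1 - a * b)].
Proof.
move=> ab bab.
have cab k l : a ^+ k * b ^+ l = b ^+ l * a ^+ k.
  by apply: commrX; apply: commr_sym; apply: commrX.
have cae k : a ^+ k * (a * b) = a * b * a ^+ k.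
  by rewrite mulrA -exprSr exprS -!mulrA; congr (_ * _); have := cab k 1; rewrite expr1.
elim: n => [|n [IH1 IH2 IH3]].
  by rewrite !expr1 -ab; split=> //; ncring.
have ee : a * b * (a * b) = a * b by rewrite -mulrA [b * _]mulrA bab.
have E1 : a ^+ n.+2 * b ^+ n.+2 = a * b.
  by rewrite exprSr [b ^+ _]exprS mulrA -[a ^+ _ * a * b]mulrA cae -mulrA IH1.
split=> //; first by rewrite -cab.
rewrite exprSr IH3 [a ^+ n.+2]exprSr -[RHS]mulrA -[LHS]mulrA; congr (_ * _).
transitivity (a - a * a * b - (a * b * a - (a * b * a) * (a * b))); first by ncring.
have -> : a * b * a = a * a * b by rewrite -mulrA -ab mulrA.
rewrite -[a * a * b]mulrA -[a * (a * b) * _]mulrA ee subrr subr0; ncring.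
Qed.

Hypotheses (lin : linear_topology tau) (hd : hausdorff tau).

(* With [e = a * b], an [x] commuting with [a] satisfies
   [e * x * (1 - e) = b ^+ n * x * (a ^+ n * (1 - e))], which tends to 0. *)
Lemma gdrazin_comm a b x : gdrazin tau a b -> x * a = a * x -> x * b = b * x.
Proof.
move=> [ab bab /linear_tends_to_0-/(_ lin) a0] xa; set e := a * b.
have xan n : x * a ^+ n = a ^+ n * x by apply: commrX.
have ex0 : e * x * (1 - e) = 0.
  apply: (linear_separated lin hd) => I tI iI.
  have [N /(_ N (leqnn N))] := a0 _ tI iI.
  have [_ e2 ->] := gdrazin_pow N ab bab.
  rewrite /e -[X in X * x]e2 -[b ^+ _ * _ * x]mulrA -xan mulrA -mulrA => Ia.
  by case: iI => _; apply.
have xe0 : (1 - e) * x * e = 0.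
  apply: (linear_separated lin hd) => I tI iI.
  have [N /(_ N (leqnn N))] := a0 _ tI iI.
  have [e1 _ ->] := gdrazin_pow N ab bab.
  have -> : (1 - e) * x * e = (1 - e) * x * (a ^+ N.+1 * b ^+ N.+1) by rewrite e1.
  rewrite /e mulrA -[(1 - _) * x * _]mulrA xan mulrA.
  have -> : (1 - a * b) * a ^+ N.+1 = a ^+ N.+1 * (1 - a * b).
    have cab : a ^+ N.+1 * b = b * a ^+ N.+1.
      by apply: commr_sym; apply: commrX; apply: commr_sym.
    by rewrite mulrBl mulrBr mul1r mulr1 mulrA -exprSr -mulrA -cab mulrA -exprS.
  by case: iI => rI _ Ia; rewrite -mulrA; apply: right_idealM.
have exe : e * x = x * e.
  by transitivity (e * x * (1 - e) - (1 - e) * x * e + x * e); [ncring|rewrite ex0 xe0; ncring].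
have be : b * e = b by rewrite /e mulrA.
have eb : e * b = b by rewrite /e ab.
have -> : x * b = b * (x * e).
  transitivity (b * a * x * b); first by rewrite -[in LHS]eb mulrA -exe /e ab.
  by rewrite -!mulrA; congr (_ * _); rewrite !mulrA xa.
by rewrite -exe mulrA be.
Qed.

(** With [e = a * b] and [e' = a * b'], the element [e * (1 - e') = b ^+ n * (a ^+ n * (1 - e'))] is
    arbitrarily small, so [e * e' = e], and symmetrically [e' * e = e']. Since [b] and [b'] commute
    by [gdrazin_comm], [e = e'], and then [b = b * e' = e * b' = b']. *)
Lemma gdrazin_uniq a b b' : gdrazin tau a b -> gdrazin tau a b' -> b = b'.
Proof.
have key c c' : gdrazin tau a c -> gdrazin tau a c' -> a * c * (a * c') = a * c.
  move=> dc dc'; have [ac cac _] := dc; have [ac' cac' /linear_tends_to_0-/(_ lin) c0] := dc'.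
  apply/eqP; rewrite eq_sym -subr_eq0; apply/eqP/(linear_separated lin hd) => I tI iI.
  have [N /(_ N (leqnn N))] := c0 _ tI iI.
  have [_ _ ->] := gdrazin_pow N ac' cac'.
  have [_ e2 _] := gdrazin_pow N ac cac.
  have -> : a * c - a * c * (a * c') = a * c * (1 - a * c') by rewrite mulrBr mulr1.
  move=> Ia; rewrite -e2 -mulrA.
  by case: iI => _; apply.
move=> db db'; have [ab bab _] := db; have [ab' bab' _] := db'.
have bb' : b' * b = b * b' by apply: (gdrazin_comm db); rewrite ab'.
have e1 := key _ _ db db'; have e2 := key _ _ db' db.
have ee' : a * b = a * b'.
  transitivity (a * a * (b * b')).
    by rewrite -[LHS]e1 -mulrA [b * (a * _)]mulrA -ab -!mulrA.
  by rewrite -[RHS]e2 -[RHS]mulrA [b' * (a * _)]mulrA -ab' -bb' -!mulrA.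
have -> : b = b * (a * b') by rewrite -ee' mulrA.
by rewrite mulrA -ab ee' ab'.
Qed.
End Gdrazin.

Lemma discrete_tends_to_0 (R : pzRingType) (u : nat -> R) :
  tends_to_0 setT u <-> exists N, forall n, (N <= n)%N -> u n = 0.
Proof.
split=> [u0|[N uN] U _ U0]; first by have [//|//|N uN] := u0 [set 0]; exists N.
by exists N => n /uN ->.
Qed.

Lemma discrete_linear (R : pzRingType) : linear_topology [set: set R].
Proof.
split; first split=> //.
- by move=> U x y _ Uxy; exists [set x], [set y]; split=> // _ _ -> ->.
- by move=> U x y _ Uxy; exists [set x], [set y]; split=> // _ _ -> ->.
move=> U _ U0; exists [set 0]; split=> //; last by move=> _ ->.
split; last by move=> _ r ->; rewrite mulr0.
by split=> // [_ _ -> ->|_ r ->]; rewrite ?subrr ?mul0r.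
Qed.

Lemma discrete_hausdorff (T : Type) : hausdorff [set: set T].
Proof.
move=> x y xy; exists [set x], [set y]; split=> //.
by apply/seteqP; split=> // z [-> /xy].
Qed.

(** The group inverse [x] of [a ^+ n.+1] is also its generalized Drazin inverse, so it commutes with
    [a], and [a ^+ n * x] is the Drazin inverse of [a]. Conversely, the vanishing of
    [a ^+ N.+1 * (1 - a * b)] is the stabilization of the powers at [N.+1]. *)
Lemma pi_gdrazin (R : pzRingType) :
  pi_regular R <-> forall a : R, exists b, gdrazin setT a b.
Proof.
rewrite pi_regularP; split=> piR a.
  have [n [x [Ax xAx AxA]]] := dischinger a piR; set A := a ^+ n.+1 in Ax xAx AxA.
  have aA : a * A = A * a by rewrite /A -exprS exprSr.
  have drx : gdrazin setT A x.
    split=> //; apply/discrete_tends_to_0; exists 0%N => m _.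
    have -> : A - A * A * x = 0 by rewrite -mulrA Ax mulrA AxA subrr.
    by rewrite expr0n.
  have ax : a * x = x * a.
    exact: (gdrazin_comm (@discrete_linear R) (@discrete_hausdorff R) drx).
  have anx : a ^+ n * x = x * a ^+ n by apply: commr_sym; apply: commrX; apply: commr_sym.
  have ab : a * (a ^+ n * x) = A * x by rewrite mulrA -exprS.
  have ba : a ^+ n * x * a = A * x by rewrite -mulrA -ax mulrA -exprSr.
  exists (a ^+ n * x).
  have cE : a * (a ^+ n * x) = a ^+ n * x * a by rewrite ab ba.
  have bab : a ^+ n * x * a * (a ^+ n * x) = a ^+ n * x.
    by rewrite ba {1}Ax anx mulrA xAx.
  split=> //; apply/discrete_tends_to_0; exists n => m nm.
  have [_ _ ->] := gdrazin_pow m cE bab.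
  have -> : a ^+ m.+1 = a ^+ (m - n) * A by rewrite -exprD addnS subnK.
  by rewrite ab -mulrA mulrBr mulr1 Ax mulrA AxA subrr mulr0.
have [b [ab bab /discrete_tends_to_0[N /(_ N (leqnn N))]]] := piR a.
have [_ _ ->] := gdrazin_pow N ab bab; rewrite mulrBr mulr1 => /eqP.
rewrite subr_eq0 => /eqP aN; exists N.+1, b.
by rewrite [a ^+ N.+2]exprSr -mulrA.
Qed.

Lemma quasi_gdrazin (R : pzRingType) (tau : set (set R)) :
  quasi_pi_regular tau <->
  [/\ linear_topology tau, hausdorff tau & forall a, exists b, gdrazin tau a b].
Proof.
split=> [[lin hd qR]|[lin hd dR]]; split=> // a.
  have [e /= [ee aE [b [ebe eaeb beae]] t0]] := qR a; set f := 1 - e in aE t0.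
  have eb : e * b = b by rewrite -ebe !mulrA ee.
  have be : b * e = b by rewrite -ebe -mulrA ee.
  have fb : f * b = 0 by rewrite mulrBl eb mul1r subrr.
  have bf : b * f = 0 by rewrite mulrBr be mulr1 subrr.
  have ff : f * f = f by rewrite /f mulrBl mul1r mulrBr mulr1 ee subrr subr0.
  have ef : e * f = 0 by rewrite /f mulrBr mulr1 ee subrr.
  have ab : a * b = e by rewrite aE mulrDl eaeb -[f * a * f * b]mulrA fb mulr0 addr0.
  have ba : b * a = e.
    by rewrite {1}aE mulrDr beae -[f * a * f]mulrA [b * (f * _)]mulrA bf mul0r addr0.
  have afE : a - a * a * b = f * a * f.
    transitivity (a * f); first by rewrite -mulrA ab /f; ncring.
    by rewrite {1}aE mulrDl -[e * a * e * f]mulrA ef mulr0 add0r -[f * a * f * f]mulrA ff.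
  exists b; split; [by rewrite ab ba|by rewrite ba|].
  move=> U tU U0; have [N uN] := t0 U tU U0; exists N => n Nn.
  by rewrite afE; apply: uN; exact: (leq_trans Nn).
have [b [ab bab t0]] := dR a; exists (a * b) => /=.
have ea : a * b * a = a * a * b by rewrite -mulrA -ab mulrA.
have be : b * (a * b) = b by rewrite mulrA.
have ee : a * b * (a * b) = a * b by rewrite -mulrA be.
have aee : a * a * b * (a * b) = a * a * b by rewrite -mulrA be.
have faf : (1 - a * b) * a * (1 - a * b) = a - a * a * b.
  transitivity (a - a * a * b - (a * b * a - a * b * a * (a * b))); first by ncring.
  by rewrite ea aee subrr subr0.
split=> //.
- by rewrite faf ea aee addrC subrK.
- have abb : a * b * b = b by rewrite {1}ab bab.
  exists b; split; first by rewrite abb be.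
  + by rewrite ea aee -[a * a * b]mulrA -mulrA abb.
  + by rewrite ea aee -mulrA mulrA -ab ee.
(* Exponents start at 0 in [quasi_pi_regular] and at 1 in [gdrazin], hence [N.+1]. *)
- move=> U tU U0; have [N uN] := t0 U tU U0; exists N.+1 => -[//|n] Nn.
  by rewrite faf; exact: uN.
Qed.

(** * T-nilpotence and the pi-regularity of perfect rings *)

Fixpoint lprod (R : pzRingType) (x : nat -> R) n :=
  if n is n.+1 then lprod x n * x n else 1.

Definition t_nilpotent (R : pzRingType) (J : set R) :=
  forall x : nat -> R, (forall i, J (x i)) -> exists n, lprod x n = 0.

Lemma lprodE (R : pzRingType) (x : nat -> R) n : \prod_(i < n) x i = lprod x n.
Proof. by elim: n => [|n IHn]; rewrite ?big_ord0 // big_ord_recr /= IHn. Qed.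

(** Reading a sequence in [R^c] reverses its products, so that a single notion of T-nilpotence
    serves both sides. *)
Lemma lprod_conv (R : pzRingType) (x : nat -> R) n :
  \prod_(i < n) x (rev_ord i) = lprod (x : nat -> R^c) n.
Proof.
elim: n => [|n IHn]; rewrite ?big_ord0 // big_ord_recl /= subSS subn0.
congr (x n * _); rewrite -IHn; apply: eq_bigr => i _.
by rewrite /= /bump /= subSS add1n.
Qed.

Lemma lprod0 (R : pzRingType) (x : nat -> R) n m : lprod x n = 0 ->
  (n <= m)%N -> lprod x m = 0.
Proof.
by move=> xn /subnKC <-; elim: (_ - _)%N => [|k IHk]; rewrite ?addn0 // addnS /= IHk mul0r.
Qed.

Lemma left_T_nilpotentP (R : pzRingType) :
  Jac_left_T_nilpotent R <-> t_nilpotent (@Jac R).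
Proof.
split=> tn x /tn [n xn]; first by exists n; rewrite -lprodE; exact: xn.
by exists n => m nm; rewrite lprodE; exact: lprod0 xn nm.
Qed.

Lemma right_T_nilpotentP (R : pzRingType) :
  Jac_right_T_nilpotent R <-> t_nilpotent (@Jac R : set R^c).
Proof.
split=> tn x /tn [n xn]; first by exists n; rewrite -lprod_conv; exact: xn.
by exists n => m nm; rewrite lprod_conv; exact: lprod0 xn nm.
Qed.

Lemma nilpotent_t_nilpotent (R : pzRingType) :
  Jac_nilpotent R -> t_nilpotent (@Jac R).
Proof. by move=> [n nil] x Jx; exists n; rewrite -lprodE; exact: nil. Qed.

Section TNilpotentPiRegular.
Variables (R : pzRingType) (J : set R).
Hypotheses (rJ : right_ideal J) (invJ : forall x, J x -> exists v, (1 - x) * v = 1).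
Hypothesis tJ : t_nilpotent (J : set R^c).

(* Starting from [a = a * a * b + j], solving for [a] repeatedly yields
   [a = a ^+ k.+2 * r k + j k] with [j k] in [J], so that [a ^+ k] is
   [j k.-1 * ... * j 0] up to a multiple of [a ^+ k.+1]. *)
Lemma t_nilpotent_right_pi (a b j : R) : J j -> a = a * a * b + j ->
  exists n c, a ^+ n = a ^+ n.+1 * c.
Proof.
move=> Jj aE.
have step k : exists r i, J i /\ a = a ^+ k.+2 * r + i.
  elim: k => [|k [r [i [Ji aE']]]]; first by exists b, j; rewrite expr2.
  have [v iv] : exists v, (1 - i * b) * v = 1 by apply: invJ; exact: right_idealM.
  exists (r * b * v), (j * v); split; first exact: right_idealM.
  have a1 : a * (1 - i * b) = a ^+ k.+3 * r * b + j.
    have aaE : a * a = a ^+ k.+3 * r + a * i by rewrite {2}aE' mulrDr mulrA -exprS.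
    by rewrite mulrBr mulr1 {1}aE aaE; ncring.
  transitivity (a * (1 - i * b) * v); first by rewrite -mulrA iv mulr1.
  by rewrite a1; ncring.
have [r /choice[i iP]] := choice step.
have [n in0] := tJ (fun k => (iP k).1).
pose L k : R := lprod (i : nat -> R^c) k.
have LS k : L k.+1 = i k * L k by [].
have key k : forall m, exists c, a ^+ (m + k) = a ^+ m * L k + a ^+ (m + k).+1 * c.
  elim: k => [|k IHk] m; first by exists 0; rewrite addn0 mulr1 mulr0 addr0.
  have [c amk] := IHk m.+1; exists (r k * L k + c).
  have aS : a ^+ m.+1 = a ^+ m * (a ^+ k.+2 * r k + i k) by rewrite exprSr -(iP k).2.
  rewrite -addSnnS amk aS LS.
  have -> : a ^+ (m.+1 + k).+1 = a ^+ m * a ^+ k.+2 by rewrite -exprD !addnS addSn.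
  by ncring.
have [c] := key n 0; rewrite [L n]in0 mulr0 !add0r add0n => an.
by exists n, c.
Qed.
End TNilpotentPiRegular.

Lemma expr_conv (R : pzRingType) (a : R) n : (a : R^c) ^+ n = a ^+ n :> R.
Proof. by elim: n => // n IHn; rewrite [RHS]exprSr exprS IHn. Qed.

(** The group inverse supplied by [dischinger] commutes with the power of [a], so it works equally
    in the opposite ring. *)
Lemma right_pi_conv (R : pzRingType) : right_pi R^c -> right_pi R.
Proof.
move=> piR a; have [n [x [Ax _ AxA]]] := dischinger (a : R^c) piR.
rewrite !expr_conv in Ax AxA; set A := a ^+ n.+1 in Ax AxA.
pose y : R := x.
have yA : y * A = A * y by exact: Ax.
have AyA : A * (y * A) = A by exact: AxA.
exists n.+1, (a ^+ n * y); rewrite mulrA -exprD addSnnS exprD -/A.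
by rewrite -mulrA -yA.
Qed.

Lemma artinian_right_pi (S : pzRingType) : right_artinian S -> right_pi S.
Proof.
move=> artS; apply/pi_regularP => a.
have [||n In] := artS (fun n => principal (a ^+ n)); last by exists n.
- by move=> n; exact: principal_right_ideal.
- by move=> n _ [x _ <-]; exists (a * x); rewrite // exprSr mulrA.
Qed.

(** Lifts the group inverse of a power of [p a] in the artinian ring [R / Jac R]. Both congruences
    are kept: one serves right perfect rings, the other left perfect rings. *)
Lemma semilocal_pi (R : pzRingType) (a : R) : semilocal R ->
  exists n b, Jac (a ^+ n.+1 - a ^+ n.+1 * a ^+ n.+1 * b) /\
              Jac (a ^+ n.+1 - b * (a ^+ n.+1 * a ^+ n.+1)).
Proof.
move=> [S [p [[psurj pJ] [artS _]]]].
have [n [x [Ax _ AxA]]] := dischinger (p a) (artinian_right_pi artS).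
have [b bx] := psurj x; subst x.
exists n, b; rewrite -pJ /= !rmorphB !rmorphM rmorphXn.
split; first by rewrite -mulrA Ax mulrA AxA subrr.
by rewrite mulrA -Ax AxA subrr.
Qed.

Lemma right_pi_exp (R : pzRingType) (a : R) n k c :
  (a ^+ n.+1) ^+ k = (a ^+ n.+1) ^+ k.+1 * c ->
  exists m b, a ^+ m = a ^+ m.+1 * b.
Proof.
rewrite -!exprM => E; exists (n.+1 * k)%N, (a ^+ n * c).
rewrite {1}E mulrA -exprD; congr (a ^+ _ * c).
by rewrite mulnS addSn addnC.
Qed.

Lemma right_perfect_pi (R : pzRingType) : right_perfect R -> pi_regular R.
Proof.
move=> [sl /right_T_nilpotentP tJ]; apply/pi_regularP => a.
have [n [b [Jb _]]] := semilocal_pi a sl.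
have [||k [c]] := @t_nilpotent_right_pi R (@Jac R) (@Jac_right_ideal R) _ tJ (a ^+ n.+1) b _ Jb.
- by move=> x /Jac_inv[v [? _]]; exists v.
- by rewrite addrC subrK.
- exact: right_pi_exp.
Qed.

(** The argument for right perfect rings carried out in [R^c], with [Jac R] itself as the right
    ideal; it is one in [R^c] by [Jac_left]. *)
Lemma left_perfect_pi (R : pzRingType) : left_perfect R -> pi_regular R.
Proof.
move=> [sl /left_T_nilpotentP tJ]; apply/pi_regularP/right_pi_conv => a.
have [n [b [_ Jb]]] := @semilocal_pi R a sl.
pose A : R := (a : R) ^+ n.+1.
have rJ : right_ideal (@Jac R : set R^c).
  split; first exact: (right_ideal0 (@Jac_right_ideal R)).
  - by move=> x y; exact: (@right_idealB R _ x y (@Jac_right_ideal R)).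
  - by move=> x r Jx; exact: (@Jac_left R x r Jx).
have tJcc : t_nilpotent (@Jac R : set (R^c)^c).
  move=> x Jx; have [m xm] := tJ x Jx; exists m.
  suff -> : lprod (x : nat -> (R^c)^c) m = lprod (x : nat -> R) m by [].
  by elim: m {xm} => //= m ->.
have [||k [c]] := @t_nilpotent_right_pi R^c _ rJ _ tJcc A b _ Jb.
- by move=> x /Jac_inv[v [_ ?]]; exists v.
- by rewrite addrC subrK.
- by rewrite /A -(@expr_conv R a n.+1); exact: right_pi_exp.
Qed.

Lemma has_disc_pi (Q : disc_property) (R : pzRingType) : has_disc Q R -> pi_regular R.
Proof.
have inf : pi_inf_regular R -> pi_regular R.
  move=> infR; apply/pi_regularP => a.
  have /pi_regularP/(_ a%:M)[n [B aB]] := infR 1%N.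
  have aX k : (a%:M : 'M[R]_1) ^+ k = (a ^+ k)%:M.
    by elim: k => [|k IHk]; rewrite ?expr0 // !exprS IHk scalar_mxM.
  exists n, (B 0 0); move/matrixP/(_ 0 0): aB; rewrite !aX !mxE big_ord1 !mxE eqxx.
  by rewrite !mulr1n.
case: Q => //=.
- move=> [sl /nilpotent_t_nilpotent /left_T_nilpotentP tJ]; exact: left_perfect_pi.
- exact: right_perfect_pi.
- exact: left_perfect_pi.
- by case=> /inf.
- by case.
Qed.

(** * Idempotents and semiperfect rings *)

Section Idempotents.
Variable R : pzRingType.
Implicit Types e g h x y z : R.

Definition orthogonal_finite := forall e : nat -> R,
  (forall i, e i * e i = e i) -> (forall i j, i != j -> e i * e j = 0) ->
  exists n, e n = 0.

Definition corner_inv e x := exists y, [/\ e * y = y, y * e = y, x * y = e & y * x = e].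

Definition primitive_idem e := [/\ e * e = e, e <> 0 &
  forall g, g * g = g -> e * g = g -> g * e = g -> g = 0 \/ g = e].

(** Locality of [e * R * e], expressed by units so that no corner ring has to be formed. *)
Definition local_idem e := [/\ e * e = e, e <> 0 &
  forall x, e * x = x -> x * e = x -> corner_inv e x \/ corner_inv e (e - x)].

Definition idem_sum (P : R -> Prop) e := exists (I : finType) (u : I -> R),
  [/\ forall i, P (u i), forall i j, i != j -> u i * u j = 0 & \sum_i u i = e].

Lemma orthogonal_sumM (I : finType) (u : I -> R) e i :
  (forall i, u i * u i = u i) -> (forall i j, i != j -> u i * u j = 0) ->
  \sum_i u i = e -> u i * e = u i /\ e * u i = u i.
Proof.
move=> uu uij <-; split.
  rewrite mulr_sumr (bigD1 i) //= uu big1 ?addr0 // => j ji.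
  by rewrite uij // eq_sym.
by rewrite mulr_suml (bigD1 i) //= uu big1 ?addr0 // => j ji; rewrite uij.
Qed.

Lemma idem_sumD (P : R -> Prop) e g : (forall x, P x -> x * x = x) ->
  e * g = 0 -> g * e = 0 -> idem_sum P e -> idem_sum P g -> idem_sum P (e + g).
Proof.
move=> Pidem eg ge [I [u [Pu uij ue]]] [J [v [Pv vij vg]]].
have uu i := Pidem _ (Pu i); have vv i := Pidem _ (Pv i).
exists (I + J)%type, (fun s => match s with inl i => u i | inr j => v j end).
split; [by case=> i; [exact: Pu|exact: Pv]|move=> [i|i] [j|j] ij|
  by rewrite big_sumType /= ue vg].
- by rewrite uij //; apply: contraNneq ij => ->.
- have [<- _] := orthogonal_sumM i uu uij ue; have [_ <-] := orthogonal_sumM j vv vij vg.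
  by rewrite mulrA -[u i * e * g]mulrA eg mulr0 mul0r.
- have [_ <-] := orthogonal_sumM j uu uij ue; have [<- _] := orthogonal_sumM i vv vij vg.
  by rewrite mulrA -[v i * g * e]mulrA ge mulr0 mul0r.
- by rewrite vij //; apply: contraNneq ij => ->.
Qed.

(** If [e] is not a sum of orthogonal primitive idempotents, it splits properly and one part is
    again not such a sum. Iterating from [1] gives a decreasing sequence [E], whose successive
    differences are nonzero and pairwise orthogonal. *)
Lemma orthogonal_finite_primitive : orthogonal_finite -> idem_sum primitive_idem 1.
Proof.
move=> fin; apply: contrapT => bad1.
pose bad e := e * e = e /\ ~ idem_sum primitive_idem e.
have step (e : {e | bad e}) : {g : {g | bad g} |
    [/\ sval e * sval g = sval g, sval g * sval e = sval g & sval e - sval g <> 0]}.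
  case: e => e [ee ebad] /=; apply: cid.
  have e0 : e <> 0.
    move=> e0; apply: ebad; exists void, (fun i : void => 0).
    by split=> [[]|[]|]; rewrite big1 // => -[].
  have [g [gg eg ge [g0 gne]]] :
      exists g, [/\ g * g = g, e * g = g, g * e = g & g <> 0 /\ g <> e].
    apply: contrapT => nog; apply: ebad; exists unit, (fun=> e).
    split=> [_|[] []//|]; last by rewrite big_const card_unit /= addr0.
    split=> // g gg eg ge; apply: contrapT => /not_orP[g0 gne].
    by apply: nog; exists g.
  have eg0 : e - g <> 0 by move=> /eqP; rewrite subr_eq0 => /eqP/esym.
  have [sg|ng] := pselect (idem_sum primitive_idem g); last first.
    by exists (exist bad g (conj gg ng)).
  have hbad : bad (e - g).
    split; first by rewrite mulrBl !mulrBr ee eg ge gg subrr subr0.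
    move=> sh; apply: ebad; rewrite -(subrK g e); apply: idem_sumD => //.
    - by move=> x [].
    - by rewrite mulrBl eg gg subrr.
    - by rewrite mulrBr ge gg subrr.
  exists (exist bad _ hbad); split=> /=.
  - by rewrite mulrBr ee eg.
  - by rewrite mulrBl ee ge.
  - by rewrite subKr.
have bad_1 : bad 1 by split=> //; rewrite mulr1.
pose E := fix E n := if n is n.+1 then sval (step (E n)) else exist bad 1 bad_1.
have EE i : sval (E i) * sval (E i) = sval (E i) by case: (svalP (E i)).
have Ele i j : (i <= j)%N ->
    sval (E i) * sval (E j) = sval (E j) /\ sval (E j) * sval (E i) = sval (E j).
  move=> /subnKC <-; elim: (j - i)%N => [|k [IH1 IH2]]; first by rewrite addn0.
  rewrite addnS /=; have [E1 E2 _] := svalP (step (E (i + k)%N)).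
  by split; [rewrite -E1 mulrA IH1|rewrite -E2 -mulrA IH2].
have [|i j|n] := fin (fun n => sval (E n) - sval (E n.+1)).
- move=> i; have [E1 E2] := Ele _ _ (leqnSn i).
  by rewrite mulrBl !mulrBr !EE E1 E2 subrr subr0.
- move=> ij.
  have key k l : (k < l)%N -> sval (E k) * sval (E l) - sval (E k.+1) * sval (E l) = 0
      /\ sval (E l) * sval (E k) - sval (E l) * sval (E k.+1) = 0.
    move=> kl; have [E1 E2] := Ele _ _ kl; have [E3 E4] := Ele _ _ (ltnW kl).
    by rewrite E1 E2 E3 E4 !subrr.
  case: ltngtP ij => // [lij|lji] _.
    by rewrite mulrBr !mulrBl (key i j lij).1 (key i j.+1 (ltnW lij)).1 subrr.
  by rewrite mulrBl !mulrBr (key j i lji).2 (key j i.+1 (ltnW lji)).2 subrr.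
- by case: (svalP (step (E n))).
Qed.

Lemma Jac_corner_inv e x : e * e = e -> Jac x -> e * x = x -> x * e = x ->
  corner_inv e (e - x).
Proof.
move=> ee /Jac_inv[z [xz zx]] ex xe; exists (e * z * e); split.
- by rewrite !mulrA ee.
- by rewrite -mulrA ee.
- have -> : (e - x) * (e * z * e) = e * ((1 - x) * z) * e.
    by rewrite !mulrA mulrBl mulrBr mulr1 ee xe ex.
  by rewrite xz mulr1 ee.
- have -> : e * z * e * (e - x) = e * (z * (1 - x)) * e.
    by rewrite -!mulrA; congr (_ * (_ * _)); rewrite mulrBl mulrBr mul1r ee xe ex.
  by rewrite zx mulr1 ee.
Qed.

(** [y * x] is an idempotent of [e * R * e], and it is nonzero because [e = x * (y * x) * y]. *)
Lemma primitive_right_inv e x y : primitive_idem e -> e * x = x -> x * e = x ->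
  e * y = y -> y * e = y -> x * y = e -> y * x = e.
Proof.
move=> [ee e0 prim] ex xe ey ye xy.
have [||||//] := prim (y * x).
- by rewrite mulrA -[y * x * y]mulrA xy ye.
- by rewrite mulrA ey.
- by rewrite -mulrA xe.
by move=> yx; case: e0; rewrite -ee -{1}xy -xy -mulrA [y * (x * y)]mulrA yx mul0r mulr0.
Qed.

(** Let [h] lift [x] in [R]. Then [h * (1 - e)] is in the radical, so [a = 1 - h * (1 - e)] is a
    unit with [h * a = h * e]. The conjugate [k] of [h] by [a] satisfies [k * e = k], and [e * k] is
    the lift in the corner. *)
Lemma idempotents_lift_corner e x : idempotents_lift_mod_Jac R -> e * e = e ->
  e * x = x -> x * e = x -> Jac (x * x - x) ->
  exists h, [/\ h * h = h, e * h = h, h * e = h & Jac (h - x)].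
Proof.
move=> lift ee ex xe /lift[h [hh hx]]; have rJ := @Jac_right_ideal R.
have Jhf : Jac (h * (1 - e)).
  have -> : h * (1 - e) = (h - x) * (1 - e).
    by rewrite [RHS]mulrBl [x * _]mulrBr xe mulr1 subrr subr0.
  exact: (right_idealM _ rJ hx).
have [z [az za]] := Jac_inv Jhf.
have ha : h * (1 - h * (1 - e)) = h * e by rewrite mulrBr mulr1 mulrA hh; ncring.
pose k := z * (h * e).
have kk : k * k = k.
  rewrite /k -{1}ha !mulrA -[z * h * _ * z]mulrA az mulr1.
  by rewrite -[z * h * h]mulrA hh.
have ke : k * e = k by rewrite /k -!mulrA ee.
have kx : Jac (k - x).
  have -> : k - x = z * (h * (1 - e)) * (h * e) + (h - x) * e.
    transitivity ((z - z * (1 - h * (1 - e))) * (h * e) + (h * e - x * e)).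
      by rewrite za xe /k; ncring.
    by ncring.
  by apply: (right_idealD rJ); apply: (right_idealM _ rJ) => //; exact: Jac_left.
exists (e * k); split.
- by rewrite mulrA -[e * k * e]mulrA ke -mulrA kk.
- by rewrite mulrA ee.
- by rewrite -mulrA ke.
- have -> : e * k - x = e * (k - x) by rewrite mulrBr ex.
  exact: Jac_left.
Qed.

(** [R / Jac R] is von Neumann regular, which gives [y] in the corner with [x * y * x] congruent to
    [x]. The idempotent class of [x * y] lifts to an idempotent [h] of the corner. If [h = 0], then
    [x] is in the radical and [e - x] is a unit; if [h = e], then [x * y] is a unit, and so is [x]
    by primitivity. *)
Lemma semiperfect_primitive_local e : semiperfect R -> primitive_idem e -> local_idem e.
Proof.
move=> [[S [p [[psurj pJ] ssS]]] lift] prim; have [ee e0 prime] := prim; split=> //.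
move=> x ex xe; have JP y : Jac y <-> p y = 0 by rewrite -pJ.
have [_ [s _ <-] gx] := semisimple_idem ssS (principal_right_ideal (p x)).
have [y0 ys] := psurj s; subst s.
pose y := e * y0 * e.
have ey : e * y = y by rewrite /y !mulrA ee.
have ye : y * e = y by rewrite /y -mulrA ee.
have xyx : p (x * y * x) = p x.
  have -> : x * y * x = x * y0 * x by rewrite /y !mulrA xe -mulrA ex.
  rewrite !rmorphM; apply: gx; exists 1; by rewrite ?mulr1.
have exy : e * (x * y) = x * y by rewrite mulrA ex.
have xye : x * y * e = x * y by rewrite -mulrA ye.
have [|h [hh eh he hxy]] := idempotents_lift_corner lift ee exy xye.
  by apply/JP; rewrite rmorphB mulrA rmorphM xyx -rmorphM subrr.
have [h0|h1] := prime h hh eh he.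
  right; apply: Jac_corner_inv => //; apply/JP; rewrite -xyx rmorphM.
  suff -> : p (x * y) = 0 by rewrite mul0r.
  apply/JP; have -> : x * y = - (h - x * y) by rewrite h0 sub0r opprK.
  exact: (right_idealN (@Jac_right_ideal R) hxy).
left; have [|||z [ez ze xyz zxy]] := @Jac_corner_inv e (h - x * y) ee.
- exact: hxy.
- by rewrite mulrBr eh exy.
- by rewrite mulrBl he xye.
rewrite h1 subKr in xyz zxy.
exists (y * z); split.
- by rewrite mulrA ey.
- by rewrite -mulrA ze.
- by rewrite mulrA.
- apply: primitive_right_inv => //; first by rewrite mulrA ey.
    by rewrite -mulrA ze.
  by rewrite mulrA.
Qed.

(** Fitting's dichotomy: for [y] in the corner, the idempotent [y * b] is [e] or [0], so [y] is a
    unit or topologically nilpotent. If [x] and [e - x] were both topologically nilpotent, the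
    binomial expansion of a high power of [e = x + (e - x)] would put [e] into every open ideal. *)
Lemma gdrazin_primitive_local (tau : set (set R)) e :
  linear_topology tau -> hausdorff tau -> (forall a, exists b, gdrazin tau a b) ->
  primitive_idem e -> local_idem e.
Proof.
move=> lin hd dr [ee e0 prime]; split=> // x ex xe.
have key y : e * y = y -> y * e = y -> corner_inv e y \/
    forall I, tau I -> two_sided_ideal I -> exists N, forall n, (N <= n)%N -> I (y ^+ n.+1).
  move=> ey ye; have [b [yb byb t0]] := dr y.
  have [|||yb0|yb1] := prime (y * b).
  - by rewrite mulrA -[y * b * y]mulrA -mulrA byb.
  - by rewrite mulrA ey.
  - by rewrite yb -mulrA ye.
  - right=> I tI iI; have [N yN] := (linear_tends_to_0 _ lin).1 t0 I tI iI.
    by exists N => n /yN; rewrite -[y * y * b]mulrA yb0 mulr0 subr0.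
  - left; exists b; rewrite -yb yb1; split=> //; first by rewrite -yb1 yb byb.
    by rewrite -yb1 mulrA byb.
have [|x0] := key x ex xe; first by left.
have [|||y0] := key (e - x); [by rewrite mulrBr ee ex|by rewrite mulrBl ee xe|by right|].
case: e0; apply: (linear_separated lin hd) => I tI iI.
have [N xN] := x0 I tI iI; have [N' yN] := y0 I tI iI.
have [rI lI] := iI.
have eX n : e ^+ n.+1 = e by elim: n => // n IHn; rewrite exprS IHn.
have cxy : GRing.comm x (e - x) by rewrite /GRing.comm mulrBr mulrBl ex xe.
rewrite -(eX (N.+1 + N'.+1)%N) -{1}(subrK x e) addrC exprDn_comm //.
apply: big_ind => [||i _]; first exact: right_ideal0.
- by move=> ? ?; exact: right_idealD.
rewrite -mulr_natr; apply: right_idealM => //.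
have [iN'|N'i] := leqP i N'.+1.
  apply: right_idealM => //.
  have -> : ((N.+1 + N'.+1).+1 - i = ((N.+1 + N'.+1) - i).+1)%N.
    by rewrite subSn // (leq_trans iN') // leq_addl.
  by apply: xN; apply: leq_trans (leq_sub2l _ iN'); rewrite addnK.
apply: lI; case: (nat_of_ord i) N'i => // k; rewrite ltnS => N'k.
by apply: yN; exact: ltnW.
Qed.

End Idempotents.

Lemma idem_sum_ord (R : pzRingType) (P : R -> Prop) e : idem_sum P e ->
  exists t (u : 'I_t -> R),
    [/\ forall i, P (u i), forall i j, i != j -> u i * u j = 0 & \sum_i u i = e].
Proof.
move=> [I [u [Pu uij ue]]]; exists #|I|, (u \o enum_val); split=> /=.
- by move=> i; exact: Pu.
- by move=> i j ij; apply: uij; apply: contraNneq ij => /enum_val_inj ->.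
- rewrite -ue (reindex (fun i : 'I_#|I| => enum_val i)) //.
  by apply: onW_bij; exact: enum_val_bij.
Qed.

(** As [e * y] is outside the radical, some [1 - e * y * r] has no right inverse. This excludes that
    [e - e * y * r * e] is a unit of the corner, so [e * y * r * e] is one. *)
Lemma local_idem_right_inv (R : pzRingType) (e y : R) : local_idem e ->
  ~ Jac (e * y) -> exists r, e * y * r = e.
Proof.
move=> [ee e0 loc] nJ.
have [r nr] : exists r, forall z, (1 - e * y * r) * z <> 1.
  apply: contrapT => nor; apply: nJ; apply/JacP => r.
  by apply: contrapT => nz; apply: nor; exists r => z zE; apply: nz; exists z.
have [||[w [ew we xw wx]]|[w [ew we xw wx]]] := loc (e * y * r * e).
- by rewrite !mulrA ee.
- by rewrite -mulrA ee.
- by exists (r * e * w); rewrite !mulrA.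
(* [(1 - e * y * r) * w = e], and the last term cancels the [e * y * r * (1 - e)] left over by the
   first. *)
case: (nr ((1 - e) + w + w * (e * y * r) * (1 - e))).
have w1 : (1 - e * y * r) * w = e.
  by transitivity ((1 - e * y * r) * (e * w)); [rewrite ew|rewrite -[RHS]xw; ncring].
transitivity ((1 - e * y * r) * (1 - e) + (1 - e * y * r) * w * (1 + (e * y * r) * (1 - e))).
  by ncring.
have eyr : e * (e * y * r) = e * y * r by rewrite !mulrA ee.
rewrite w1.
transitivity ((1 - e * y * r) * (1 - e) + e + e * (e * y * r) * (1 - e)); first by ncring.
by rewrite eyr; ncring.
Qed.

(** * Rings in which 1 is a sum of local idempotents are semiperfect *)

Section LocalIdempotentSum.
Variables (R : pzRingType) (t : nat) (u : 'I_t -> R).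
Hypotheses (uloc : forall i, local_idem (u i)) (u1 : \sum_i u i = 1).

Let rJ := @Jac_right_ideal R.
Let tJ : two_sided_ideal (@Jac R).
Proof. by split; [exact: rJ|move=> x r; exact: Jac_left]. Qed.
Let S : pzRingType := quotient_ring tJ.
Let p : {rmorphism R -> S} := @qpi R _ tJ.
Let p0 x : p x = 0 <-> Jac x. Proof. exact: qpi_eq0. Qed.
Let psurj (y : S) : exists x, p x = y. Proof. exact: qpi_surj. Qed.

Let pu_unit i (y : S) : p (u i) * y != 0 -> exists r, p (u i) * y * r = p (u i).
Proof.
have [x <-] := psurj y; rewrite -rmorphM => /eqP n0.
have [|r ur] := @local_idem_right_inv R _ x (uloc i); first by move/p0.
by exists (p r); rewrite -rmorphM ur.
Qed.

Let sum_pu (y : S) : \sum_i p (u i) * y = y.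
Proof. by rewrite -mulr_suml -rmorph_sum u1 rmorph1 mul1r. Qed.

Let supported k (y : S) := forall i : 'I_t, (k <= i)%N -> p (u i) * y = 0.

(** As in an echelon form: the positions at which elements of [I] have their last nonzero component,
    the components of [y] being the [p (u i) * y]. *)
Let lead (I : set S) := [set k : 'I_t | `[< exists y,
  [/\ I y, supported k.+1 y & p (u k) * y != 0] >] ]%SET.

Let lead_sub (I J : set S) : I `<=` J -> (lead I \subset lead J)%SET.
Proof.
move=> IJ; apply/fintype.subsetP => k; rewrite inE => kI; rewrite inE; move: kI => /asboolP[y [Iy sy ny]].
by apply/asboolP; exists y; split=> //; exact: IJ.
Qed.

(** Elimination: if [x] in [J] has its last component at [k], take [y] in [I] with the same last
    position. By [pu_unit] a right multiple of [y] has the same [k]-th component as [x], and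
    subtracting it lowers the support. *)
Let lead_eq (I J : set S) : right_ideal I -> right_ideal J -> I `<=` J ->
  lead I = lead J -> I = J.
Proof.
move=> rI rJ' IJ IJlead; apply/seteqP; split=> // x Jx.
suff key k : (k <= t)%N -> forall x, J x -> supported k x -> I x.
  by apply: (key t) => // i; rewrite leqNgt ltn_ord.
elim: k => [|k IHk] kt {x Jx} x Jx sx.
  by rewrite -(sum_pu x) big1 => [|i _]; [exact: right_ideal0|exact: sx].
pose i := Ordinal kt; have [x0|nx0] := eqVneq (p (u i) * x) 0.
  apply: (IHk (ltnW kt)) => // j; rewrite leq_eqVlt => /orP[/eqP kj|]; last exact: sx.
  by have -> : j = i by apply: val_inj.
have : (i \in lead J)%SET.
  by rewrite inE; apply/asboolP; exists x; split=> // j /ltnW; exact: sx.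
rewrite -IJlead inE => /asboolP[y [Iy sy ny]].
have [r yr] := pu_unit ny; rewrite -(subrK (y * (r * x)) x).
apply: right_idealD => //; last exact: right_idealM.
apply: (IHk (ltnW kt)).
  by apply: right_idealB => //; apply: right_idealM => //; exact: IJ.
move=> j kj; rewrite mulrBr mulrA.
move: kj; rewrite leq_eqVlt => /orP[/eqP kj|kj]; last by rewrite sx // sy // mul0r subrr.
have -> : j = i by apply: val_inj.
by rewrite mulrA yr subrr.
Qed.

(** Along a decreasing chain, [lead] decreases among the subsets of ['I_t]; once its cardinality is
    minimal, [lead_eq] makes the chain constant. The radical of the quotient vanishes because right
    inverses lift from [S] up to a unit of the form [1 + j] with [j] in [Jac R]. *)
Lemma local_sum_artinian : semisimple_artinian S.
Proof.
split; last first.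
  apply/seteqP; split=> y; last by move=> -> I [[]].
  have [x <-] := psurj y => Jx; apply/p0/JacP => r.
  have [w] := (JacP (p x)).1 Jx (p r); have [z <-] := psurj w.
  move=> xz; have Jz : Jac ((1 - x * r) * z - 1).
    by apply/p0; rewrite rmorphB rmorphM rmorphB rmorph1 rmorphM xz subrr.
  have [v [zv _]] := Jac_inv (right_idealN rJ Jz).
  by exists (z * v); rewrite mulrA -[RHS]zv; congr (_ * v); ncring.
move=> I rI dI.
have dI' n m : (n <= m)%N -> I m `<=` I n.
  move=> /subnKC <-; elim: (m - n)%N => [|k IHk]; first by rewrite addn0.
  by rewrite addnS => x /dI; exact: IHk.
have exc : exists c, `[< exists n, #|lead (I n)| = c >].
  by exists #|lead (I 0)|; apply/asboolP; exists 0.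
have [c /asboolP[n nc] cmin] := ex_minnP exc.
exists n => m nm; apply: lead_eq => //; first exact: dI'.
apply/eqP; rewrite eqEcard lead_sub /=; last exact: dI'.
by rewrite nc; apply: cmin; apply/asboolP; exists m.
Qed.

(** To lift [x], take an idempotent [G] with [p G] below [p x] and [annr (p G)] minimal. If [p G] is
    not [p x], some [u i] does not kill the class of [x1 = (1 - G) * x * (1 - G)], and this yields
    an idempotent [g] orthogonal to [G], below [x] modulo the radical and outside it; then [G + g]
    contradicts minimality. *)
Lemma local_sum_semiperfect : semiperfect R.
Proof.
split.
  exists S, p; split; last exact: local_sum_artinian.
  by split; [exact: psurj|apply/seteqP; split=> x /= /p0].
have [artS _] := local_sum_artinian.
move=> x Jxx.
have [||_ [G [GG xG Gx] <-] Gmin] := @artinian_min S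
  [set K | exists2 G, [/\ G * G = G, Jac (x * G - G) & Jac (G * x - G)] & annr (p G) = K] artS.
- by move=> _ [G _ <-]; exact: annr_right_ideal.
- exists (annr (p 0)), 0 => //; rewrite !mul0r mulr0 subrr.
  by split=> //; exact: (right_ideal0 rJ).
exists G; split=> //; apply: contrapT => nGx.
pose x1 := (1 - G) * x * (1 - G).
have eqJ a b : p a = p b <-> Jac (a - b).
  rewrite -p0 rmorphB; split=> [->|/eqP]; first by rewrite subrr.
  by rewrite subr_eq0 => /eqP.
have pxx : p x * p x = p x by rewrite -rmorphM; apply/eqJ.
have pGG : p G * p G = p G by rewrite -rmorphM GG.
have pxG : p x * p G = p G by rewrite -rmorphM; apply/eqJ.
have pGx : p G * p x = p G by rewrite -rmorphM; apply/eqJ.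
have px1 : p x1 = p x - p G.
  rewrite /x1 !rmorphM rmorphB rmorph1.
  transitivity (p x - p x * p G - (p G * p x - (p G * p x) * p G)); first by ncring.
  by rewrite pxG pGx pGG subrr subr0.
have x1G : x1 * G = 0 by rewrite /x1 -mulrA [_ * G]mulrBl mul1r GG subrr mulr0.
have Gx1 : G * x1 = 0 by rewrite /x1 !mulrA [G * (1 - G)]mulrBr mulr1 GG subrr !mul0r.
clearbody x1.
have px11 : p x1 * p x1 = p x1.
  by rewrite px1 mulrBl !mulrBr pxx pxG pGx pGG subrr subr0.
have [i nxi] : exists i, p (u i) * p x1 != 0.
  apply: contrapT => noi; apply: nGx; apply/eqJ/eqP.
  rewrite eq_sym -subr_eq0 -px1; apply/eqP; rewrite -(sum_pu (p x1)) big1 // => i _.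
  by apply/eqP/negPn/negP => ni; apply: noi; exists i.
(* The product [x1 * x1] replaces [x1], which has the same class, so that
   [u i * (x1 * x1) * r = u i] makes [g] exactly idempotent. *)
have [|r xr] := @local_idem_right_inv R _ (x1 * x1) (uloc i).
  by move/p0; rewrite !rmorphM px11 => /eqP; rewrite (negPf nxi).
pose g := x1 * r * u i * x1.
have gg : g * g = g.
  have -> : g * g = x1 * r * (u i * (x1 * x1) * r) * u i * x1 by rewrite /g; ncring.
  have [uu _ _] := uloc i.
  by rewrite xr /g -[_ * u i * u i]mulrA uu.
have gG : g * G = 0 by rewrite /g -mulrA x1G mulr0.
have Gg : G * g = 0 by rewrite /g !mulrA Gx1 !mul0r.
have pxx1 : p x * p x1 = p x1 by rewrite px1 mulrBr pxx pxG.
have px1x : p x1 * p x = p x1 by rewrite px1 mulrBl pxx pGx.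
have pg : p x * p g = p g /\ p g * p x = p g.
  rewrite /g !rmorphM; split; first by rewrite !mulrA pxx1.
  by rewrite -mulrA px1x.
have g0 : p g != 0.
  apply: contra_neq nxi => pg0.
  have -> : p (u i) * p x1 = p (u i) * p x1 * p g.
    rewrite -!rmorphM; congr (p _); rewrite /g.
    have -> : u i * x1 * (x1 * r * u i * x1) = (u i * (x1 * x1) * r) * u i * x1 by ncring.
    by have [uu _ _] := uloc i; rewrite xr uu.
  by rewrite pg0 mulr0.
clearbody g.
have annE : annr (p (G + g)) = annr (p G).
  apply: Gmin.
    exists (G + g) => //; split.
    - by rewrite mulrDl !mulrDr GG gG Gg gg addr0 add0r.
    - by apply/eqJ; rewrite rmorphM rmorphD mulrDr pxG pg.1.
    - by apply/eqJ; rewrite rmorphM rmorphD mulrDl pGx pg.2.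
  move=> y; rewrite /annr /= => Gy.
  have -> : p G = p G * p (G + g) by rewrite -rmorphM mulrDr GG Gg addr0.
  by rewrite -mulrA Gy mulr0.
have : annr (p (G + g)) (p g).
  by rewrite annE /annr /= -rmorphM Gg rmorph0.
by rewrite /annr /= -rmorphM mulrDl Gg gg add0r => /eqP; rewrite (negPf g0).
Qed.

End LocalIdempotentSum.

(** * Passing to a subring or a corner ring *)

(* An injective ring homomorphism that need not preserve the unit, such as the
   inclusion of a corner ring. *)
Definition nu_embedding (R1 R2 : pzRingType) (c : R1 -> R2) :=
  [/\ {morph c : x y / x + y}, {morph c : x y / x * y} & injective c].

Section Embedding.
Variables (R1 R2 : pzRingType) (c : R1 -> R2).
Hypothesis emb : nu_embedding c.

Lemma emb0 : c 0 = 0.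
Proof. by have [cD _ _] := emb; apply: (addrI (c 0)); rewrite -cD !addr0. Qed.

Lemma embB x y : c (x - y) = c x - c y.
Proof. by have [cD _ _] := emb; apply: (addIr (c y)); rewrite -cD !subrK. Qed.

Lemma embX x n : c (x ^+ n.+1) = c x ^+ n.+1.
Proof.
by have [_ cM _] := emb; elim: n => // n IHn; rewrite exprS cM IHn -exprS.
Qed.

Lemma emb_eq0 x : c x = 0 -> x = 0.
Proof. by have [_ _ cI] := emb; rewrite -emb0 => /cI. Qed.

(** The factor [y] absorbs the empty product, whose image [c 1] may differ from [1]. *)
Lemma emb_lprod (x : nat -> R1) n y :
  c (lprod x n * y) = lprod (c \o x) n * c y.
Proof.
have [_ cM _] := emb.
by elim: n y => [|n IHn] y /=; rewrite ?mul1r // -mulrA IHn cM mulrA.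
Qed.

Lemma emb_orthogonal_finite : orthogonal_finite R2 -> orthogonal_finite R1.
Proof.
have [_ cM _] := emb; move=> fin e ee eij; have [|i j /eij|n] := fin (c \o e).
- by move=> i /=; rewrite -cM ee.
- by rewrite /= -cM => ->; rewrite emb0.
- by move/emb_eq0; exists n.
Qed.

End Embedding.

Lemma emb_conv (R1 R2 : pzRingType) (c : R1 -> R2) : nu_embedding c ->
  nu_embedding (c : R1^c -> R2^c).
Proof. by case=> cD cM cI; split=> // x y; exact: cM. Qed.

(** Let [G n] be the image in [R / Jac R] of the sum of the first [n] idempotents. Once the chain
    [annr (G n)] is stationary, [p (e n)] is killed by [G n.+1], which also fixes it; so [e n] lies
    in the radical and is zero. *)
Lemma semilocal_orthogonal_finite (R : pzRingType) : semilocal R -> orthogonal_finite R.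
Proof.
move=> [S [p [[_ pJ] [artS _]]]] e ee eij.
pose G n := \sum_(i < n) p (e i).
have Ge n m : (n <= m)%N -> G n * p (e m) = 0.
  move=> nm; rewrite mulr_suml big1 // => i _.
  by rewrite -rmorphM eij ?rmorph0 // neq_ltn (leq_trans _ nm).
have Gge n m : (m < n)%N -> p (e m) * G n = p (e m) /\ G n * p (e m) = p (e m).
  move=> mn; pose i0 := Ordinal mn.
  rewrite mulr_suml mulr_sumr; split; rewrite (bigD1 i0) //= -rmorphM ee big1 ?addr0 //.
  - by move=> i ii0; rewrite -rmorphM eij ?rmorph0 // eq_sym.
  - by move=> i ii0; rewrite -rmorphM eij ?rmorph0.
have GG n : G n * G n.+1 = G n.
  rewrite mulr_suml; apply: eq_bigr => i _.
  by rewrite (Gge n.+1 i (leqW (ltn_ord i))).1.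
have [||n In] := artS (fun n => annr (G n)).
- by move=> n; exact: annr_right_ideal.
- by move=> n s; rewrite /annr /= => Gs; rewrite -GG -mulrA Gs mulr0.
exists n; apply: Jac_idem => //; rewrite -pJ /=.
have : annr (G n) (p (e n)) by exact: Ge.
by rewrite -(In n.+1 (leqnSn n)) /annr /= (Gge n.+1 n (ltnSn n)).2.
Qed.

Lemma gdrazin_semiperfect (R : pzRingType) (tau : set (set R)) :
  linear_topology tau -> hausdorff tau -> (forall a, exists b, gdrazin tau a b) ->
  orthogonal_finite R -> semiperfect R.
Proof.
move=> lin hd dr /orthogonal_finite_primitive /idem_sum_ord[t [u [pu uij u1]]].
apply: (@local_sum_semiperfect R t u) => // i.
exact: (gdrazin_primitive_local lin hd dr (pu i)).
Qed.

(** The idempotent [x * b] lies in the radical, hence vanishes, so [x] coincides with its nilpotent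
    part. *)
Lemma pi_Jac_nil (R : pzRingType) (x : R) : pi_regular R -> Jac x ->
  exists n, x ^+ n = 0.
Proof.
move=> /pi_gdrazin/(_ x)[b [xb bxb /discrete_tends_to_0[N /(_ N (leqnn N)) xN]]] Jx.
exists N.+1; suff xb0 : x * b = 0 by rewrite -mulrA xb0 mulr0 subr0 in xN.
apply: Jac_idem; first exact: (right_idealM _ (@Jac_right_ideal R)).
by rewrite -mulrA [b * _]mulrA bxb.
Qed.

(* The image of the nil ideal [Jac R1] in the semisimple ring [R2 / Jac R2] is
   a nil semigroup, hence nilpotent. *)
Lemma emb_Jac_prod (R1 R2 : pzRingType) (c : R1 -> R2) :
  nu_embedding c -> pi_regular R1 -> semilocal R2 ->
  exists k, forall x : 'I_k -> R1, (forall i, Jac (x i)) -> Jac (c (\prod_i x i)).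
Proof.
move=> emb piR [S [p [[_ pJ] ssS]]]; have [cD cM cI] := emb.
have [||k kN] := @nil_semigroup_nilpotent S [set p (c x) | x in @Jac R1] ssS.
- move=> _ _ [x Jx <-] [y Jy <-]; exists (x * y); last by rewrite cM rmorphM.
  exact: (right_idealM _ (@Jac_right_ideal R1)).
- move=> _ [x Jx <-]; have [n xn] := pi_Jac_nil piR Jx; exists n.+1.
  by rewrite -rmorphXn -embX // exprS xn mulr0 emb0 // rmorph0.
exists k => x Jx; rewrite -pJ /= -[\prod_i _]mulr1.
have -> : \prod_(i < k) x i = \prod_(y <- [seq x i | i <- enum 'I_k]) y.
  by rewrite big_map enumT /index_enum locked_withE.
have -> (s : seq R1) y : c (\prod_(x <- s) x * y) = \prod_(x <- s) c x * c y.
  by elim: s => [|z s IHs]; rewrite ?big_nil ?mul1r // !big_cons -mulrA cM IHs mulrA.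
rewrite rmorphM rmorph_prod.
rewrite -(big_map (p \o c) predT id) kN ?mul0r //; first by rewrite !size_map -enumT size_enum_ord.
by move=> _ /mapP[_ /mapP[i _ ->] ->]; exists (x i).
Qed.

Lemma lprodD (R : pzRingType) (x : nat -> R) n k :
  lprod x (n + k) = lprod x n * lprod (fun i => x (n + i)%N) k.
Proof. by elim: k => [|k IHk]; rewrite ?addn0 ?mulr1 // addnS /= IHk mulrA. Qed.

Section TNilpotentTransfer.
Variables (R1 R2 : pzRingType) (c : R1 -> R2) (J1 : set R1) (J2 : set R2) (k : nat).
Hypothesis emb : nu_embedding c.
Hypothesis J12 : forall x : nat -> R1, (forall i, J1 (x i)) -> J2 (c (lprod x k)).

(** Products over consecutive blocks of length [k] turn a sequence in [J1] into one whose image lies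
    in [J2]. *)
Let blocks (x : nat -> R1) j := lprod (fun i => x (j * k + i)%N) k.

Let lprod_blocks x m : lprod x (m * k) = lprod (blocks x) m.
Proof.
elim: m => [|m IHm] //; rewrite mulSn addnC lprodD IHm //.
Qed.

Lemma lprod_transfer x : (forall i, J1 (x i)) -> exists2 y : nat -> R2,
  forall i, J2 (y i) & forall n, lprod y n = 0 -> lprod x (n * k) = 0.
Proof.
move=> Jx; exists (c \o blocks x) => [i|n yn]; first exact: J12.
by apply: (emb_eq0 emb); rewrite lprod_blocks -[lprod _ _]mulr1 (emb_lprod emb) yn mul0r.
Qed.

Lemma t_nilpotent_transfer : t_nilpotent J2 -> t_nilpotent J1.
Proof.
by move=> tJ x /lprod_transfer[y /tJ[n yn] yx]; exists (n * k)%N; exact: yx.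
Qed.
End TNilpotentTransfer.

Lemma Jac_nilpotentP (R : pzRingType) : Jac_nilpotent R <->
  exists n, forall x : nat -> R, (forall i, Jac (x i)) -> lprod x n = 0.
Proof.
split=> -[n nil]; exists n => x Jx; first by rewrite -lprodE; exact: nil.
pose x' i := if insub i is Some j then x j else 0.
rewrite -(nil x') -?lprodE => [|i].
  by apply: eq_bigr => i _; rewrite /x' valK.
by rewrite /x'; case: insub => // ; exact: (right_ideal0 (@Jac_right_ideal R)).
Qed.

(** The part of [Q] that has to be known for [R1] beforehand; [has_disc_emb] brings the rest back
    along any embedding. *)
Definition disc_pi_regular (Q : disc_property) (R : pzRingType) :=
  match Q with
  | PiInfRegularSemiperfect | PiInfRegular => pi_inf_regular R
  | _ => pi_regular R
  end.

Lemma disc_pi_regular_pi Q R : disc_pi_regular Q R -> pi_regular R.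
Proof. by case: Q => //; exact: (@has_disc_pi PiInfRegular). Qed.

Lemma has_disc_emb (Q : disc_property) (R1 R2 : pzRingType) (c : R1 -> R2) :
  nu_embedding c -> disc_pi_regular Q R1 -> has_disc Q R2 -> has_disc Q R1.
Proof.
move=> emb dpi; have piR := disc_pi_regular_pi dpi.
have sp : semilocal R2 -> semiperfect R1.
  move=> /semilocal_orthogonal_finite /(emb_orthogonal_finite emb).
  apply: (gdrazin_semiperfect (@discrete_linear R1) (@discrete_hausdorff R1)).
  exact/pi_gdrazin.
have Jk : semilocal R2 -> exists k, (forall x : nat -> R1, (forall i, Jac (x i)) ->
    Jac (c (lprod x k))) /\
    (forall x : nat -> R1, (forall i, Jac (x i)) -> Jac (c (lprod (x : nat -> R1^c) k))).
  move=> /(emb_Jac_prod emb piR)[k kJ]; exists k; split=> x Jx.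
    by rewrite -lprodE; exact: kJ.
  by rewrite -lprod_conv; exact: kJ.
case: Q dpi => //= dpi.
- move=> [sl /Jac_nilpotentP[n nil]]; split; first by case: (sp sl).
  have [k [kJ _]] := Jk sl; apply/Jac_nilpotentP; exists (n * k)%N => x Jx.
  by have [y /nil yn] := lprod_transfer emb kJ Jx; apply.
- move=> [sl /right_T_nilpotentP tJ]; split; first by case: (sp sl).
  have [k [_ kJ]] := Jk sl; apply/right_T_nilpotentP.
  exact: (t_nilpotent_transfer (emb_conv emb) kJ tJ).
- move=> [sl /left_T_nilpotentP tJ]; split; first by case: (sp sl).
  have [k [kJ _]] := Jk sl; apply/left_T_nilpotentP.
  exact: (t_nilpotent_transfer emb kJ tJ).
- by move=> [_ [sl _]]; split=> //; exact: sp.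
- by move=> [_ [sl _]]; split=> //; exact: sp.
Qed.

(** * Linear topologies *)

Section LinearTopologies.
Variables (R : pzRingType) (tau : set (set R)).

Lemma topology_local (T : Type) (t : set (set T)) (U : set T) : is_topology t ->
  (forall x, U x -> exists V, [/\ t V, V x & V `<=` U]) -> t U.
Proof.
move=> [_ _ tU] locU.
have -> : U = \bigcup_(V in [set V | t V /\ V `<=` U]) V.
  apply/seteqP; split=> [x /locU[V [tV Vx VU]]|x [V [_ VU] Vx]]; last exact: VU.
  by exists V.
by apply: tU => V [].
Qed.

Lemma linear_cosetP (U : set R) : linear_topology tau ->
  tau U <-> forall x, U x -> exists I,
    [/\ tau I, two_sided_ideal I & forall y, I (y - x) -> U y].
Proof.
move=> [[top cD _ _] lin]; split=> [tU x Ux|locU].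
  have [|V [W [tV tW Vx W0 VW]]] := cD U x 0 tU; first by rewrite addr0.
  have [I [tI iI IW]] := lin _ tW W0; exists I; split=> // y Iyx.
  by rewrite -(subrK x y) addrC; apply: VW => //; exact: IW.
apply: (topology_local top) => x /locU[I [tI iI IU]].
have [|V [W [tV tW Vx WN VW]]] := cD I x (- x) tI.
  by rewrite subrr; case: iI => -[].
by exists V; split=> // y Vy; apply: IU; exact: VW.
Qed.

Hypothesis lin : linear_topology tau.

Lemma open_idealI (I J : set R) : tau I -> two_sided_ideal I -> tau J ->
  two_sided_ideal J -> tau (I `&` J) /\ two_sided_ideal (I `&` J).
Proof.
have [[[_ tI _] _ _ _] _] := lin => oI [rI lI] oJ [rJ lJ]; split; first exact: tI.
split; first split; first by split; exact: right_ideal0.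
- by move=> x y [? ?] [? ?]; split; exact: right_idealB.
- by move=> x r [? ?]; split; exact: right_idealM.
- by move=> x r [? ?]; split; [exact: lI|exact: lJ].
Qed.

Lemma matrix_ideal n (I : set R) : tau I -> two_sided_ideal I ->
  let MI := [set A : 'M[R]_n | forall i j, I (A i j)] in
  matrix_topology tau MI /\ two_sided_ideal MI.
Proof.
move=> tI iI /=; have [rI lI] := iI.
have sumI (F : 'I_n -> R) : (forall k, I (F k)) -> I (\sum_k F k).
  by move=> IF; apply: big_ind => //; [exact: right_ideal0|move=> ? ?; exact: right_idealD].
split.
  move=> A AI; exists I; split=> // B BA i j.
  by rewrite -(subrK (A i j) (B i j)); apply: right_idealD.
split; first split.
- by move=> i j; rewrite mxE; exact: right_ideal0.
- by move=> A B IA IB i j; rewrite !mxE; exact: right_idealB.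
- by move=> A B IA i j; rewrite mxE; apply: sumI => k; exact: right_idealM.
- by move=> A B IA i j; rewrite mxE; apply: sumI => k; exact: lI.
Qed.

Lemma matrix_linear n : linear_topology (@matrix_topology R tau n).
Proof.
have [[top _ _ _] _] := lin.
have [tT _ _] := top.
have coset (A : 'M[R]_n) I : tau I -> two_sided_ideal I ->
    matrix_topology tau [set B : 'M[R]_n | forall i j, I (B i j - A i j)].
  move=> tI iI B BA; exists I; split=> // C CB i j.
  have [rI _] := iI; rewrite -(subrK (B i j) (C i j)) -addrA.
  exact: right_idealD.
split; last first.
  move=> U tU U0; have [I [tI iI IU]] := tU _ U0.
  have [tM iM] := matrix_ideal n tI iI.
  exists [set A : 'M[R]_n | forall i j, I (A i j)]; split=> // A AI.
  by apply: IU => i j; rewrite mxE subr0.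
split.
- split.
  + by move=> A _; exists setT; split=> //.
  + move=> U V tU tV A [/tU[I [tI iI IU]] /tV[J [tJ iJ JV]]].
    have [tIJ iIJ] := open_idealI tI iI tJ iJ.
    exists (I `&` J); split=> // B BA.
    by split; [apply: IU|apply: JV] => i j; case: (BA i j).
  + move=> F FU A [U FUU UA]; have [I [tI iI IU]] := FU _ FUU _ UA.
    by exists I; split=> // B /IU UB; exists U.
- move=> U A B tU /tU[I [tI iI IU]]; have [rI _] := iI.
  exists [set A' : 'M[R]_n | forall i j, I (A' i j - A i j)],
    [set B' : 'M[R]_n | forall i j, I (B' i j - B i j)]; split.
  + exact: coset.
  + exact: coset.
  + by move=> i j; rewrite subrr; exact: right_ideal0.
  + by move=> i j; rewrite subrr; exact: right_ideal0.
  + move=> A' B' AA' BB'; apply: IU => i j; rewrite !mxE opprD addrACA.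
    exact: right_idealD.
- move=> U tU A /tU[I [tI iI IU]]; have [rI _] := iI; exists I; split=> // B BA.
  apply: IU => i j; rewrite !mxE -opprD; apply: right_idealN => //; exact: BA.
- move=> U A B tU /tU[I [tI iI IU]]; have [rI lI] := iI.
  exists [set A' : 'M[R]_n | forall i j, I (A' i j - A i j)],
    [set B' : 'M[R]_n | forall i j, I (B' i j - B i j)]; split.
  + exact: coset.
  + exact: coset.
  + by move=> i j; rewrite subrr; exact: right_ideal0.
  + by move=> i j; rewrite subrr; exact: right_ideal0.
  + move=> A' B' AA' BB'; apply: IU => i j; rewrite !mxE -sumrB.
    apply: big_ind => [||k _]; first exact: right_ideal0.
      by move=> ? ?; exact: right_idealD.
    have -> : A' i k * B' k j - A i k * B k j =
      (A' i k - A i k) * B' k j + A i k * (B' k j - B k j) by ncring.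
    by apply: right_idealD => //; [apply: right_idealM|apply: lI].
Qed.

Lemma matrix_hausdorff n : hausdorff tau -> hausdorff (@matrix_topology R tau n).
Proof.
move=> hd A B AB.
have [I [tI [iI nI]]] : exists I, [/\ tau I & two_sided_ideal I /\
    ~ forall i j, I (A i j - B i j)].
  apply: contrapT => noI; apply: AB; apply/matrixP => i j.
  apply/eqP; rewrite -subr_eq0; apply/eqP/(linear_separated lin hd) => I tI iI.
  by apply: contrapT => nI; apply: noI; exists I; split=> //; split=> // /(_ i j).
have [rI _] := iI.
exists [set C : 'M[R]_n | forall i j, I (C i j - A i j)],
  [set C : 'M[R]_n | forall i j, I (C i j - B i j)]; split.
- move=> C CA; exists I; split=> // D DC i j.
  by rewrite -(subrK (C i j) (D i j)) -addrA; exact: right_idealD.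
- move=> C CA; exists I; split=> // D DC i j.
  by rewrite -(subrK (C i j) (D i j)) -addrA; exact: right_idealD.
- by move=> i j; rewrite subrr; exact: right_ideal0.
- by move=> i j; rewrite subrr; exact: right_ideal0.
- apply/seteqP; split=> // C [CA CB]; case: nI => i j.
  have -> : A i j - B i j = (C i j - B i j) - (C i j - A i j) by ncring.
  exact: right_idealB.
Qed.

Lemma matrix_tends_to_0 n (u : nat -> 'M[R]_n) :
  tends_to_0 (@matrix_topology R tau n) u <->
  forall I, tau I -> two_sided_ideal I ->
    exists N, forall k, (N <= k)%N -> forall i j, I (u k i j).
Proof.
split=> [u0 I tI iI|u0 U tU U0].
  have [tM [rM _]] := matrix_ideal n tI iI.
  by have [|N uN] := u0 _ tM; [exact: right_ideal0|exists N].
have [I [tI iI IU]] := tU _ U0; have [N uN] := u0 I tI iI.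
by exists N => k /uN Iu; apply: IU => i j; rewrite mxE subr0.
Qed.

End LinearTopologies.

(** * Topologies induced along an embedding *)

Section InitialTopology.
Variables (R1 R2 : pzRingType) (c : R1 -> R2) (tau : set (set R2)).
Hypotheses (emb : nu_embedding c) (lin : linear_topology tau).

Let tau1 := initial_topology c tau.

Lemma preimage_ideal (I : set R2) : two_sided_ideal I -> two_sided_ideal (c @^-1` I).
Proof.
have [cD cM _] := emb => -[rI lI]; split; first split=> /=.
- by rewrite (emb0 emb); exact: right_ideal0.
- by move=> x y Ix Iy; rewrite (embB emb); exact: right_idealB.
- by move=> x r Ix; rewrite cM; exact: right_idealM.
- by move=> x r Ix; rewrite /preimage /= cM; exact: lI.
Qed.

Lemma initial_linear : linear_topology tau1.
Proof.
have [cD cM _] := emb; have [[[tT tI tU] tD tN tM] tlin] := lin.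
split; first split; first split.
- by exists setT.
- by move=> _ _ [U tU' <-] [V tV <-]; exists (U `&` V) => //; exact: tI.
- move=> F FU; exists (\bigcup_(V in [set V | tau V /\ F (c @^-1` V)]) V).
    by apply: tU => V [].
  apply/seteqP; split=> [x [V [tV FV] Vx]|x [U FUU Ux]]; first by exists (c @^-1` V).
  by have [V tV VU] := FU _ FUU; exists V; [split=> //; rewrite VU|rewrite -VU in Ux].
- move=> _ x y [U tU' <-]; rewrite /preimage /= cD => /(tD _ _ _ tU')[V [W [tV tW Vx Wy VW]]].
  exists (c @^-1` V), (c @^-1` W); split=> //; [by exists V|by exists W|].
  by move=> v w Vv Ww; rewrite /preimage /= cD; exact: VW.
- move=> _ [U tU' <-]; exists (-%R @^-1` U); first exact: tN.
  have cN x : c (- x) = - c x by rewrite -[- x]sub0r (embB emb) (emb0 emb) sub0r.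
  by apply/seteqP; split=> x; rewrite /preimage /= cN.
- move=> _ x y [U tU' <-]; rewrite /preimage /= cM => /(tM _ _ _ tU')[V [W [tV tW Vx Wy VW]]].
  exists (c @^-1` V), (c @^-1` W); split=> //; [by exists V|by exists W|].
  by move=> v w Vv Ww; rewrite /preimage /= cM; exact: VW.
- move=> _ [U tU' <-]; rewrite /preimage /= (emb0 emb) => U0.
  have [I [tI' iI IU]] := tlin _ tU' U0; exists (c @^-1` I); split.
  + by exists I.
  + exact: preimage_ideal.
  + by move=> x; exact: IU.
Qed.

Lemma initial_hausdorff : hausdorff tau -> hausdorff tau1.
Proof.
move=> hd x y xy; have [_ _ cI] := emb.
have [|U [V [tU tV Ux Vy UV]]] := hd (c x) (c y); first by move/cI.
exists (c @^-1` U), (c @^-1` V); split=> //; [by exists U|by exists V|].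
by rewrite -preimage_setI UV preimage_set0.
Qed.

Lemma gdrazin_push a b : gdrazin tau1 a b -> gdrazin tau (c a) (c b).
Proof.
have [cD cM _] := emb; move=> [ab bab t0]; split; [by rewrite -!cM ab|by rewrite -!cM bab|].
move=> U tU U0; have [||N uN] := t0 (c @^-1` U); first by exists U.
  by rewrite /preimage /= (emb0 emb).
by exists N => n /uN; rewrite /preimage /= (embX emb) (embB emb) !cM.
Qed.

Lemma gdrazin_reflect a b : gdrazin tau (c a) (c b) -> gdrazin tau1 a b.
Proof.
have [cD cM cI] := emb; rewrite /gdrazin -!cM => -[/cI ab /cI bab t0]; split=> //.
move=> _ [U tU <-] U0; have [|N uN] := t0 U tU; first by rewrite -(emb0 emb).
by exists N => n /uN; rewrite -(embB emb) -(embX emb).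
Qed.

Lemma map_mx_emb n : nu_embedding (map_mx c : 'M_n -> 'M_n).
Proof.
have [cD cM cI] := emb; split.
- by move=> A B; apply/matrixP => i j; rewrite !mxE cD.
- move=> A B; apply/matrixP => i j; rewrite !mxE (big_morph c cD (emb0 emb)).
  by apply: eq_bigr => k _; rewrite !mxE cM.
- move=> A B /matrixP AB; apply/matrixP => i j; apply: cI.
  by have := AB i j; rewrite !mxE.
Qed.

Lemma gdrazin_mx_push n (A B : 'M[R1]_n) : gdrazin (@matrix_topology R1 tau1 n) A B ->
  gdrazin (@matrix_topology R2 tau n) (map_mx c A) (map_mx c B).
Proof.
have [cD cM cI] := map_mx_emb n; move=> [ab bab t0]; split; [by rewrite -!cM ab|by rewrite -!cM bab|].
apply: (matrix_tends_to_0 _ _).2 => I tI iI.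
have [||N uN] := (matrix_tends_to_0 _ _).1 t0 (c @^-1` I).
- by exists I.
- exact: preimage_ideal.
exists N => k /uN Ik i j; have := Ik i j.
by rewrite -!cM -(embB (map_mx_emb n)) -(embX (map_mx_emb n)) mxE.
Qed.

Lemma gdrazin_mx_reflect n (A B : 'M[R1]_n) :
  gdrazin (@matrix_topology R2 tau n) (map_mx c A) (map_mx c B) ->
  gdrazin (@matrix_topology R1 tau1 n) A B.
Proof.
have [cD cM cI] := map_mx_emb n.
rewrite /gdrazin -!cM => -[/cI ab /cI bab t0]; split=> //.
apply: (matrix_tends_to_0 _ _).2 => _ [V tV <-] [rV _].
(* The open ideal of [R1] is the preimage of an open set [V] that may fail to be an ideal, so [V] is
   first shrunk to an open ideal [I]. *)
have [_ tlin] := lin; have [|I [tI iI IV]] := tlin V tV.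
  by have := right_ideal0 rV; rewrite /preimage /= (emb0 emb).
have [N uN] := (matrix_tends_to_0 _ _).1 t0 I tI iI.
exists N => k /uN Ik i j; apply: IV; have := Ik i j.
by rewrite -(embB (map_mx_emb n)) -(embX (map_mx_emb n)) mxE.
Qed.

End InitialTopology.

(** The interface between the transfer results and the two kinds of embedding, centralizers and
    corners. The clause on matrices serves pi_inf-regularity. *)
Definition gdrazin_closed (R1 R2 : pzRingType) (tau : set (set R2)) (c : R1 -> R2) :=
  (forall a b, gdrazin tau (c a) b -> exists b1, c b1 = b) /\
  (forall n (A : 'M[R1]_n) (B : 'M[R2]_n), gdrazin (@matrix_topology R2 tau n) (map_mx c A) B ->
     exists B1, map_mx c B1 = B).

(** Used to identify [R1] with the inverse limit of its images. *)
Definition closed_image (T1 T2 : Type) (tau : set (set T2)) (c : T1 -> T2) :=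
  forall x, (forall U, tau U -> U x -> exists y, U (c y)) -> exists y, c y = x.

Lemma initial_discrete (T1 T2 : Type) (c : T1 -> T2) : injective c ->
  initial_topology c [set: set T2] = setT.
Proof.
move=> cI; apply/seteqP; split=> // U _; exists (c @` U) => //.
by apply/seteqP; split=> [x [y Uy /cI <-] //|x Ux]; exists x.
Qed.

Lemma matrix_discrete (R : pzRingType) n : @matrix_topology R setT n = setT.
Proof.
apply/seteqP; split=> // U _ A UA; exists [set 0]; split=> //.
  split; last by move=> _ r ->; rewrite mulr0.
  by split=> // [_ _ -> ->|_ r ->]; rewrite ?subrr ?mul0r.
move=> B BA; suff -> : B = A by [].
by apply/matrixP => i j; apply/eqP; rewrite -subr_eq0; apply/eqP/BA.
Qed.

Section DrazinTransfer.
Variables (R1 R2 : pzRingType) (tau : set (set R2)) (c : R1 -> R2).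
Hypotheses (emb : nu_embedding c) (lin : linear_topology tau) (cl : gdrazin_closed tau c).

Let tau1 := initial_topology c tau.

Lemma gdrazin_emb : (forall a : R2, exists b, gdrazin tau a b) ->
  forall a : R1, exists b, gdrazin tau1 a b.
Proof.
move=> dr a; have [b db] := dr (c a); have [b1 cb1] := cl.1 _ _ db.
by exists b1; apply: gdrazin_reflect => //; rewrite cb1.
Qed.

Lemma gdrazin_mx_emb n :
  (forall A : 'M[R2]_n, exists B, gdrazin (@matrix_topology R2 tau n) A B) ->
  forall A : 'M[R1]_n, exists B, gdrazin (@matrix_topology R1 tau1 n) A B.
Proof.
move=> dr A; have [B dB] := dr (map_mx c A); have [B1 cB1] := cl.2 _ _ _ dB.
by exists B1; apply: gdrazin_mx_reflect => //; rewrite cB1.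
Qed.

End DrazinTransfer.

Lemma has_disc_closed (Q : disc_property) (R1 R2 : pzRingType) (c : R1 -> R2) :
  nu_embedding c -> gdrazin_closed setT c -> has_disc Q R2 -> has_disc Q R1.
Proof.
move=> emb cl QR2; apply: (has_disc_emb emb) => //.
have [_ _ cI] := emb.
have pi2 := has_disc_pi QR2.
have pi1 : pi_regular R1.
  apply/pi_gdrazin; rewrite -(initial_discrete cI).
  by apply: (gdrazin_emb emb cl); apply/pi_gdrazin.
have inf : pi_inf_regular R2 -> pi_inf_regular R1.
  move=> infR n; apply/pi_gdrazin; rewrite -(@matrix_discrete R1 n) -(initial_discrete cI).
  apply: (gdrazin_mx_emb emb (@discrete_linear R2) cl) => A; rewrite matrix_discrete.
  by move: A; apply/pi_gdrazin; exact: infR.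
by case: Q QR2 => //= -[infR _]; exact: inf.
Qed.

Section LimitDrazin.
Variables (I : choiceType) (le : I -> I -> Prop) (T : pzRingType) (Ti : I -> pzRingType).
Variables (t : set (set T)) (q : forall i, {rmorphism T -> Ti i}).
Variable m : forall i j, le i j -> {rmorphism Ti j -> Ti i}.
Hypothesis qI : forall x y, (forall i, q i x = q i y) -> x = y.
Hypothesis qm : forall i j (h : le i j) x, m h (q j x) = q i x.
Hypothesis qlim : forall x : forall i, Ti i, (forall i j (h : le i j), m h (x j) = x i) ->
  exists y, forall i, q i y = x i.
Hypothesis qt : forall U, t U -> U 0 ->
  exists s : seq I, forall y, (forall i, i \in s -> q i y = 0) -> U y.

Lemma hom_gdrazin (A B : pzRingType) (f : {rmorphism A -> B}) a b :
  gdrazin setT a b -> gdrazin setT (f a) (f b).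
Proof.
move=> [ab bab /discrete_tends_to_0[N aN]]; split.
- by rewrite -!rmorphM ab.
- by rewrite -!rmorphM bab.
apply/discrete_tends_to_0; exists N => n /aN nN.
by rewrite -!rmorphM -rmorphB -rmorphXn nN rmorph0.
Qed.

(** By uniqueness the Drazin inverses of the coordinates are compatible, hence define an element of
    the limit; a neighbourhood of zero constrains finitely many coordinates, each of which is
    eventually zero. The maps [q] and [m] are kept abstract so that matrix rings over a limit are
    covered too. *)
Lemma limit_gdrazin a : (forall i (x : Ti i), exists b, gdrazin setT x b) ->
  exists b, gdrazin t a b.
Proof.
move=> dr; pose b i := projT1 (cid (dr i (q i a))).
have bP i : gdrazin setT (q i a) (b i) by exact: projT2 (cid (dr i (q i a))).
have [|x xb] := qlim (x := b).
  move=> i j h; apply: (gdrazin_uniq (@discrete_linear _) (@discrete_hausdorff _)) (bP i).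
  by rewrite -(qm h); exact: hom_gdrazin.
exists x; split.
- by apply: qI => i; rewrite !rmorphM xb; case: (bP i).
- by apply: qI => i; rewrite !rmorphM xb; case: (bP i).
move=> U tU U0; have [s sU] := qt tU U0.
suff [N sN] : exists N, forall n, (N <= n)%N ->
    forall i, i \in s -> q i ((a - a * a * x) ^+ n.+1) = 0.
  by exists N => n /sN /sU.
elim: s {sU} => [|i s [N IHs]]; first by exists 0%N.
have [_ _ /discrete_tends_to_0[N' iN']] := bP i.
exists (maxn N N') => n; rewrite geq_max => /andP[Nn N'n] j; rewrite inE => /orP[/eqP ->|].
  by rewrite rmorphXn rmorphB !rmorphM xb iN'.
exact: IHs.
Qed.

End LimitDrazin.

Lemma gdrazin_open_hom (R Q : pzRingType) (t : set (set R)) (f : {rmorphism R -> Q}) a b :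
  t [set x | f x = 0] -> gdrazin t a b -> gdrazin setT (f a) (f b).
Proof.
move=> tf [ab bab t0]; split.
- by rewrite -!rmorphM ab.
- by rewrite -!rmorphM bab.
have [|N uN] := t0 _ tf; first by rewrite /= rmorph0.
apply/discrete_tends_to_0; exists N => n /uN.
by rewrite /= rmorphXn rmorphB !rmorphM.
Qed.

(** * Inverse limits *)

Section ProDrazin.
Variables (P : pzRingType -> Prop) (R : pzRingType) (tau : set (set R)).
Hypothesis proR : pro P tau.

Lemma pro_hausdorff : hausdorff tau.
Proof.
have [I [S [_ [p [pI _ ptau]]]]] := proR => x y xy.
have [i pxy] : exists i, p i x <> p i y.
  apply: contrapT => nopxy; apply: xy; apply: pI.
  apply: functional_extensionality_dep => i.
  by apply: contrapT => pxy; apply: nopxy; exists i.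
exists [set z | p i z = p i x], [set z | p i z = p i y]; split=> //.
- by apply/ptau => z zx; exists [:: i] => w /(_ i (mem_head _ _)) /= ->.
- by apply/ptau => z zx; exists [:: i] => w /(_ i (mem_head _ _)) /= ->.
- by apply/seteqP; split=> // z [/= -> /pxy].
Qed.

Lemma pro_gdrazin : (forall A, P A -> pi_regular A) ->
  forall a : R, exists b, gdrazin tau a b.
Proof.
move=> Ppi a; have [I [S [PS [p [pI plim ptau]]]]] := proR.
have pm i j (h : sys_le S i j) x : sys_map h (p j x) = p i x.
  have : range (fun x i => p i x) (fun i => p i x) by exists x.
  by rewrite plim => /(_ i j h).
apply: (@limit_gdrazin I (sys_le S) R (sys_ring S) tau p (@sys_map I S)).
- by move=> x y pxy; apply: pI; apply: functional_extensionality_dep.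
- exact: pm.
- move=> x xm; have : inverse_limit S x by exact: xm.
  by rewrite -plim => -[y _ <-]; exists y.
- move=> U /ptau tU /tU[s sU]; exists s => y ys; apply: sU => i /ys ->.
  by rewrite rmorph0.
- by move=> i; apply/pi_gdrazin; apply: Ppi.
Qed.

Lemma pro_gdrazin_mx n : linear_topology tau -> (forall A, P A -> pi_regular 'M[A]_n) ->
  forall A : 'M[R]_n, exists B, gdrazin (@matrix_topology R tau n) A B.
Proof.
move=> lin Ppi A; have [I [S [PS [p [pI plim ptau]]]]] := proR.
have pm i j (h : sys_le S i j) x : sys_map h (p j x) = p i x.
  have : range (fun x i => p i x) (fun i => p i x) by exists x.
  by rewrite plim => /(_ i j h).
apply: (@limit_gdrazin I (sys_le S) 'M[R]_n (fun i => 'M[sys_ring S i]_n)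
  (@matrix_topology R tau n) (fun i => map_mx (p i)) (fun i j h => map_mx (sys_map h))).
- move=> x y pxy; apply/matrixP => k l; apply: pI; apply: functional_extensionality_dep => i.
  by move/matrixP/(_ k l): (pxy i); rewrite !mxE.
- by move=> i j h x; apply/matrixP => k l; rewrite !mxE pm.
- move=> x xm.
  have /choice[y yx] : forall kl : 'I_n * 'I_n, exists y, forall i, p i y = x i kl.1 kl.2.
    move=> [k l]; have : inverse_limit S (fun i => x i k l).
      by move=> i j h; have /matrixP/(_ k l) := xm i j h; rewrite mxE.
    by rewrite -plim => -[y _ /= yx]; exists y => i; rewrite -[RHS]/((fun i => x i k l) i) -yx.
  exists (\matrix_(k, l) y (k, l)) => i; apply/matrixP => k l; rewrite !mxE.
  by rewrite yx.
- move=> U tU U0; have [J [tJ [rJ _] JU]] := tU _ U0.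
  have [s sJ] := (ptau J).1 tJ 0 (right_ideal0 rJ); exists s => B Bs.
  apply: JU => k l; rewrite mxE subr0; apply: sJ => i /Bs /matrixP/(_ k l).
  by rewrite !mxE rmorph0.
- by move=> i; apply/pi_gdrazin; apply: Ppi.
Qed.

End ProDrazin.

(** * A closed subring as the limit of its images in an inverse system *)

Section ProTransfer.
Variables (R1 R2 : pzRingType) (tau : set (set R2)) (c : R1 -> R2).
Hypotheses (emb : nu_embedding c) (lin : linear_topology tau).
Hypotheses (cl : gdrazin_closed tau c) (clim : closed_image tau c).

Let tau1 := initial_topology c tau.

Variables (I : choiceType) (S : inverse_system I).
Variable p : forall i, {rmorphism R2 -> sys_ring S i}.
Hypothesis pI : injective (fun (x : R2) i => p i x).
Hypothesis plim : range (fun (x : R2) i => p i x) = inverse_limit S.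
Hypothesis ptau : forall U : set R2, tau U <->
  (forall x, U x -> exists s : seq I, forall y, (forall i, i \in s -> p i y = p i x) -> U y).

Let pm i j (h : sys_le S i j) x : sys_map h (p j x) = p i x.
Proof.
have : range (fun x i => p i x) (fun i => p i x) by exists x.
by rewrite plim => /(_ i j h).
Qed.

Let K i := [set x : R1 | p i (c x) = 0].

Let tK i : two_sided_ideal (K i).
Proof.
have [cD cM _] := emb; split; first split; rewrite /K /=.
- by rewrite (emb0 emb) rmorph0.
- by move=> x y px py; rewrite (embB emb) rmorphB px py subrr.
- by move=> x r px; rewrite cM rmorphM px mul0r.
- by move=> x r px; rewrite cM rmorphM px mulr0.
Qed.

Let K_le i j (h : sys_le S i j) x : K j x -> qpi (tK i) x = 0.
Proof. by rewrite /K /= => pjx; apply/qpi_eq0; rewrite /= -(pm h) pjx rmorph0. Qed.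

(** The image of [R1] in [sys_ring S i], presented as a quotient of [R1]. *)
Let Qi i : pzRingType := quotient_ring (tK i).

Let Qmap i j (h : sys_le S i j) : {rmorphism Qi j -> Qi i} :=
  @qlift _ _ (tK j) _ (qpi (tK i)) (K_le h).

Let QmapE i j (h : sys_le S i j) x : Qmap h (qpi (tK j) x) = qpi (tK i) x.
Proof. exact: qliftE. Qed.

Fact image_map_id i (h : sys_le S i i) x : Qmap h x = x.
Proof. by have [y <-] := qpi_surj x; rewrite QmapE. Qed.

Fact image_map_comp i j k (hij : sys_le S i j) (hjk : sys_le S j k) (hik : sys_le S i k) x :
  Qmap hij (Qmap hjk x) = Qmap hik x.
Proof. by have [y <-] := qpi_surj x; rewrite !QmapE. Qed.

Definition image_system : inverse_system I :=
  InverseSystem (sys_inhabited S) (@sys_le_refl _ S) (@sys_le_trans _ S) (@sys_directed _ S)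
    image_map_id image_map_comp.

(** A compatible family of classes comes from some [x] in [R2]. For finitely many indices,
    directedness gives a common upper bound [k], and the representative [r k] agrees with [x] at all
    of them; so [x] is in the closure of the image of [R1], hence in the image. *)
Lemma image_system_limit : is_inverse_limit_of tau1 image_system.
Proof.
have [cD cM cI] := emb.
have qE i x y : qpi (tK i) x = qpi (tK i) y <-> p i (c x) = p i (c y).
  rewrite qpiE /K /= (embB emb) rmorphB; split=> [/eqP|->]; last exact: subrr.
  by rewrite subr_eq0 => /eqP.
exists (fun i => qpi (tK i)); split.
- move=> x y xy; apply: cI; apply: pI; apply: functional_extensionality_dep => i.
  by apply/qE; exact: (congr1 (fun f => f i) xy).
- apply/seteqP; split=> [_ [x _ <-] i j h|q qlim]; first exact: QmapE.
  pose r i := repr (q i).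
  have rq i : qpi (tK i) (r i) = q i by rewrite /qpi reprK.
  have : inverse_limit S (fun i => p i (c (r i))).
    by move=> i j h; rewrite pm; apply/qE; rewrite rq -(qlim i j h) -[in RHS]rq QmapE.
  rewrite -plim => -[x _ /= xr].
  have xri i : p i x = p i (c (r i)) by exact: (congr1 (fun f => f i) xr).
  have [|y yx] := clim (x := x).
    move=> U /ptau tU /tU[s sU].
    have [k ks] : exists k, forall i, i \in s -> sys_le S i k.
      elim: s {sU} => [|i s [k IHs]]; first by have [i] := sys_inhabited S; exists i.
      have [l [il kl]] := sys_directed S i k; exists l => j; rewrite inE => /orP[/eqP -> //|js].
      exact: sys_le_trans (IHs j js) kl.
    by exists (r k); apply: sU => i /ks ik; rewrite -(pm ik) -xri pm.
  exists y => //; apply: functional_extensionality_dep => i.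
  by rewrite -rq; apply/qE; rewrite yx xri.
- move=> U; split=> [[V /ptau tV <-] x /tV[s sV]|Uloc].
    by exists s => y ys; apply: sV => i /ys /qE.
  (* The union of the basic open sets of [R2] centred at points [c x] whose trace on [R1] lies in
     [U]. *)
  exists [set z | exists x (s : seq I), (forall y, (forall i, i \in s -> p i (c y) = p i (c x)) -> U y) /\
      forall i, i \in s -> p i z = p i (c x)].
    apply/ptau => z [x [s [sU zx]]]; exists s => w wz; exists x, s; split=> // i si.
    by rewrite wz // zx.
  apply/seteqP; split=> [x [y [s [sU xy]]]|x Ux]; first exact: sU.
  have [s sU] := Uloc x Ux; exists x, s; split=> // y ys; apply: sU => i /ys /qE.
  by [].
Qed.

Lemma image_system_emb i : nu_embedding (fun q : Qi i => p i (c (repr q))).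
Proof.
have [cD cM cI] := emb.
have cE x : p i (c (repr (qpi (tK i) x))) = p i (c x).
  have := repr_qpi (tK i) x; rewrite /K /= (embB emb) rmorphB => /eqP.
  by rewrite subr_eq0 => /eqP.
split=> q r; have [x <-] := qpi_surj q; have [y <-] := qpi_surj r.
- by rewrite -rmorphD !cE cD rmorphD.
- by rewrite -rmorphM !cE cM rmorphM.
- rewrite !cE => /eqP; rewrite -subr_eq0 -rmorphB -(embB emb) => /eqP xy.
  exact/qpiE.
Qed.

Let tau1K i : tau1 (K i).
Proof.
exists [set z | p i z = 0] => //; apply/ptau => x px; exists [:: i] => y /(_ i (mem_head _ _)).
by rewrite /= px.
Qed.

(** Drazin inverses restrict from [R2] to [R1] and then descend to the quotient by the open ideal
    [K i], where topological nilpotence becomes nilpotence. *)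
Lemma image_system_pi i : (forall a : R2, exists b, gdrazin tau a b) -> pi_regular (Qi i).
Proof.
move=> dr; apply/pi_gdrazin => q; have [a <-] := qpi_surj q.
have [b db] := gdrazin_emb emb cl dr a; exists (qpi (tK i) b).
apply: gdrazin_open_hom db; suff -> : [set x | qpi (tK i) x = 0] = K i by exact: tau1K.
by apply/seteqP; split=> x /= /qpi_eq0.
Qed.

Lemma image_system_mx_pi i n :
  (forall A : 'M[R2]_n, exists B, gdrazin (@matrix_topology R2 tau n) A B) ->
  pi_regular 'M[Qi i]_n.
Proof.
move=> dr; apply/pi_gdrazin => q.
have -> : q = map_mx (qpi (tK i)) (map_mx repr q).
  by apply/matrixP => k l; rewrite !mxE /qpi reprK.
move: (map_mx repr q) => A.
have [B dB] := gdrazin_mx_emb emb lin cl dr A; exists (map_mx (qpi (tK i)) B).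
apply: (gdrazin_open_hom (f := map_mx (qpi (tK i)))) dB.
have [tM _] := matrix_ideal n (tau1K i) (tK i).
suff -> : [set A | map_mx (qpi (tK i)) A = 0] = [set A : 'M[R1]_n | forall k l, K i (A k l)] by [].
apply/seteqP; split=> C /= CK.
  by move=> k l; apply/qpi_eq0; move/matrixP/(_ k l): CK; rewrite !mxE.
by apply/matrixP => k l; rewrite !mxE; apply/qpi_eq0; exact: CK.
Qed.

End ProTransfer.

Lemma scalar_mx1_emb (R : pzRingType) : nu_embedding (fun a : R => a%:M : 'M[R]_1).
Proof.
split=> a b; first exact: raddfD.
- exact: scalar_mxM.
- by move/matrixP/(_ 0 0); rewrite !mxE eqxx !mulr1n.
Qed.

Lemma quasi_inf_gdrazin (R : pzRingType) (tau : set (set R)) :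
  quasi_pi_inf_regular tau -> forall a, exists b, gdrazin tau a b.
Proof.
move=> [lin hd qinf] a; have /quasi_gdrazin[_ _ dr] := qinf 1%N.
have [B] := dr (a%:M); have -> : B = (B 0 0)%:M.
  by apply/matrixP => i j; rewrite !ord1 !mxE eqxx mulr1n.
move: (B 0 0) => b /(gdrazin_reflect (scalar_mx1_emb R))[ab bab t0].
exists b; split=> // U tU; apply: t0.
exists [set A : 'M[R]_1 | U (A 0 0)]; last first.
  by apply/seteqP; split=> x; rewrite /preimage /= !mxE eqxx mulr1n.
move=> A /= /((linear_cosetP _ lin).1 tU)[I [tI iI IU]].
by exists I; split=> // C CA; exact: IU.
Qed.

Lemma has_top_hausdorff (P : top_property) (R : pzRingType) (tau : set (set R)) :
  has_top P tau -> hausdorff tau.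
Proof.
case: P => [Q|Q||||] [_] /=; try by case.
- exact: pro_hausdorff.
- by case=> /pro_hausdorff.
- by case=> -[].
- by case=> -[].
Qed.

Lemma has_top_gdrazin (P : top_property) (R : pzRingType) (tau : set (set R)) :
  has_top P tau -> forall a, exists b, gdrazin tau a b.
Proof.
have proP Q : pro (has_disc Q) tau -> forall a, exists b, gdrazin tau a b.
  by move=> pr; apply: (pro_gdrazin pr) => A; exact: has_disc_pi.
case: P => [Q|Q||||] [_] /=.
- exact: proP.
- by case=> /proP.
- exact: quasi_inf_gdrazin.
- by case=> /quasi_inf_gdrazin.
- by move/quasi_gdrazin => -[].
- by case=> /quasi_gdrazin[].
Qed.

Section TopTransfer.
Variables (R1 R2 : pzRingType) (tau : set (set R2)) (c : R1 -> R2).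
Hypotheses (emb : nu_embedding c) (lin : linear_topology tau).
Hypotheses (cl : gdrazin_closed tau c) (clim : closed_image tau c).

Lemma pro_emb Q : pro (has_disc Q) tau -> pro (has_disc Q) (initial_topology c tau).
Proof.
move=> pr; have [I [S [QS [p [pI plim ptau]]]]] := pr.
exists I, (image_system emb plim); split; last first.
  exact: (image_system_limit emb clim pI plim ptau).
move=> i; apply: (@has_disc_emb Q (sys_ring (image_system emb plim) i) (sys_ring S i) _
  (image_system_emb emb p i)); last exact: QS.
have drR : forall a, exists b, gdrazin tau a b.
  by apply: (pro_gdrazin pr) => A; exact: has_disc_pi.
have inf : (forall A, has_disc Q A -> pi_inf_regular A) ->
    pi_inf_regular (sys_ring (image_system emb plim) i).
  move=> Qinf n; apply: (image_system_mx_pi lin cl ptau).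
  by apply: (pro_gdrazin_mx pr lin) => A /Qinf.
have npi : pi_regular (sys_ring (image_system emb plim) i).
  exact: (image_system_pi cl ptau).
by case: (Q) inf => //= inf; apply: inf => A; [case|].
Qed.

Lemma semiperfect_emb : hausdorff tau -> (forall a, exists b, gdrazin tau a b) ->
  semiperfect R2 -> semiperfect R1.
Proof.
move=> hd dr [sl _].
apply: (gdrazin_semiperfect (initial_linear emb lin) (initial_hausdorff emb hd)).
  exact: gdrazin_emb.
exact: (emb_orthogonal_finite emb (semilocal_orthogonal_finite sl)).
Qed.

Lemma quasi_emb : quasi_pi_regular tau -> quasi_pi_regular (initial_topology c tau).
Proof.
move=> /quasi_gdrazin[_ hd dr]; apply/quasi_gdrazin; split.
- exact: initial_linear.
- exact: initial_hausdorff.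
- exact: gdrazin_emb.
Qed.

Lemma quasi_inf_emb : quasi_pi_inf_regular tau -> quasi_pi_inf_regular (initial_topology c tau).
Proof.
move=> [_ hd qinf]; have lin1 := initial_linear emb lin; have hd1 := initial_hausdorff emb hd.
split=> // n; have /quasi_gdrazin[_ _ dr] := qinf n; apply/quasi_gdrazin; split.
- exact: matrix_linear.
- exact: matrix_hausdorff.
- exact: gdrazin_mx_emb.
Qed.

Lemma has_top_emb (P : top_property) : has_top P tau -> has_top P (initial_topology c tau).
Proof.
move=> Ptau; have hd := has_top_hausdorff Ptau; have dr := has_top_gdrazin Ptau.
have sp := semiperfect_emb hd dr.
split; first exact: initial_linear.
case: P Ptau {hd dr} => [Q|Q||||] [_] /=.
- exact: pro_emb.
- by case=> /pro_emb ? /sp.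
- exact: quasi_inf_emb.
- by case=> /quasi_inf_emb ? /sp.
- exact: quasi_emb.
- by case=> /quasi_emb ? /sp.
Qed.

End TopTransfer.

(** * Centralizers and corners *)

Lemma open_coset (R : pzRingType) (tau : set (set R)) I x : linear_topology tau ->
  tau I -> two_sided_ideal I -> tau [set z | I (z - x)].
Proof.
move=> lin tI iI; apply/(linear_cosetP _ lin) => z Iz; exists I; split=> // y yz /=.
have -> : y - x = (y - z) + (z - x) by ncring.
by case: iI => rI _; exact: right_idealD.
Qed.

Lemma mx_entryP (R1 R2 : pzRingType) (c : R1 -> R2) n (B : 'M[R2]_n) :
  (forall i j, exists y, c y = B i j) -> exists B1, map_mx c B1 = B.
Proof.
move=> Bc; have /choice[y yB] : forall ij : 'I_n * 'I_n, exists y, c y = B ij.1 ij.2.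
  by case=> i j; exact: Bc.
by exists (\matrix_(i, j) y (i, j)); apply/matrixP => i j; rewrite !mxE yB.
Qed.

Lemma scalar_mul_mxE (R : pzRingType) n (s : R) (A : 'M[R]_n) i j :
  (s%:M * A) i j = s * A i j /\ (A * s%:M) i j = A i j * s.
Proof.
rewrite !mxE; split.
  rewrite (bigD1 i) //= !mxE eqxx mulr1n big1 ?addr0 // => k ki.
  by rewrite !mxE eq_sym (negPf ki) mul0r.
rewrite (bigD1 j) //= !mxE eqxx mulr1n big1 ?addr0 // => k kj.
by rewrite !mxE (negPf kj) mulr0.
Qed.

Section Centralizer.
Variables (R1 R2 S : pzRingType) (c : R1 -> R2) (v : R2 -> S) (X : set S).
Variable tau : set (set S).
Hypotheses (vemb : nu_embedding v) (lin : linear_topology tau) (hd : hausdorff tau).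
Hypothesis cX : forall x, (exists y, c y = x) <-> forall s, X s -> s * v x = v x * s.

Let tau2 := initial_topology v tau.

(** [R1] is cut out of [R2] by commutation with elements of a larger ring [S], as [End(rho)] is cut
    out of [End(rho|_H)] inside [End M]. A Drazin inverse in [R2] remains one in [S], where
    [gdrazin_comm] applies. For matrices, commuting with every [s%:M] is an entrywise condition. *)
Lemma centralizer_gdrazin_closed : gdrazin_closed tau2 c.
Proof.
split=> [a b dab|n A B dAB].
  apply/cX => s Xs.
  apply: (gdrazin_comm lin hd (gdrazin_push vemb dab)).
  exact: ((cX (c a)).1 (ex_intro _ a erefl) s Xs).
apply: mx_entryP => i j; apply/cX => s Xs.
have /matrixP/(_ i j) : s%:M * map_mx v B = map_mx v B * s%:M.
  apply: (gdrazin_comm (matrix_linear lin n) (matrix_hausdorff lin hd)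
    (gdrazin_mx_push vemb dAB)).
  apply/matrixP => k l; have [-> ->] := scalar_mul_mxE s (map_mx v (map_mx c A)) k l.
  by rewrite !mxE; exact: ((cX (c (A k l))).1 (ex_intro _ (A k l) erefl) s Xs).
by have [-> ->] := scalar_mul_mxE s (map_mx v B) i j; rewrite !mxE.
Qed.

(** If an element of the image agrees with [x] modulo [I], the commutator of [s] and [v x] lies in
    [I]. *)
Lemma centralizer_closed_image : closed_image tau2 c.
Proof.
move=> x clx; apply/cX => s Xs; apply/eqP; rewrite -subr_eq0; apply/eqP.
apply: (linear_separated lin hd) => I tI iI; have [rI lI] := iI.
have [||y Iy] := clx (v @^-1` [set z | I (z - v x)]).
- by exists [set z | I (z - v x)] => //; exact: (open_coset _ lin tI iI).
- by rewrite /preimage /= subrr; exact: (right_ideal0 rI).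
have sy : s * v (c y) = v (c y) * s by exact: ((cX (c y)).1 (ex_intro _ y erefl) s Xs).
have -> : s * v x - v x * s = (v (c y) - v x) * s - s * (v (c y) - v x).
  by rewrite mulrBr mulrBl sy; ncring.
by apply: right_idealB => //; [exact: right_idealM|exact: lI].
Qed.

End Centralizer.

Section Corner.
Variables (R1 R2 : pzRingType) (c : R1 -> R2) (e : R2).
Variable tau : set (set R2).
Hypothesis ce : forall x, (exists y, c y = x) <-> e * x = x /\ x * e = x.

(** [b = a * b * b = b * b * a], so [b] is fixed by every [f] that fixes [a]. *)
Let corner_drazin (A : pzRingType) (a b f : A) : a * b = b * a -> b * a * b = b ->
  f * a = a -> a * f = a -> f * b = b /\ b * f = b.
Proof.
move=> ab bab fa af; split.
  have abb : a * b * b = b by rewrite ab bab.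
  by rewrite -{1}abb !mulrA fa abb.
have bba : b * b * a = b by rewrite -mulrA -ab mulrA bab.
by rewrite -{1}bba -mulrA af bba.
Qed.

Lemma corner_gdrazin_closed : gdrazin_closed tau c.
Proof.
split=> [a b [ab bab _]|n A B [ab bab _]].
  have [ea ae] := (ce (c a)).1 (ex_intro _ a erefl).
  by apply/ce; exact: corner_drazin ab bab ea ae.
apply: mx_entryP => i j; apply/ce.
have [|| /matrixP/(_ i j) eB /matrixP/(_ i j) Be] := corner_drazin (f := e%:M) ab bab.
- apply/matrixP => k l; have [-> _] := scalar_mul_mxE e (map_mx c A) k l.
  by rewrite mxE; have [] := (ce (c (A k l))).1 (ex_intro _ (A k l) erefl).
- apply/matrixP => k l; have [_ ->] := scalar_mul_mxE e (map_mx c A) k l.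
  by rewrite mxE; have [] := (ce (c (A k l))).1 (ex_intro _ (A k l) erefl).
by have [<- <-] := scalar_mul_mxE e B i j.
Qed.

Lemma corner_closed_image : linear_topology tau -> hausdorff tau -> closed_image tau c.
Proof.
move=> lin hd x clx; have key I : two_sided_ideal I -> tau I -> exists2 z, I (z - x) & 
    e * z = z /\ z * e = z.
  move=> iI tI; have [||w Iw] := clx [set z | I (z - x)]; first exact: (open_coset _ lin tI iI).
    by rewrite /= subrr; case: iI => -[].
  by exists (c w) => //; apply/ce; exists w.
apply/ce; split; apply/eqP; rewrite eq_sym -subr_eq0; apply/eqP/(linear_separated lin hd) => I tI iI.
all: have [z Iz [ez ze]] := key I iI tI; have [rI lI] := iI.
- have -> : x - e * x = e * (z - x) - (z - x) by rewrite mulrBr ez; ncring.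
  by apply: right_idealB => //; exact: lI.
- have -> : x - x * e = (z - x) * e - (z - x) by rewrite mulrBl ze; ncring.
  by apply: right_idealB => //; exact: right_idealM.
Qed.

End Corner.

(** * Azumaya's theorem for idempotents *)

Section Azumaya.
Variable R : pzRingType.
Implicit Types e f g h p q u v w x y : R.

(** Isomorphism of the right ideals [e * R] and [f * R]; in an endomorphism ring, of the images of
    [e] and [f]. *)
Definition idem_iso e f := exists u v,
  [/\ [/\ e * u = u, u * f = u & u * v = e] & [/\ f * v = v, v * e = v & v * u = f]].

Lemma idem_iso_trans e f g : idem_iso e f -> idem_iso f g -> idem_iso e g.
Proof.
move=> [u [v [[eu uf uv] [fv ve vu]]]] [x [y [[fx xg xy] [gy yf yx]]]].
exists (u * x), (y * v); split; split.
- by rewrite mulrA eu.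
- by rewrite -mulrA xg.
- by rewrite mulrA -[u * x * y]mulrA xy uf.
- by rewrite mulrA gy.
- by rewrite -mulrA ve.
- by rewrite mulrA -[y * v * u]mulrA vu yf.
Qed.

Lemma idem_iso_primitive e f : idem_iso e f -> primitive_idem f -> primitive_idem e.
Proof.
move=> [u [v [[eu uf uv] [fv ve vu]]]] [ff f0 prim].
have ee : e * e = e by rewrite -{2}uv mulrA eu uv.
split=> // [e0|g gg eg ge].
  by apply: f0; rewrite -vu -ve e0 mulr0 mul0r.
have [||||] := prim (v * g * u).
- by rewrite -!mulrA [u * (v * _)]mulrA uv [e * _]mulrA eg [g * (g * _)]mulrA gg.
- by rewrite !mulrA fv.
- by rewrite -mulrA uf.
- by move=> vgu; left; rewrite -ge -eg -uv -!mulrA [v * (g * _)]mulrA [v * g * (u * _)]mulrA vgu mul0r mulr0.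
- move=> vgu; right.
  by rewrite -ge -eg -{2}uv -uv -!mulrA [v * (g * _)]mulrA [v * g * (u * _)]mulrA vgu fv uv.
Qed.

Lemma local_primitive e : local_idem e -> primitive_idem e.
Proof.
move=> [ee e0 loc]; split=> // g gg eg ge.
have inv_idem x : x * x = x -> e * x = x -> corner_inv e x -> x = e.
  by move=> xx ex [y [_ _ xy yx]]; rewrite -yx -{2}xx mulrA yx ex.
have [/inv_idem|/inv_idem] := loc g eg ge; first by move=> gE; right; exact: gE.
move=> eE; left; have := eE _ _; rewrite mulrBl !mulrBr ee eg ge gg subrr subr0.
by move=> /(_ erefl erefl)/eqP; rewrite -subr_eq0 addrAC subrr sub0r oppr_eq0 => /eqP.
Qed.

(** If [z] inverts [x + y], then [x * z] and [y * z] add up to [e], so one of them is a unit; a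
    right inverse in the corner is two-sided by primitivity. *)
Lemma local_nonunitD e x y : local_idem e -> e * x = x -> x * e = x ->
  e * y = y -> y * e = y -> corner_inv e (x + y) -> corner_inv e x \/ corner_inv e y.
Proof.
move=> le ex xe ey ye [z [ez ze xyz _]]; have prim := local_primitive le.
have [ee _ loc] := le.
have inv a : e * a = a -> a * e = a -> corner_inv e (a * z) -> corner_inv e a.
  move=> ea ae [w [ew we aw wa]]; exists (z * w); split.
  - by rewrite mulrA ez.
  - by rewrite -mulrA we.
  - by rewrite mulrA.
  - apply: primitive_right_inv => //; last by rewrite mulrA.
      by rewrite mulrA ez.
    by rewrite -mulrA we.
have [||xz|exz] := loc (x * z).
- by rewrite mulrA ex.
- by rewrite -mulrA ze.
- by left; exact: inv.
right; apply: inv => //; suff -> : y * z = e - x * z by [].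
by rewrite -xyz; ncring.
Qed.

Lemma local_sum_unit (J : finType) (B : {set J}) (x : J -> R) e : local_idem e ->
  (forall j, e * x j = x j /\ x j * e = x j) -> \sum_(j in B) x j = e ->
  exists2 j, j \in B & corner_inv e (x j).
Proof.
move=> le ex sx; have [ee e0 _] := le.
have : corner_inv e (\sum_(j in B) x j) by rewrite sx; exists e.
apply: contraPP => noj.
suff [_ []] : [/\ e * (\sum_(j in B) x j) = \sum_(j in B) x j,
  (\sum_(j in B) x j) * e = \sum_(j in B) x j & ~ corner_inv e (\sum_(j in B) x j)] by [].
apply: (big_ind (fun y => [/\ e * y = y, y * e = y & ~ corner_inv e y])).
- split; rewrite ?mulr0 ?mul0r // => -[y [_ _ yy _]].
  by apply: e0; rewrite -yy mul0r.
- move=> y z [ey ye ny] [ez ze nz]; split; rewrite ?mulrDr ?mulrDl ?ey ?ez ?ye ?ze //.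
  by move=> /(local_nonunitD le ey ye ez ze)[].
- move=> j jB; have [exj xje] := ex j; split=> // xinv.
  by apply: noj; exists j.
Qed.

(* With [x] the inverse of [e * f * e] in [e R e], the idempotent [h = f * x] has
   the same left annihilator as [e] and generates the same right ideal as [f],
   so [p - e], [p - h] and [p - f] are isomorphic. *)
Lemma idem_exchange p e f : primitive_idem f -> e <> 0 ->
  p * p = p -> p * e = e -> e * p = e -> p * f = f -> f * p = f ->
  corner_inv e (e * f * e) -> idem_iso e f /\ idem_iso (p - e) (p - f).
Proof.
move=> [ff f0 prim] e0 pp pe ep pf fp [y [ey ye xy yx]].
pose h := f * y.
have fh : f * h = h by rewrite /h mulrA ff.
have he : h * e = h by rewrite /h -mulrA ye.
have eh : e * h = e.
  by transitivity (e * f * e * y); [rewrite /h -!mulrA ey|exact: xy].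
have hh : h * h = h by rewrite -{1}he -mulrA eh he.
have ph : p * h = h by rewrite /h mulrA pf.
have hp : h * p = h by rewrite -{1}he -mulrA ep he.
have hf : h * f = f.
  have [|||hf0|//] := prim (h * f).
  - by rewrite mulrA -[h * f * h]mulrA fh hh.
  - by rewrite mulrA fh.
  - by rewrite -mulrA ff.
  have h0 : h = 0 by rewrite -hh -{2}fh mulrA hf0 mul0r.
  by case: e0; rewrite -eh h0 mulr0.
clearbody h; split.
  exists (e * f), h; split; split.
  - have ee : e * e = e by rewrite -{1}eh -mulrA he eh.
    by rewrite mulrA ee.
  - by rewrite -mulrA ff.
  - by rewrite -mulrA fh eh.
  - by [].
  - by [].
  - by rewrite mulrA he hf.
have ab : (p - e) * (p - h) = p - h by rewrite mulrBl !mulrBr pp ph ep eh; ncring.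
have ba : (p - h) * (p - e) = p - e by rewrite mulrBl !mulrBr pp pe hp he; ncring.
have bd : (p - h) * (p - f) = p - h by rewrite mulrBl !mulrBr pp pf hp hf; ncring.
have db : (p - f) * (p - h) = p - f by rewrite mulrBl !mulrBr pp ph fp fh; ncring.
have dd : (p - f) * (p - f) = p - f by rewrite mulrBl !mulrBr pp pf fp ff; ncring.
have ee : e * e = e by rewrite -{1}eh -mulrA he eh.
have aa : (p - e) * (p - e) = p - e by rewrite mulrBl !mulrBr pp pe ep ee; ncring.
(* [ab] and [ba] make [p - e] and [p - h] isomorphic, [bd] and [db] do so for [p - h] and [p - f];
   the witnesses are the composites. *)
exists (p - h), ((p - f) * (p - e)); split; split=> //.
- by rewrite mulrA bd ba.
- by rewrite mulrA dd.
- by rewrite -mulrA aa.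
- by rewrite -mulrA ab db.
Qed.

Lemma idem_iso0 p : idem_iso 0 p -> p = 0.
Proof. by move=> [u [v [[u0 _ _] [_ _ <-]]]]; rewrite -u0 mul0r mulr0. Qed.

Definition orthogonal_on (I : finType) (A : {set I}) (u : I -> R) :=
  forall i j, i \in A -> j \in A -> i != j -> u i * u j = 0.

Lemma orthogonal_on_sum (I : finType) (A : {set I}) (u : I -> R) i :
  (forall i, i \in A -> u i * u i = u i) -> orthogonal_on A u -> i \in A ->
  u i * (\sum_(j in A) u j) = u i /\ (\sum_(j in A) u j) * u i = u i.
Proof.
move=> uu uij iA; split.
  rewrite mulr_sumr (bigD1 i) //= uu // big1 ?addr0 // => j /andP[jA ji].
  by rewrite uij // eq_sym.
by rewrite mulr_suml (bigD1 i) //= uu // big1 ?addr0 // => j /andP[jA ji]; rewrite uij.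
Qed.

Lemma orthogonal_sum_idem (I : finType) (A : {set I}) (u : I -> R) :
  (forall i, i \in A -> u i * u i = u i) -> orthogonal_on A u ->
  (\sum_(j in A) u j) * (\sum_(j in A) u j) = \sum_(j in A) u j.
Proof.
move=> uu uij; rewrite {1}mulr_suml; apply: eq_bigr => i iA.
by have [-> _] := orthogonal_on_sum uu uij iA.
Qed.

(** Induction on [A]: the [w j] are transported to idempotents [w' j] with the same sum [p] as the
    [u i], one [u i] is exchanged for some [w' j], and the remainders [p - u i] and [p - w' j] stay
    isomorphic. Subsets [A] and [B] of fixed types let the induction delete indices; [option]
    provides values outside [A] even when [J] is empty. *)
Lemma azumaya (I J : finType) (u : I -> R) (A : {set I}) (w : J -> R) (B : {set J}) :
  (forall i, i \in A -> local_idem (u i)) -> orthogonal_on A u ->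
  (forall j, j \in B -> primitive_idem (w j)) -> orthogonal_on B w ->
  idem_iso (\sum_(i in A) u i) (\sum_(j in B) w j) ->
  exists f : I -> option J, [/\ {in A &, injective f}, f @: A = Some @: B &
    forall i j, i \in A -> f i = Some j -> idem_iso (u i) (w j)].
Proof.
have [n] := ubnP #|A|; elim: n => // n IHn in A w B *; rewrite ltnS => An uloc uij wprim wij iso.
have ww j : j \in B -> w j * w j = w j by case/wprim.
have uu i : i \in A -> u i * u i = u i by case/uloc.
have [A0|[i iA]] := set_0Vmem A.
  exists (fun=> None); rewrite A0; split=> [i j|| //]; first by rewrite inE.
  rewrite imset0; have [->|[j jB]] := set_0Vmem B; first by rewrite imset0.
  rewrite A0 big_set0 in iso; have [_ w0 _] := wprim j jB; case: w0.
  by have [<- _] := orthogonal_on_sum ww wij jB; rewrite (idem_iso0 iso) mulr0.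
have [U [V [[pU UP UV] [PV Vp VU]]]] := iso.
have pp := orthogonal_sum_idem uu uij; have PP := orthogonal_sum_idem ww wij.
set p := \sum_(i in A) u i in pU UV Vp pp; set P := \sum_(j in B) w j in UP PV VU PP.
have wP j : j \in B -> w j * P = w j /\ P * w j = w j by exact: orthogonal_on_sum.
have up k : k \in A -> u k * p = u k /\ p * u k = u k by exact: orthogonal_on_sum.
pose w' j := U * w j * V.
have ww' j k : j \in B -> w' j * w' k = U * (w j * w k) * V.
  move=> jB; rewrite /w' -!mulrA [V * (U * _)]mulrA VU [w j * (P * _)]mulrA.
  by have [-> _] := wP j jB.
have w'iso j : j \in B -> idem_iso (w' j) (w j).
  move=> jB; have [wjP Pwj] := wP j jB; exists (U * w j), (w j * V); split; split.
  - by rewrite /w' -!mulrA [V * (U * _)]mulrA VU Pwj ww.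
  - by rewrite -mulrA ww.
  - by rewrite -mulrA [w j * (w j * V)]mulrA ww // /w' mulrA.
  - by rewrite mulrA ww.
  - by rewrite /w' -!mulrA [V * (U * _)]mulrA VU [w j * (P * _)]mulrA wjP [w j * (w j * _)]mulrA ww.
  - by rewrite -mulrA [V * (U * _)]mulrA VU Pwj ww.
have w'prim j : j \in B -> primitive_idem (w' j).
  by move=> jB; apply: idem_iso_primitive (w'iso j jB) (wprim j jB).
have w'ij : orthogonal_on B w'.
  by move=> j k jB kB jk; rewrite ww' // wij // mulr0 mul0r.
have w'w' j : j \in B -> w' j * w' j = w' j by case/w'prim.
have w'p : \sum_(j in B) w' j = p by rewrite /w' -mulr_suml -mulr_sumr -/P UP UV.
have [ui0 [up1 pu1]] : u i <> 0 /\ u i * p = u i /\ p * u i = u i.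
  by split; [case: (uloc i iA)|exact: up].
(* [u i] is the sum of the [u i * w' j * u i], so by locality one of these is a unit of the
   corner. *)
have [||j jB uinv] := @local_sum_unit J B (fun j => u i * w' j * u i) (u i) (uloc i iA).
- by move=> j; split; rewrite ?mulrA ?uu // -mulrA uu.
- by rewrite -mulr_suml -mulr_sumr w'p up1 uu.
have [w'p1 pw'1] := orthogonal_on_sum w'w' w'ij jB; rewrite w'p in w'p1 pw'1.
have [uiw' iso'] := idem_exchange (w'prim j jB) ui0 pp pu1 up1 pw'1 w'p1 uinv.
have uD : \sum_(k in A :\ i) u k = p - u i by rewrite /p (big_setD1 i iA) /= addrAC subrr add0r.
have wD : \sum_(k in B :\ j) w' k = p - w' j.
  by rewrite -w'p (big_setD1 j jB) /= addrAC subrr add0r.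
have [||||||f [finj fAB fiso]] := IHn (A :\ i) w' (B :\ j).
- by move: An; rewrite (cardsD1 i) iA.
- by move=> k /setD1P[_]; exact: uloc.
- by move=> k l /setD1P[_ kA] /setD1P[_ lA]; exact: uij.
- by move=> k /setD1P[_]; exact: w'prim.
- by move=> k l /setD1P[_ kB] /setD1P[_ lB]; exact: w'ij.
- by rewrite uD wD.
have fD k : k \in A -> k != i -> exists2 l, l \in B :\ j & f k = Some l.
  move=> kA ki; have : f k \in Some @: (B :\ j).
    by rewrite -fAB imset_f // !inE ki.
  by case/imsetP => l lB ->; exists l.
exists (fun k => if k == i then Some j else f k); split.
- move=> k l kA lA; case: eqVneq => [->|ki]; case: eqVneq => [->|li] //.
  + by have [m + ->] := fD l lA li => + [jm]; rewrite -jm !inE eqxx.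
  + by have [m + ->] := fD k kA ki => + [jm]; rewrite jm !inE eqxx.
  + by apply: finj; rewrite !inE ?ki ?li.
- rewrite -(finset.setD1K iA) imsetU1 eqxx -(finset.setD1K jB) imsetU1; congr (_ |: _).
  rewrite -fAB; apply: eq_in_imset => k; rewrite !inE => /andP[ki _].
  by rewrite (negPf ki).
- move=> k l kA; case: eqVneq => [-> [<-]|ki fkl].
    exact: idem_iso_trans uiw' (w'iso j jB).
  have [m mB fkm] := fD k kA ki.
  have lB : l \in B.
    by move: fkl; rewrite fkm => -[<-]; case/setD1P: mB.
  by apply: idem_iso_trans (w'iso l lB); apply: fiso; rewrite ?inE ?ki.
Qed.

End Azumaya.

(** * Endomorphisms of representations *)

Section Action.
Variables (R : pzRingType) (G : monoid_or_ring) (M : lmodType R^c).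
Variables (rho : representation G M) (H : set G).
Implicit Types (x y : endrep rho H) (m : M).

Definition act x : {linear M -> M} := endrep_val x.

Lemma act_inj x y : (forall m, act x m = act y m) -> x = y.
Proof. by move=> xy; apply: val_inj; apply: endoP. Qed.

Lemma actM x y m : act (x * y) m = act x (act y m). Proof. by []. Qed.
Lemma actD x y m : act (x + y) m = act x m + act y m. Proof. by []. Qed.
Lemma act1 m : act 1 m = m. Proof. by []. Qed.
Lemma act0 m : act 0 m = 0. Proof. by []. Qed.

Lemma act_sum (I : finType) (x : I -> endrep rho H) m :
  act (\sum_i x i) m = \sum_i act (x i) m.
Proof. exact: (big_morph (fun y => act y m) (fun a b => actD a b m) (act0 m)). Qed.

Lemma act_comm x g m : H g -> act x (rho g m) = rho g (act x m).
Proof.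
case: x => f fc Hg; have /asboolP/(_ g Hg) := fc.
by move=> /(congr1 (fun h : endo M => h m)).
Qed.

Lemma endrep_ex (f : M -> M) : linear f ->
  (forall g m, H g -> f (rho g m) = rho g (f m)) ->
  exists x : endrep rho H, forall m, act x m = f m.
Proof.
move=> lf fg.
pose fl : {linear M -> M} := HB.pack f (GRing.isLinear.Build R^c M M _ f lf).
have fc : (fl : endo M) \in commutant rho H.
  by apply/asboolP => g Hg; apply: endoP => m; exact: fg.
by exists (EndRep fc).
Qed.

Lemma endrep_val_emb : nu_embedding (@endrep_val R G M rho H).
Proof. by split=> // x y; exact: val_inj. Qed.

End Action.

Section FixedSubmodule.
Variables (R : pzRingType) (G : monoid_or_ring) (M : lmodType R^c).
Variables (rho : representation G M) (f : endrep rho setT).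

(** For an idempotent [f] this is its image, the summand that [f] cuts out. *)
Definition fixpred : {pred M} := [pred m | act f m == m].

Fact fixpred_submod : subsemimod_closed fixpred.
Proof.
split; first split.
- by rewrite !inE raddf0.
- by move=> x y; rewrite !inE => /eqP fx /eqP fy; apply/eqP; rewrite -[in RHS]fx -[in RHS]fy; exact: raddfD.
- by move=> a x; rewrite !inE => /eqP fx; apply/eqP; rewrite -[RHS](congr1 (fun y => a *: y) fx); exact: linearZZ.
Qed.

Record fixmod := FixMod { fix_val : M; _ : fix_val \in fixpred }.

HB.instance Definition _ := [isSub for fix_val].
HB.instance Definition _ := [Choice of fixmod by <:].
HB.instance Definition _ := GRing.SubChoice_isSubLmodule.Build
  R^c M fixpred fixmod fixpred_submod.

Lemma fix_valP (x : fixmod) : act f (fix_val x) = fix_val x.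
Proof. by case: x => m mf; apply/eqP. Qed.

Lemma fix_val_inj : injective fix_val. Proof. exact: val_inj. Qed.

Lemma fix_rep_ex : exists sigma : representation G fixmod,
  forall g x, fix_val (sigma g x) = rho g (fix_val x).
Proof.
have frho g (x : fixmod) : rho g (fix_val x) \in fixpred.
  by rewrite inE act_comm // fix_valP.
pose s g x := FixMod (frho g x).
have slin g : linear (s g).
  by move=> a x y; apply: fix_val_inj; rewrite /= linearP.
pose sl g : {linear fixmod -> fixmod} :=
  HB.pack (s g) (GRing.isLinear.Build R^c fixmod fixmod _ (s g) (slin g)).
have sP g x : fix_val (sl g x) = rho g (fix_val x) by [].
suff hom : is_hom (fun g => sl g : endo fixmod) by exists (Representation hom).
move: sl sP; clear; case: G rho f => A r h /= sl sP.
- have [r1 rM] := rep_hom r; split=> [|a b]; apply: endoP => x; apply: fix_val_inj.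
  + by rewrite sP r1.
  + by rewrite sP rM /= !sP.
- have [r1 rD rM] := rep_hom r; split=> [|a b|a b]; apply: endoP => x; apply: fix_val_inj.
  + by rewrite sP r1.
  + by rewrite sP rD /= !sP.
  + by rewrite sP rM /= !sP.
Qed.

End FixedSubmodule.

(** * Decompositions of a representation and orthogonal idempotents *)

Section Components.
Variables (R : pzRingType) (G : monoid_or_ring) (M : lmodType R^c).
Variables (rho : representation G M) (t : nat) (D : decomposition rho t).
Let N := summand_mod D.
Let phi := dec_map D.
Implicit Types (i j : 'I_t) (m : M).

Lemma dec_inv_ex : exists g : dsum N -> M, cancel phi g /\ cancel g phi.
Proof. by have [[g phiK gK] _] := dec_iso D; exists g. Qed.

Definition dec_inv : dsum N -> M := projT1 (cid dec_inv_ex).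

Lemma dec_mapK : cancel phi dec_inv. Proof. by have [] := projT2 (cid dec_inv_ex). Qed.
Lemma dec_invK : cancel dec_inv phi. Proof. by have [] := projT2 (cid dec_inv_ex). Qed.

Definition inj i (n : N i) : M := dec_inv (dfwith (fun=> 0) n : forall j, N j).
Definition pr i m : N i := phi m i.

Lemma comp_eq m m' : (forall i, pr i m = pr i m') -> m = m'.
Proof.
by move=> mm'; rewrite -[m]dec_mapK -[m']dec_mapK; congr dec_inv;
   apply: functional_extensionality_dep.
Qed.

Lemma pr_linear i : linear (pr i).
Proof. by move=> a x y; rewrite /pr linearP. Qed.

Lemma pr_inj_neq i j (n : N i) : i != j -> pr j (inj n) = 0.
Proof. by move=> ij; rewrite /pr /inj dec_invK dfwith_out. Qed.

Lemma pr_inj i (n : N i) : pr i (inj n) = n.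
Proof. by rewrite /pr /inj dec_invK dfwith_in. Qed.

Lemma pr_rho i g m : pr i (rho g m) = summand D i g (pr i m).
Proof. by have [_ phig] := dec_iso D; rewrite /pr /phi phig. Qed.

Lemma inj_linear i : linear (@inj i).
Proof.
move=> a x y; apply: comp_eq => j; rewrite pr_linear.
have [<-|ij] := eqVneq i j; first by rewrite !pr_inj.
by rewrite !pr_inj_neq // scaler0 addr0.
Qed.

Lemma inj_rho i g (n : N i) : inj (summand D i g n) = rho g (inj n).
Proof.
apply: comp_eq => j; rewrite pr_rho.
have [<-|ij] := eqVneq i j; first by rewrite !pr_inj.
by rewrite !pr_inj_neq // raddf0.
Qed.

Lemma inj0 i : inj (0 : N i) = 0.
Proof.
apply: comp_eq => j; have -> : pr j 0 = 0 by rewrite /pr raddf0.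
by have [<-|ij] := eqVneq i j; [rewrite pr_inj|rewrite pr_inj_neq].
Qed.

Lemma component_ex i (x : endrep (summand D i) setT) :
  exists y : endrep rho setT, forall m, act y m = inj (act x (pr i m)).
Proof.
apply: endrep_ex => [a m m'|g m _].
  by rewrite pr_linear linearP inj_linear.
by rewrite pr_rho act_comm // inj_rho.
Qed.

Definition component i x : endrep rho setT := projT1 (cid (@component_ex i x)).

Lemma componentE i x m : act (@component i x) m = inj (act x (pr i m)).
Proof. by rewrite /component; case: cid. Qed.

Lemma component_emb i : nu_embedding (@component i).
Proof.
split.
- move=> x y; apply: act_inj => m; rewrite actD !componentE actD.
  by have := inj_linear 1 (act x (pr i m)) (act y (pr i m)); rewrite !scale1r.
- by move=> x y; apply: act_inj => m; rewrite actM !componentE actM pr_inj.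
- move=> x y xy; apply: act_inj => n.
  have := congr1 (fun z => pr i (act z (inj n))) xy.
  by rewrite !componentE !pr_inj.
Qed.

Definition proj_idem i := component (1 : endrep (summand D i) setT).

Lemma proj_idemE i m : act (proj_idem i) m = inj (pr i m).
Proof. by rewrite componentE act1. Qed.

Lemma component_corner i x : (exists y, @component i y = x) <->
  proj_idem i * x = x /\ x * proj_idem i = x.
Proof.
have [cD cM cI] := component_emb i; split=> [[y <-]|[ex xe]].
  by rewrite /proj_idem -!cM mul1r mulr1.
have [|g n _|y yE] := @endrep_ex _ _ _ (summand D i) setT (fun n => pr i (act x (inj n))).
- by move=> a n n'; rewrite inj_linear linearP pr_linear.
- by rewrite inj_rho act_comm // pr_rho.
exists y; apply: act_inj => m; rewrite componentE yE.
by rewrite -!proj_idemE -!actM -mulrA xe ex.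
Qed.

Lemma proj_idem_orth i j : i != j -> proj_idem i * proj_idem j = 0.
Proof.
move=> ij; apply: act_inj => m; rewrite actM !proj_idemE act0 pr_inj_neq ?inj0 //.
by rewrite eq_sym.
Qed.

Lemma proj_idem_idem i : proj_idem i * proj_idem i = proj_idem i.
Proof. by have [_ <- _] := component_emb i; rewrite mulr1. Qed.

Lemma proj_idem_sum : \sum_i proj_idem i = 1.
Proof.
apply: act_inj => m; rewrite act_sum act1; apply: comp_eq => j.
have prD : {morph pr j : x y / x + y} by move=> x y; rewrite /pr raddfD.
have pr0 : pr j 0 = 0 by rewrite /pr raddf0.
rewrite (big_morph (pr j) prD pr0) (bigD1 j) //= proj_idemE pr_inj.
by rewrite big1 ?addr0 // => i ij; rewrite proj_idemE pr_inj_neq.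
Qed.

Lemma proj_idem0 i : proj_idem i = 0 <-> zero_module (summand_mod D i).
Proof.
split=> [ei0 n|zN].
  have := proj_idemE i (inj n); rewrite ei0 act0 pr_inj => /(congr1 (pr i)).
  by rewrite pr_inj => <-; rewrite /pr raddf0.
by apply: act_inj => m; rewrite proj_idemE (zN (pr i m)) inj0 act0.
Qed.

(** The equation on [psi] has exactly one solution, the endomorphism underlying [component phi], so
    the set attached to [V] is a preimage. *)
Lemma summand_topologyE (tau : set (set (endo M))) i :
  summand_topology tau (D := D) (i := i) =
  initial_topology (@component i) (endrep_topology (rho := rho) (H := setT) tau).
Proof.
have key V : [set f | exists2 psi : endo M, V psi & forall m, dec_map D (psi m) =
      dfwith (fun=> 0) (endrep_val f (dec_map D m i)) :> (forall j, _)] =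
    (@component i) @^-1` ((@endrep_val R G M rho setT) @^-1` V).
  have compE f m : phi (act (component f) m) =
      dfwith (fun=> 0) (endrep_val f (dec_map D m i)) :> (forall j, N j).
    by rewrite componentE /inj dec_invK.
  apply/seteqP; split=> f /=.
    move=> [psi Vpsi psiE]; suff -> : endrep_val (component f) = psi by [].
    apply: endoP => m; apply: (can_inj dec_mapK); rewrite [RHS]psiE; exact: compE.
  by move=> Vf; exists (endrep_val (component f)) => // m; exact: compE.
apply/seteqP; split=> [_ [V tV <-]|_ [_ [V tV <-] <-]].
  by exists (@endrep_val R G M rho setT @^-1` V); [exists V|rewrite key].
by exists V; rewrite // key.
Qed.

End Components.

Lemma idem_iso_reps (R : pzRingType) (G : monoid_or_ring) (M : lmodType R^c)
    (rho : representation G M) t t' (D : decomposition rho t) (D' : decomposition rho t') i j :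
  idem_iso (proj_idem D i) (proj_idem D' j) ->
  isomorphic_reps (summand D i) (summand D' j).
Proof.
move=> [u [v [[eu uf uv] [fv ve vu]]]].
pose f (n : summand_mod D i) : summand_mod D' j := pr D' j (act v (inj n)).
pose g (n : summand_mod D' j) : summand_mod D i := pr D i (act u (inj n)).
have flin : linear f by move=> a x y; rewrite /f inj_linear linearP pr_linear.
pose fl : {linear summand_mod D i -> summand_mod D' j} :=
  HB.pack f (GRing.isLinear.Build R^c _ _ _ f flin).
exists fl; split; last first.
  by move=> h n; rewrite /= /f inj_rho act_comm // pr_rho.
exists g => n /=; rewrite /f /g.
  by rewrite -proj_idemE -!actM uf uv proj_idemE !pr_inj.
by rewrite -proj_idemE -!actM ve vu proj_idemE !pr_inj.
Qed.

Lemma idem_decomposition (R : pzRingType) (G : monoid_or_ring) (M : lmodType R^c)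
    (rho : representation G M) t (u : 'I_t -> endrep rho setT) :
  (forall i, u i * u i = u i) -> (forall i j, i != j -> u i * u j = 0) -> \sum_i u i = 1 ->
  exists D : decomposition rho t, forall i, proj_idem D i = u i.
Proof.
move=> uu uij u1.
pose N i : lmodType R^c := fixmod (u i).
pose sigma i : representation G (N i) := projT1 (cid (fix_rep_ex (u i))).
have sigmaE i g x : fix_val (sigma i g x) = rho g (fix_val x).
  exact: (projT2 (cid (fix_rep_ex (u i)))).
have Pf i m : act (u i) m \in fixpred (u i) by rewrite inE -actM uu.
pose f m : dsum N := fun i => FixMod (Pf i m).
have flin : linear f.
  move=> a x y; apply: functional_extensionality_dep => i; apply: fix_val_inj.
  by rewrite /= linearP.
pose fl : {linear M -> dsum N} := HB.pack f (GRing.isLinear.Build R^c M (dsum N) _ f flin).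
pose g (y : dsum N) : M := \sum_i fix_val (y i).
have actsum i (F : 'I_t -> M) : act (u i) (\sum_j F j) = \sum_j act (u i) (F j).
  exact: raddf_sum.
have uval i j (x : N j) : i != j -> act (u i) (fix_val x) = 0.
  by move=> ij; rewrite -(fix_valP x) -actM uij.
have iso : rep_iso rho (dsum_rep sigma) fl.
  split; last first.
    move=> h m; apply: functional_extensionality_dep => i; apply: fix_val_inj.
    by rewrite [RHS]sigmaE /= act_comm.
  exists g => [m|y].
    by rewrite /g /= -act_sum u1 act1.
  apply: functional_extensionality_dep => i; apply: fix_val_inj.
  rewrite /= /g actsum (bigD1 i) //= fix_valP big1 ?addr0 // => j ji.
  by rewrite uval // eq_sym.
exists (Decomposition iso) => i; apply: act_inj => m; rewrite proj_idemE.
apply: (comp_eq (D := Decomposition iso)) => j.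
have [<-|ij] := eqVneq i j.
  by rewrite pr_inj; apply: fix_val_inj; rewrite /= -actM uu.
rewrite pr_inj_neq //; apply: fix_val_inj; rewrite /= -actM uij //.
by rewrite eq_sym.
Qed.

Section CornerLocal.
Variables (R1 R2 : pzRingType) (c : R1 -> R2).
Hypothesis emb : nu_embedding c.
Hypothesis ce : forall x, (exists y, c y = x) <-> c 1 * x = x /\ x * c 1 = x.

Lemma corner_primitive : primitive_idem (c 1) <-> primitive_idem (1 : R1).
Proof.
have [cD cM cI] := emb; have c1 y : c 1 * c y = c y by rewrite -cM mul1r.
split=> -[ee e0 prim]; split.
- by rewrite mulr1.
- by move=> e1; apply: e0; rewrite e1 (emb0 emb).
- move=> g gg _ _; have [||||cg] := prim (c g); rewrite -?cM ?gg ?mul1r ?mulr1 //.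
    by move/(emb_eq0 emb); left.
  by right; apply: cI.
- by rewrite -cM mulr1.
- by move/(emb_eq0 emb).
- move=> g gg eg ge; have [y yg] := (ce g).2 (conj eg ge).
  have yy : y * y = y by apply: cI; rewrite cM yg.
  have [||y0|y1] := prim y yy; rewrite ?mul1r ?mulr1 //.
    by left; rewrite -yg y0 (emb0 emb).
  by right; rewrite -yg y1.
Qed.

Lemma corner_local : local_idem (c 1) -> local_idem (1 : R1).
Proof.
have [cD cM cI] := emb => -[ee e0 loc]; split.
- by rewrite mulr1.
- by move=> e1; apply: e0; rewrite e1 (emb0 emb).
have inv x : corner_inv (c 1) (c x) -> corner_inv 1 x.
  move=> [y [ey ye xy yx]]; have [z zy] := (ce y).2 (conj ey ye).
  exists z; rewrite mul1r mulr1; split=> //; apply: cI; rewrite cM zy //.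
move=> x _ _; have [||/inv xinv|] := loc (c x); rewrite -?cM ?mul1r ?mulr1 //.
  by left.
by rewrite -(embB emb) => /inv; right.
Qed.

End CornerLocal.

(** The nonunits form a right ideal, by [local_nonunitD] and because right invertible elements are
    invertible; every proper right ideal consists of nonunits. *)
Lemma local_idem_local_ring (R : pzRingType) : local_idem (1 : R) -> local_ring R.
Proof.
move=> loc; have prim := local_primitive loc.
pose m := [set x : R | ~ corner_inv 1 x].
have unitT (J : set R) x : right_ideal J -> J x -> corner_inv 1 x -> J = setT.
  by move=> rJ Jx [y [_ _ xy _]]; apply: right_ideal1 => //; rewrite -xy; exact: right_idealM.
have inv1 : corner_inv (1 : R) 1 by exists 1; rewrite mulr1.
have mT : m != setT.
  by apply/eqP => mE; have : m 1 by rewrite mE.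
have rm : right_ideal m.
  split=> [[y [_ _ y1 _]]|x y mx my xy|x r mx [y [_ _ xy yx]]].
  - by have [_ n10 _] := loc; apply: n10; rewrite -y1 mul0r.
  - have [//|[z [_ _ yz zy]]] := local_nonunitD loc (mul1r _) (mulr1 _) (mul1r _) (mulr1 _) xy.
    by apply: my; exists (- z); rewrite mul1r mulr1 mulrN mulNr -mulNr -mulrN.
  - apply: mx; exists (r * y); rewrite mul1r mulr1; split=> //; first by rewrite mulrA.
    by apply: (primitive_right_inv prim); rewrite ?mul1r ?mulr1 ?mulrA.
have maxm : maximal_right_ideal m.
  split=> // J rJ mJ; have [JE|nJ] := pselect (J `<=` m); [left|right].
    by apply/seteqP.
  have [x [Jx nmx]] : exists x, J x /\ ~ m x.
    by apply: contrapT => nox; apply: nJ => x Jx; apply: contrapT => nmx; apply: nox; exists x.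
  by apply: (unitT J x) => //; exact: contrapT.
exists m => // n [rn nT maxn].
have nm : n `<=` m by move=> x nx xinv; move/eqP: nT; apply; exact: unitT nx xinv.
by have [|/eqP] := maxn m rm nm; [|rewrite (negPf mT)].
Qed.

Lemma indecomposable_primitive (R : pzRingType) (G : monoid_or_ring) (M : lmodType R^c)
    (rho : representation G M) :
  indecomposable rho <-> primitive_idem (1 : endrep rho setT).
Proof.
split=> [[nz ind]|[_ n10 prim]].
  split; first by rewrite mulr1.
    by move=> e10; apply: nz => m; rewrite -[m](act1 rho setT) e10.
  move=> g gg _ _; pose u (i : 'I_2) := if i == ord0 then g else 1 - g.
  have [|||D Du] := @idem_decomposition _ _ _ rho 2 u.
  - move=> i; rewrite /u; case: ifP => // _.
    by rewrite mulrBl !mulrBr !mul1r mulr1 gg subrr subr0.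
  - move=> i j; rewrite /u; case: (i =P ord0) => [->|/eqP i0]; case: (j =P ord0) => [->|/eqP j0] //.
    + by rewrite mulrBr mulr1 gg subrr.
    + by rewrite mulrBl mul1r gg subrr.
    + case: i i0 => [[|[|//]] ? //] _; case: j j0 => [[|[|//]] ? //] _.
  - by rewrite big_ord_recl big_ord1 /u /= addrC subrK.
  have [i /proj_idem0] := ind D; rewrite Du /u; case: ifP => _ ; first by left.
  by move/eqP; rewrite subr_eq0 => /eqP; right.
split=> [zM|D]; first by apply: n10; apply: act_inj => m; rewrite (zM m) raddf0.
have [|||e0|e1] := prim (proj_idem D ord0); rewrite ?mul1r ?mulr1 //.
- exact: proj_idem_idem.
- by exists ord0; apply/proj_idem0.
exists ord_max; apply/proj_idem0.
by have := proj_idem_orth D (isT : ord0 != ord_max :> 'I_2); rewrite e1 mul1r.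
Qed.

(** Indecomposability makes the idempotents of a competing decomposition primitive, which is what
    [azumaya] asks of its second family. *)
Lemma semiperfect_krull_schmidt (R : pzRingType) (G : monoid_or_ring) (M : lmodType R^c)
    (rho : representation G M) : semiperfect (endrep rho setT) ->
  exists t (D : decomposition rho t), krull_schmidt D /\ forall i, local_idem (proj_idem D i).
Proof.
move=> sp; have [sl _] := sp.
have [t [u [up uij u1]]] :=
  idem_sum_ord (orthogonal_finite_primitive (semilocal_orthogonal_finite sl)).
have uloc i := semiperfect_primitive_local sp (up i).
have uu i : u i * u i = u i by case: (up i).
have [D Du] := idem_decomposition uu uij u1; exists t, D.
have Dloc i : local_idem (proj_idem D i) by rewrite Du.
split=> //; split=> [i|t' D' ind'].
  apply/indecomposable_primitive/(corner_primitive (component_emb D i)).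
    exact: component_corner.
  by apply: local_primitive; exact: Dloc.
have [|||||f [finj fT fiso]] :=
    @azumaya _ _ _ (proj_idem D) [set: 'I_t]%SET (proj_idem D') [set: 'I_t']%SET.
- by move=> i _; exact: Dloc.
- by move=> i j _ _; exact: proj_idem_orth.
- move=> j _; apply/(corner_primitive (component_emb D' j)).
    exact: component_corner.
  exact/indecomposable_primitive.
- by move=> i j _ _; exact: proj_idem_orth.
- have sumT t0 (D0 : decomposition rho t0) :
      \sum_(i in [set: 'I_t0]%SET) proj_idem D0 i = 1.
    by rewrite -[RHS](proj_idem_sum D0); apply: eq_bigl => i; rewrite inE.
  by rewrite !sumT; exists 1, 1; rewrite mulr1.
have sP i : exists j, f i = Some j.
  have : f i \in Some @: [set: 'I_t']%SET by rewrite -fT imset_f // inE.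
  by case/imsetP => j _ ->; exists j.
have [s sf] := choice sP.
exists s; last by move=> i; apply: idem_iso_reps; apply: fiso; rewrite ?inE.
have tP j : exists i, s i = j.
  have : Some j \in f @: [set: 'I_t]%SET by rewrite fT imset_f // inE.
  by case/imsetP => i _; rewrite sf => -[->]; exists i.
have [r rs] := choice tP; exists r => // i.
by apply: finj; rewrite ?inE // !sf rs.
Qed.

(** * The embedding of [End(rho)] into [End(rho|_H)] *)

Section Restriction.
Variables (R : pzRingType) (G : monoid_or_ring) (M : lmodType R^c).
Variables (rho : representation G M) (H : set G).

Lemma restrict_ex (x : endrep rho setT) :
  exists y : endrep rho H, endrep_val y = endrep_val x.
Proof.
case: x => f hf; have /asboolP fc := hf.
have fH : f \in commutant rho H by apply/asboolP => g _; exact: fc.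
by exists (EndRep fH).
Qed.

Definition restrict x : endrep rho H := projT1 (cid (restrict_ex x)).

Lemma restrictE x : endrep_val (restrict x) = endrep_val x.
Proof. by rewrite /restrict; case: cid. Qed.

Lemma restrict_emb : nu_embedding restrict.
Proof.
have [vD vM vI] := endrep_val_emb rho H; have [wD wM wI] := endrep_val_emb rho setT.
split.
- by move=> x y; apply: vI; rewrite vD !restrictE wD.
- by move=> x y; apply: vI; rewrite vM !restrictE wM.
- by move=> x y xy; apply: wI; rewrite -!restrictE xy.
Qed.

Lemma endrep_val_image (f : endo M) : (exists x : endrep rho setT, endrep_val x = f) <->
  forall s, range rho s -> s * f = f * s.
Proof.
split=> [[[h hc] /= <-] _ [g _ <-]|fc].
  by have /asboolP/(_ g I) := hc.
have fT : f \in commutant rho setT.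
  by apply/asboolP => g _; apply/esym/fc; exists g.
by exists (EndRep fT).
Qed.

Lemma restrict_image (x : endrep rho H) : (exists y, restrict y = x) <->
  forall s, range rho s -> s * endrep_val x = endrep_val x * s.
Proof.
rewrite -endrep_val_image; have [_ _ vI] := endrep_val_emb rho H.
split=> [[y <-]|[y yx]]; first by exists y; rewrite restrictE.
by exists y; apply: vI; rewrite restrictE.
Qed.

Lemma initial_restrict (tau : set (set (endo M))) :
  initial_topology restrict (endrep_topology (rho := rho) (H := H) tau) =
  endrep_topology (rho := rho) (H := setT) tau.
Proof.
have valE (V : set (endo M)) :
    restrict @^-1` ((@endrep_val R G M rho H) @^-1` V) = (@endrep_val R G M rho setT) @^-1` V.
  by apply/seteqP; split=> x; rewrite /preimage /= restrictE.
apply/seteqP; split=> [_ [_ [V tV <-] <-]|_ [V tV <-]]; first by exists V; rewrite // valE.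
by exists ((@endrep_val R G M rho H) @^-1` V); [exists V|exact: valE].
Qed.

End Restriction.

Lemma initial_id (T : Type) (tau : set (set T)) : initial_topology id tau = tau.
Proof.
by apply/seteqP; split=> [_ [V tV <-] //|V tV]; exists V.
Qed.

Lemma id_emb (R : pzRingType) : nu_embedding (@id R).
Proof. by split. Qed.

(** * Transfer to [End(rho)] and to the endomorphism rings of its summands *)

Section EndrepProperties.
Variables (R : pzRingType) (G : monoid_or_ring) (M : lmodType R^c).
Variables (rho : representation G M).

Lemma endrep_disc (Q : disc_property) : has_disc Q (endo M) -> has_disc Q (endrep rho setT).
Proof.
apply: has_disc_closed (endrep_val_emb rho setT) _.
have := centralizer_gdrazin_closed (id_emb _) (@discrete_linear _)
  (@discrete_hausdorff _) (endrep_val_image rho).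
by rewrite initial_id.
Qed.

Lemma endrep_top (P : top_property) (tau : set (set (endo M))) : has_top P tau ->
  has_top P (endrep_topology (rho := rho) (H := setT) tau).
Proof.
move=> Ptau; have [lin _] := Ptau; have hd := has_top_hausdorff Ptau.
apply: (has_top_emb (endrep_val_emb rho setT) lin) => //; rewrite -[tau]initial_id.
- exact: (centralizer_gdrazin_closed (id_emb _) lin hd (endrep_val_image rho)).
- exact: (centralizer_closed_image lin hd (endrep_val_image rho)).
Qed.

Lemma restrict_disc (Q : disc_property) (H : set G) :
  has_disc Q (endrep rho H) -> has_disc Q (endrep rho setT).
Proof.
have vemb := endrep_val_emb rho H; have [_ _ vI] := vemb.
apply: has_disc_closed (restrict_emb rho H) _; rewrite -(initial_discrete vI).
exact: (centralizer_gdrazin_closed vemb (@discrete_linear _)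
  (@discrete_hausdorff _) (@restrict_image _ _ _ rho H)).
Qed.

Lemma restrict_top (P : top_property) (H : set G) (tau : set (set (endo M))) :
  linear_topology tau -> hausdorff tau ->
  has_top P (endrep_topology (rho := rho) (H := H) tau) ->
  has_top P (endrep_topology (rho := rho) (H := setT) tau).
Proof.
move=> lin hd Ptau; have [linH _] := Ptau; rewrite -(initial_restrict rho H).
have vemb := endrep_val_emb rho H.
apply: (has_top_emb (restrict_emb rho H) linH) => //.
- exact: (centralizer_gdrazin_closed vemb lin hd (@restrict_image _ _ _ rho H)).
- exact: (centralizer_closed_image lin hd (@restrict_image _ _ _ rho H)).
Qed.

Variables (t : nat) (D : decomposition rho t) (i : 'I_t).

Lemma summand_disc (Q : disc_property) :
  has_disc Q (endrep rho setT) -> has_disc Q (endrep (summand D i) setT).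
Proof.
apply: has_disc_closed (component_emb D i) _.
exact: (corner_gdrazin_closed _ (@component_corner _ _ _ _ _ D i)).
Qed.

Lemma summand_top (P : top_property) (tau : set (set (endrep rho setT))) :
  has_top P tau -> has_top P (initial_topology (@component _ _ _ _ _ D i) tau).
Proof.
move=> Ptau; have [lin _] := Ptau; have hd := has_top_hausdorff Ptau.
apply: (has_top_emb (component_emb D i) lin) => //.
- exact: (corner_gdrazin_closed _ (@component_corner _ _ _ _ _ D i)).
- exact: (corner_closed_image (@component_corner _ _ _ _ _ D i) lin hd).
Qed.

Lemma summand_local : local_idem (proj_idem D i) -> local_ring (endrep (summand D i) setT).
Proof.
move=> loc; apply: local_idem_local_ring; apply: (corner_local (component_emb D i)) => //.
exact: component_corner.
Qed.

End EndrepProperties.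

Theorem corollary7p7 (R : pzRingType) (G : monoid_or_ring)
    (M : lmodType R^c) (rho : representation G M) :
  (* cases (i) and (ii): no topology is specified *)
  (forall P : ring_property,
     has_property P (endo M) \/
     (exists (Q : disc_property) (H : set G),
        [/\ P = Disc Q, subobject H & has_disc Q (endrep rho H)]) ->
     has_property P (endrep rho setT) /\
     (implies_semiperfect P ->
      exists (t : nat) (D : decomposition rho t),
        krull_schmidt D /\
        forall i : 'I_t,
          local_ring (endrep (summand D i) setT) /\
          has_property P (endrep (summand D i) setT)))
  /\
  (* case (iii): [tau] is the topology of End(M), and all the endomorphism
     rings carry the topology induced by it *)
  (forall (tau : set (set (endo M))) (P : top_property),
     linear_topology tau -> hausdorff tau ->
     (exists H : set G,
        subobject H /\ has_top P (endrep_topology (rho := rho) (H := H) tau)) ->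
     has_top P (endrep_topology (rho := rho) (H := setT) tau) /\
     (implies_semiperfect (Top P) ->
      exists (t : nat) (D : decomposition rho t),
        krull_schmidt D /\
        forall i : 'I_t,
          local_ring (endrep (summand D i) setT) /\
          has_top P (summand_topology tau (D := D) (i := i)))).
Proof.
split=> [P hyp|tau P lin hd [H [_ PH]]].
  have PT : has_property P (endrep rho setT).
    case: hyp => [|[Q [H [-> _ QH]]]]; last exact: restrict_disc QH.
    case: P => [Q QE|P [tau Ptau]]; first exact: endrep_disc.
    by exists (endrep_topology (rho := rho) (H := setT) tau); exact: endrep_top.
  split=> // /(_ _ PT)/semiperfect_krull_schmidt[t [D [KS Dloc]]]; exists t, D.
  split=> // i; split; first exact: summand_local.
  case: P PT {hyp} => [Q QE|P [tau Ptau]]; first exact: summand_disc.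
  by exists (initial_topology (@component _ _ _ _ _ D i) tau); exact: summand_top.
have PT := restrict_top lin hd PH; split=> // sp.
have [|t [D [KS Dloc]]] := @semiperfect_krull_schmidt R G M rho.
  (* [implies_semiperfect] speaks of rings without specified topology, so the induced topology is
     supplied as the witness. *)
  by apply: (sp (endrep rho setT)); exists (endrep_topology (rho := rho) (H := setT) tau).
exists t, D; split=> // i; split; first exact: summand_local.
by rewrite summand_topologyE; exact: summand_top.
Qed.
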